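(* Let $\mathcal V^\alpha$ denote the vacant set of two-dimensional random interlacements at level $\alpha>0$. (i) For any $\alpha>0$, $x\in\mathbb Z^2$ and finite $A\subset\mathbb Z^2$, $\mathbb P[A\subset\mathcal V^\alpha\mid x\in\mathcal V^\alpha]=\mathbb P[-A+x\subset\mathcal V^\alpha\mid x\in\mathcal V^\alpha]$. More generally, for $x\ne0$ and any isometry $M$ of the lattice $\mathbb Z^2$ exchanging $0$ and $x$, $\mathbb P[A\subset\mathcal V^\alpha\mid x\in\mathcal V^\alpha]=\mathbb P[MA\subset\mathcal V^\alpha\mid x\in\mathcal V^\alpha]$. (ii) $\mathbb P[x\in\mathcal V^\alpha]=\exp(-\pi\alpha a(x)/2)=e^{-\gamma'\pi\alpha/2}\|x\|^{-\alpha}(1+O(\|x\|^{-2}))$ as $\|x\|\to\infty$. (iii) For $A$ with $0\in A\subset B(r)$ and $x\in\mathbb Z^2$ with $\|x\|\ge 2r$, $$\mathbb P[A\subset\mathcal V^\alpha\mid x\in\mathcal V^\alpha]=\exp\Big(-\frac{\pi\alpha}{4}\mathrm{cap}(A)\frac{1+O\big(\frac{r\ln r\ln\|x\|}{\|x\|}\big)}{1-\frac{\mathrm{cap}(A)}{2a(x)}+O\big(\frac{r\ln r}{\|x\|}\big)}\Big).$$ (iv) For $x,y\ne0$, $x\ne y$, $\mathbb P[\{x,y\}\subset\mathcal V^\alpha]=\exp(-\pi\alpha\Psi)$ with $$\Psi=\frac{a(x)a(y)a(x-y)}{a(x)a(y)+a(x)a(x-y)+a(y)a(x-y)-\frac12(a^2(x)+a^2(y)+a^2(x-y))}.$$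 Moreover, if $s:=\|x\|\to\infty$ with $\ln\|y\|\sim\ln s$ and $\ln\|x-y\|\sim\beta\ln s$ for some $\beta\in[0,1]$, then $\mathbb P[\{x,y\}\subset\mathcal V^\alpha]=s^{-\frac{4\alpha}{4-\beta}+o(1)}$ and $\mathrm{Cor}(\mathbf 1\{x\in\mathcal V^\alpha\},\mathbf 1\{y\in\mathcal V^\alpha\})=s^{-\frac{\alpha\beta}{4-\beta}+o(1)}$. (v) If $\ln\|x\|\sim\ln s$ and $\ln r\sim\beta\ln s$ with $\beta<1$, then as $s\to\infty$, $\mathbb P[B(x,r)\subset\mathcal V^\alpha]=s^{-\frac{2\alpha}{2-\beta}+o(1)}$.
   Context: Let $(S_k)_{k\ge 0}$ be simple random walk on $\mathbb Z^2$ and $P_x$ its law when $S_0=x$. Write $\|\cdot\|$ for the Euclidean norm, $y\sim x$ for nearest neighbours, $B(x,r)=\{y\in\mathbb Z^2:\|y-x\|\le r\}$ for $x\in\mathbb Z^2$, real $r>0$, and $B(r)=B(0,r)$. Let $\tau_1(A)=\inf\{k\ge1:S_k\in A\}$. The potential kernel is $a(x)=\sum_{k\ge0}(P_0[S_k=0]-P_x[S_k=0])$; it satisfies $a(0)=0$, $a(x)>0$ for $x\ne0$, $\frac14\sum_{y\sim x}a(y)=a(x)$ for $x\neq 0$, and $a(x)=\frac2\pi\ln\|x\|+\gamma'+O(\|x\|^{-2})$ for a constant $\gamma'$. For finite nonempty $A\subset\mathbb Z^2$, the harmonic measure is $\mathrm{hm}_A(x)=\lim_{\|y\|\to\infty}P_y[S_{\tau_1(A)}=x]$.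 For finite $A\ni 0$, $\mathrm{cap}(A)=\sum_{x\in A}a(x)\mathrm{hm}_A(x)$; for finite nonempty $A\not\ni0$, $\mathrm{cap}(A)=\mathrm{cap}(A-z)$ for any $z\in A$. The conditioned walk $\widehat S$ is the Markov chain on $\mathbb Z^2\setminus\{0\}$ with transition probabilities $a(y)/(4a(x))$ for $y\sim x$; it is transient; $\widehat P_x$ is its law from $x$, $\widehat\tau_1(A)=\inf\{k\ge1:\widehat S_k\in A\}$. Let $\widehat e_A(x)=\mathbf 1\{x\in A\}\widehat P_x[\widehat\tau_1(A)=\infty]a(x)^2$ and $\widehat{\mathrm{cap}}(A)=\sum_x\widehat e_A(x)$. Two-dimensional random interlacements: let $W$ be the set of doubly infinite nearest-neighbour paths in $\mathbb Z^2$ visiting each site finitely often, $W^*$ the quotient by time shifts, $\chi^*$ the projection. There is a unique $\sigma$-finite measure $\nu$ on $W^*$ such that for each finite $A$, $\nu$ restricted to trajectories hitting $A$ is the image under $\chi^*$ of the measure $Q_A$ given by $Q_A[(\varrho_k)_{k\ge1}\in F,\varrho_0=x,(\varrho_{-k})_{k\ge1}\in G]=\widehat e_A(x)\widehat P_x[F]\widehat P_x[G\mid\widehat\tau_1(A)=\infty]$. Take a Poisson point process $\sum_\lambda\delta_{(w_\lambda^*,u_\lambda)}$ on $W^*\times\mathbb R_+$ with intensity $\nu\otimes du$; random interlacements at level $\alpha$ consist of the trajectories with $u_\lambda\le\pi\alpha$, and the vacant set $\mathcal V^\alpha$ is the set of sites of $\mathbb Z^2$ visited by none of them. Equivalently,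 on a finite set $A$, one sees a Poisson($\pi\alpha\widehat{\mathrm{cap}}(A)$) number of independent $\widehat S$-walks started from the normalized $\widehat e_A$. In particular $0\in\mathcal V^\alpha$ a.s. and $\mathbb P[A\subset\mathcal V^\alpha]=\exp(-\pi\alpha\,\mathrm{cap}(A))$ for every finite $A\ni0$. For events $E,F$, $\mathrm{Cor}(E,F)=\mathrm{Cov}(\mathbf 1_E,\mathbf 1_F)/\sqrt{\mathrm{Var}(\mathbf 1_E)\mathrm{Var}(\mathbf 1_F)}$. $O(g)$ denotes a quantity bounded in absolute value by a constant times $g$.
   Formalization: In (iii) r ≥ 2 is assumed (at r = 1 the error terms vanish and the formula fails); in (v) 0 ≤ β < 1 (for β < 0 the ball is {x} and the exponent is −α). P[A ⊂ V^α] is taken as exp(−πα ĉap(A)), from the Poisson description on finite sets. *)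

(* Defs.v *)
From Stdlib Require Import Reals Lra Lia ZArith List ClassicalEpsilon.
Open Scope R_scope.

Definition pt := (Z * Z)%type.
Definition pt_eq_dec : forall u v : pt, {u = v} + {u <> v}.
Proof. decide equality; apply Z.eq_dec. Defined.
Definition padd (u v : pt) : pt := ((fst u + fst v)%Z, (snd u + snd v)%Z).
Definition psub (u v : pt) : pt := ((fst u - fst v)%Z, (snd u - snd v)%Z).
Definition origin : pt := (0%Z, 0%Z).
Definition norm (u : pt) : R := sqrt (IZR (fst u) ^ 2 + IZR (snd u) ^ 2).
Definition dirs : list pt :=
  (1%Z, 0%Z) :: ((-1)%Z, 0%Z) :: (0%Z, 1%Z) :: (0%Z, (-1)%Z) :: nil.

Definition lsum {A : Type} (f : A -> R) (l : list A) : R :=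
  fold_right (fun a s => f a + s) 0 l.

(** Limits, chosen by classical choice (the value is the limit whenever it exists) *)
Definition Lim (u : nat -> R) : R :=
  epsilon (inhabits 0) (fun l => Un_cv u l).
Definition LimInf (f : pt -> R) : R :=
  epsilon (inhabits 0) (fun L => forall eps, 0 < eps ->
     exists R0, forall y, R0 <= norm y -> Rabs (f y - L) < eps).

Definition memb (z : pt) (A : list pt) : bool :=
  existsb (fun w => if pt_eq_dec z w then true else false) A.
Definition dedup (A : list pt) : list pt := nodup pt_eq_dec A.

Fixpoint p_srw (n : nat) (x y : pt) : R :=
  match n with
  | O => if pt_eq_dec x y then 1 else 0
  | S m => lsum (fun e => / 4 * p_srw m (padd x e) y) dirs
  end.

Definition pot (x : pt) : R :=
  Lim (fun n => sum_f_R0 (fun k => p_srw k origin origin - p_srw k x origin) n).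

(** P_y[tau_1(A) <= n, S_{tau_1(A)} = x] *)
Fixpoint hit_at (n : nat) (A : list pt) (x y : pt) : R :=
  match n with
  | O => 0
  | S m => lsum (fun e => / 4 *
             (if memb (padd y e) A
              then (if pt_eq_dec (padd y e) x then 1 else 0)
              else hit_at m A x (padd y e))) dirs
  end.

Definition hm (A : list pt) (x : pt) : R :=
  LimInf (fun y => Lim (fun n => hit_at n A x y)).

Definition cap0 (A : list pt) : R := lsum (fun x => pot x * hm A x) (dedup A).
Definition cap (A : list pt) : R :=
  if memb origin A then cap0 A
  else match A with
       | nil => 0
       | z :: _ => cap0 (map (fun w => psub w z) A)
       end.

(** conditioned walk: P^_x[hat tau_1(A) <= n], transitions a(y)/(4a(x)) *)
Fixpoint ret_hat (n : nat) (A : list pt) (x : pt) : R :=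
  match n with
  | O => 0
  | S m => lsum (fun e => pot (padd x e) / (4 * pot x) *
             (if memb (padd x e) A then 1 else ret_hat m A (padd x e))) dirs
  end.
Definition escape_hat (A : list pt) (x : pt) : R := 1 - Lim (fun n => ret_hat n A x).
Definition ehat (A : list pt) (x : pt) : R :=
  if memb x A then escape_hat A x * pot x ^ 2 else 0.
Definition caphat (A : list pt) : R := lsum (ehat A) (dedup A).

(** P[A subset V^alpha]: the number of interlacement trajectories (level alpha)
    hitting A is Poisson(pi alpha caphat(A)) *)
Definition vac (alpha : R) (A : list pt) : R := exp (- (PI * alpha * caphat A)).
Definition cond (alpha : R) (A : list pt) (x : pt) : R :=
  vac alpha (x :: A) / vac alpha (x :: nil).
Definition cor (alpha : R) (x y : pt) : R :=
  let px := vac alpha (x :: nil) in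
  let py := vac alpha (y :: nil) in
  let pxy := vac alpha (x :: y :: nil) in
  (pxy - px * py) / sqrt (px * (1 - px) * (py * (1 - py))).

Definition isometry (M : pt -> pt) : Prop :=
  forall u v, norm (psub (M u) (M v)) = norm (psub u v).

(** the constant gamma' in a(x) = 2/pi ln||x|| + gamma' + O(||x||^-2) *)
Definition gamma' : R := LimInf (fun x => pot x - 2 / PI * ln (norm x)).

Definition zrange (c : Z) (m : nat) : list Z :=
  map (fun k => (c - Z.of_nat m + Z.of_nat k)%Z) (seq 0 (2 * m + 1)).
Definition ball (x : pt) (r : R) : list pt :=
  let m := Z.to_nat (up r) in
  filter (fun y => if Rle_dec (norm (psub y x)) r then true else false)
         (list_prod (zrange (fst x) m) (zrange (snd x) m)).

Definition Psi (x y : pt) : R :=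
  let ax := pot x in let ay := pot y in let axy := pot (psub x y) in
  ax * ay * axy /
  (ax * ay + ax * axy + ay * axy - / 2 * (ax ^ 2 + ay ^ 2 + axy ^ 2)).

(* Main.v *)
(** Equilibrium problem: on a finite set [S] containing the origin, find a probability measure [g] whose potential [sum_z g(z) a(y - z)] is a constant [c] on [S].  Symmetry of [a] makes [c] unique.  Both [cap] and [caphat] are such constants.  For [caphat], the discrete Laplacian of [a(y) * P^_y(no visit to A)] is such a [g], because that function differs from [a] by a bounded one.  For [cap], pairing hitting probabilities with [g] shows that [g] is harmonic measure.  So [caphat A] is the capacity of [A] together with the origin, and the theorem becomes a collection of statements about the kernel [a] on explicit sets: invariance under lattice isometries, two points, a distant point added to [A], three points, a ball and a distant point.

Everything rests on a discrete Liouville theorem for bounded harmonic functions.  It turns a bounded function that is harmonic off a finite set into a constant plus a potential, and it identifies [a] with the integral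

  (2 / PI) * int_0^(PI/2) (1 - E(t)^|n| cos(2 m t)) / (sin t * rho t) dt,   rho^2 = 1 + sin^2,   E = (rho - sin)^2.

For [|m| <= |n|], replacing the integrand by [(1 - exp(-2 |n| t) cos(2 m t)) / t] costs [O(n^-2)] beyond a constant, even without using the oscillation of the cosine; the new integral is [ln (n^2 + m^2) / 2] plus a constant, with an error [O(n^-2)]. *)
From Coquelicot Require Import Coquelicot.
Require Import Defs.
From Stdlib Require Import Reals List ZArith Lra Lia Psatz ClassicalEpsilon Permutation.
Open Scope R_scope.

(** The limits in the definitions are picked by classical choice, so each of them is opaque until
    convergence is proved. For [pot] the obstacle is parity: [p k origin - p k x] keeps a sign only
    at even sites, where the partial sums increase. An odd site has only even neighbours, and its
    value is their average up to a return probability, which must be shown to vanish. Bounds uniform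
    in the truncation come from a maximum principle, not from Fourier analysis of the walk.

    The Liouville theorem is used on increments: a harmonic function with bounded increments is
    affine, and evenness or boundedness removes the linear part. Crude step bounds therefore suffice
    to identify the integral.

    The conditioned walk is a Doob transform. Multiplication by [pot] turns its hitting
    probabilities into averages for simple random walk, and the weight a^2 times escape probability
    into a times a Laplacian. This makes [caphat] the value at the origin of a potential, and
    explicit capacities follow from linear equations and the symmetry of the kernel. *)

Definition avg (f : pt -> R) (x : pt) : R := lsum (fun e => / 4 * f (padd x e)) dirs.
Definition lap (f : pt -> R) (x : pt) : R := avg f x - f x.
Definition popp (x : pt) : pt := psub origin x.
Definition delta0 (x : pt) : R := if pt_eq_dec x origin then 1 else 0.

Lemma avg_eq f x1 x2 :
  avg f (x1, x2) = / 4 * (f ((x1 + 1)%Z, x2) + f ((x1 - 1)%Z, x2)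
                          + f (x1, (x2 + 1)%Z) + f (x1, (x2 - 1)%Z)).
Proof.
  unfold avg, dirs, lsum, padd; cbn [fold_right fst snd].
  rewrite !Z.add_0_r; unfold Z.sub; cbn [Z.opp]; ring.
Qed.

Lemma avg_ext f g x : (forall e, In e dirs -> f (padd x e) = g (padd x e)) -> avg f x = avg g x.
Proof.
  intros H; unfold avg, lsum, dirs in *; cbn [fold_right].
  rewrite !H by (cbn; tauto); reflexivity.
Qed.

Lemma avg_le f g x : (forall e, In e dirs -> f (padd x e) <= g (padd x e)) -> avg f x <= avg g x.
Proof.
  intros H; unfold avg, lsum, dirs in *; cbn [fold_right].
  pose proof (H (1, 0)%Z ltac:(cbn; tauto)); pose proof (H (-1, 0)%Z ltac:(cbn; tauto)).
  pose proof (H (0, 1)%Z ltac:(cbn; tauto)); pose proof (H (0, -1)%Z ltac:(cbn; tauto)).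
  lra.
Qed.

Lemma avg_plus f g x : avg (fun y => f y + g y) x = avg f x + avg g x.
Proof. destruct x; rewrite !avg_eq; ring. Qed.

Lemma avg_minus f g x : avg (fun y => f y - g y) x = avg f x - avg g x.
Proof. destruct x; rewrite !avg_eq; ring. Qed.

Lemma avg_scal c f x : avg (fun y => c * f y) x = c * avg f x.
Proof. destruct x; rewrite !avg_eq; ring. Qed.

Lemma avg_const c x : avg (fun _ => c) x = c.
Proof. destruct x; rewrite !avg_eq; field. Qed.

Lemma padd_comm x y : padd x y = padd y x.
Proof. unfold padd; f_equal; lia. Qed.

Lemma padd_assoc x y z : padd x (padd y z) = padd (padd x y) z.
Proof. unfold padd; cbn; f_equal; lia. Qed.

Lemma avg_shift f z x : avg (fun y => f (padd y z)) x = avg f (padd x z).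
Proof.
  unfold avg, dirs, lsum; cbn [fold_right].
  rewrite <- !padd_assoc, !(padd_comm _ z), !padd_assoc; reflexivity.
Qed.

Lemma psub_padd x z : psub x z = padd x (popp z).
Proof. unfold psub, popp, padd, psub, origin; cbn; f_equal; lia. Qed.

Lemma avg_shift_sub f z x : avg (fun y => f (psub y z)) x = avg f (psub x z).
Proof.
  rewrite psub_padd, <- avg_shift; apply avg_ext; intros; now rewrite psub_padd.
Qed.

Lemma psub_eq_origin x z : psub x z = origin <-> x = z.
Proof.
  destruct x, z; unfold psub, origin; cbn; split; intros H; injection H; intros; f_equal; lia.
Qed.

Lemma un_cv_avg (f : nat -> pt -> R) g x :
  (forall e, In e dirs -> Un_cv (fun n => f n (padd x e)) (g (padd x e))) ->
  Un_cv (fun n => avg (f n) x) (avg g x).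
Proof.
  intros H. unfold avg, lsum, dirs in *; cbn [fold_right].
  repeat (apply CV_plus || apply CV_mult ||
          (apply H; cbn; tauto) ||
          (intros eps Heps; exists O; intros; unfold Rdist; rewrite Rminus_diag, Rabs_R0; exact Heps)).
Qed.

Lemma un_cv_const c : Un_cv (fun _ => c) c.
Proof. intros eps Heps; exists O; intros; unfold Rdist; rewrite Rminus_diag, Rabs_R0; exact Heps. Qed.

Lemma un_cv_S u l : Un_cv u l -> Un_cv (fun n => u (S n)) l.
Proof. intros H eps Heps. destruct (H eps Heps) as [N HN]. exists N; intros; apply HN; lia. Qed.

Lemma un_cv_S_inv u l : Un_cv (fun n => u (S n)) l -> Un_cv u l.
Proof.
  intros H eps Heps. destruct (H eps Heps) as [N HN]. exists (S N); intros [|n] Hn; [lia|].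
  apply HN; lia.
Qed.

Lemma Lim_spec u l : Un_cv u l -> Lim u = l.
Proof.
  intros H; unfold Lim.
  apply (UL_sequence u); [ | exact H ].
  apply epsilon_spec; now exists l.
Qed.

(** ** One-dimensional walk *)

Fixpoint q (k : nat) (v : Z) : R :=
  match k with
  | O => if Z.eq_dec v 0 then 1 else 0
  | S k => / 2 * (q k (v - 1)%Z + q k (v + 1)%Z)
  end.

Lemma q_pos k v : 0 <= q k v.
Proof.
  revert v; induction k as [|k IH]; intros v; cbn [q].
  - destruct Z.eq_dec; lra.
  - pose proof (IH (v - 1)%Z); pose proof (IH (v + 1)%Z); lra.
Qed.

Lemma q_opp k v : q k (- v)%Z = q k v.
Proof.
  revert v; induction k as [|k IH]; intros v; cbn [q].
  - destruct (Z.eq_dec (- v) 0), (Z.eq_dec v 0); reflexivity || lia.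
  - rewrite <- (IH (- v - 1)%Z), <- (IH (- v + 1)%Z), Rplus_comm.
    do 3 f_equal; lia.
Qed.

(** The walk charges one parity class at each time, so values two apart are compared. The range
    starts at [-1], where symmetry gives equality, because the induction at [v = 0] calls on
    [v - 1]. *)
Lemma q_unimodal k v : (-1 <= v)%Z -> q k (v + 2) <= q k v.
Proof.
  revert v; induction k as [|k IH]; intros v Hv; cbn [q].
  - destruct (Z.eq_dec (v + 2) 0), (Z.eq_dec v 0); lra || lia.
  - destruct (Z.eq_dec v (-1)) as [->|Hv'].
    + rewrite <- (q_opp k (-1 - 1)), <- (q_opp k (-1 + 1)); cbn; lra.
    + pose proof (IH (v - 1)%Z ltac:(lia)); pose proof (IH (v + 1)%Z ltac:(lia)).
      replace (v + 2 - 1)%Z with (v - 1 + 2)%Z by lia.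
      replace (v + 2 + 1)%Z with (v + 1 + 2)%Z by lia. lra.
Qed.

Lemma q_max k v : Z.Even v -> q k v <= q k 0.
Proof.
  intros [m ->].
  assert (H : forall j : nat, q k (2 * Z.of_nat j) <= q k 0).
  { induction j as [|j IH]; [cbn; lra|].
    eapply Rle_trans; [|exact IH].
    replace (2 * Z.of_nat (S j))%Z with (2 * Z.of_nat j + 2)%Z by lia.
    apply q_unimodal; lia. }
  destruct (Z_le_dec 0 m).
  - rewrite <- (Z2Nat.id m) by lia; apply H.
  - rewrite <- q_opp. replace (- (2 * m))%Z with (2 * Z.of_nat (Z.to_nat (- m)))%Z by lia; apply H.
Qed.

(** ** Two-dimensional walk *)

Definition p (k : nat) (x : pt) : R := p_srw k x origin.

Lemma p_0 x : p 0 x = delta0 x.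
Proof. reflexivity. Qed.

Lemma p_S k x : p (S k) x = avg (p k) x.
Proof. reflexivity. Qed.

(* The coordinates x1 + x2 and x1 - x2 of the walk are independent one-dimensional walks. *)
Lemma p_q k x1 x2 : p k (x1, x2) = q k (x1 + x2) * q k (x1 - x2).
Proof.
  revert x1 x2; induction k as [|k IH]; intros.
  - rewrite p_0; unfold delta0, origin; cbn [q].
    destruct pt_eq_dec as [E|E], Z.eq_dec, Z.eq_dec; try lra; exfalso;
      try (injection E; lia); apply E; f_equal; lia.
  - rewrite p_S, avg_eq, !IH; cbn [q].
    replace (x1 + 1 + x2)%Z with (x1 + x2 + 1)%Z by lia.
    replace (x1 + 1 - x2)%Z with (x1 - x2 + 1)%Z by lia.
    replace (x1 - 1 + x2)%Z with (x1 + x2 - 1)%Z by lia.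
    replace (x1 - 1 - x2)%Z with (x1 - x2 - 1)%Z by lia.
    replace (x1 + (x2 + 1))%Z with (x1 + x2 + 1)%Z by lia.
    replace (x1 - (x2 + 1))%Z with (x1 - x2 - 1)%Z by lia.
    replace (x1 + (x2 - 1))%Z with (x1 + x2 - 1)%Z by lia.
    replace (x1 - (x2 - 1))%Z with (x1 - x2 + 1)%Z by lia.
    field.
Qed.

Lemma p_pos k x : 0 <= p k x.
Proof. destruct x; rewrite p_q; apply Rmult_le_pos; apply q_pos. Qed.

Definition even (x : pt) : Prop := Z.Even (fst x + snd x).

(** At an even site both rotated coordinates are even, so each one-dimensional factor is at most its
    value at [0]. This makes the partial sums of [pot] monotone at even sites. *)
Lemma p_max k x : even x -> p k x <= p k origin.
Proof.
  destruct x as [x1 x2]; intros [m Hm]; cbn [fst snd] in Hm; unfold origin; rewrite !p_q.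
  apply Rmult_le_compat; try apply q_pos; apply q_max.
  - now exists m.
  - exists (m - x2)%Z; lia.
Qed.

Lemma p_swap k x1 x2 : p k (x2, x1) = p k (x1, x2).
Proof. rewrite !p_q, <- (q_opp k (x1 - x2)). do 2 f_equal; lia. Qed.

Lemma p_flip k x1 x2 : p k ((- x1)%Z, x2) = p k (x1, x2).
Proof.
  rewrite !p_q, <- (q_opp k (- x1 + x2)), <- (q_opp k (- x1 - x2)), Rmult_comm.
  do 2 f_equal; lia.
Qed.

Lemma lsum_ext {A} (f g : A -> R) l : (forall a, In a l -> f a = g a) -> lsum f l = lsum g l.
Proof.
  induction l as [|a l IH]; intros H; [reflexivity|]; unfold lsum in *; cbn.
  rewrite H by (now left); rewrite IH; [reflexivity | intros; apply H; now right].
Qed.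

Lemma lsum_plus {A} (f g : A -> R) l : lsum (fun a => f a + g a) l = lsum f l + lsum g l.
Proof. induction l as [|a l IH]; unfold lsum in *; cbn; [ring | rewrite IH; ring]. Qed.

Lemma lsum_scal {A} c (f : A -> R) l : lsum (fun a => c * f a) l = c * lsum f l.
Proof. induction l as [|a l IH]; unfold lsum in *; cbn; [ring | rewrite IH; ring]. Qed.

Lemma lsum_le {A} (f g : A -> R) l : (forall a, In a l -> f a <= g a) -> lsum f l <= lsum g l.
Proof.
  induction l as [|a l IH]; intros H; unfold lsum in *; cbn; [lra|].
  apply Rplus_le_compat; [apply H; now left | apply IH; intros; apply H; now right].
Qed.

Lemma lsum_map {A B} (h : A -> B) (f : B -> R) l : lsum f (map h l) = lsum (fun a => f (h a)) l.
Proof. induction l as [|a l IH]; unfold lsum in *; cbn; [reflexivity | now rewrite IH]. Qed.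

Lemma lsum_const {A} c (l : list A) : lsum (fun _ => c) l = INR (length l) * c.
Proof.
  induction l as [|a l IH]; [cbn; ring|].
  change (c + lsum (fun _ => c) l = INR (S (length l)) * c). rewrite IH, S_INR; ring.
Qed.

Lemma avg_lsum {A} (f : A -> pt -> R) l x :
  avg (fun y => lsum (fun a => f a y) l) x = lsum (fun a => avg (f a) x) l.
Proof.
  induction l as [|a l IH]; [exact (avg_const 0 x)|].
  change (avg (fun y => f a y + lsum (fun a => f a y) l) x
          = avg (f a) x + lsum (fun a => avg (f a) x) l).
  now rewrite avg_plus, IH.
Qed.

Lemma lsum_delta (f : pt -> R) z l : NoDup l -> In z l ->
  lsum (fun a => if pt_eq_dec a z then f a else 0) l = f z.
Proof.
  induction l as [|a l IH]; intros Hl Hz; [destruct Hz|].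
  inversion_clear Hl.
  change ((if pt_eq_dec a z then f a else 0)
          + lsum (fun a => if pt_eq_dec a z then f a else 0) l = f z).
  destruct (pt_eq_dec a z) as [->|Haz].
  - rewrite (lsum_ext _ (fun _ => 0)), lsum_const; [ring|].
    intros b Hb; destruct pt_eq_dec as [->|]; [contradiction | reflexivity].
  - rewrite IH; [ring | assumption |]. destruct Hz; [contradiction | assumption].
Qed.

Lemma lsum_delta_out (f : pt -> R) z l : ~ In z l ->
  lsum (fun a => if pt_eq_dec a z then f a else 0) l = 0.
Proof.
  intros Hz; rewrite (lsum_ext _ (fun _ => 0)), lsum_const; [ring|].
  intros b Hb; destruct pt_eq_dec as [->|]; [contradiction | reflexivity].
Qed.

(** The sum runs over starting points. One step writes it as the average of four sums over
    translates of the list, so the bound passes from [k] to [S k]. *)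
Lemma p_mass k l : NoDup l -> lsum (p k) l <= 1.
Proof.
  revert l; induction k as [|k IH]; intros l Hl.
  - rewrite (lsum_ext _ (fun a => if pt_eq_dec a origin then 1 else 0)) by reflexivity.
    destruct (in_dec pt_eq_dec origin l).
    + rewrite (lsum_delta (fun _ => 1)) by assumption; lra.
    + rewrite (lsum_delta_out (fun _ => 1)) by assumption; lra.
  - assert (Hs : forall e, lsum (fun x => p k (padd x e)) l <= 1).
    { intros e. rewrite <- (lsum_map (fun x => padd x e) (p k)). apply IH.
      apply FinFun.Injective_map_NoDup; [|assumption].
      intros [] []; unfold padd; cbn; intros E; injection E; intros; f_equal; lia. }
    rewrite (lsum_ext _ (fun x => lsum (fun e => / 4 * p k (padd x e)) dirs)) by reflexivity.
    unfold dirs at 1, lsum at 2; cbn [fold_right].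
    rewrite !lsum_plus, lsum_const, !lsum_scal.
    pose proof (Hs (1, 0)%Z); pose proof (Hs (-1, 0)%Z).
    pose proof (Hs (0, 1)%Z); pose proof (Hs (0, -1)%Z). lra.
Qed.

(** ** Potential kernel *)

Definition psum (n : nat) (x : pt) : R := sum_f_R0 (fun k => p k origin - p k x) n.

Lemma psum_origin n : psum n origin = 0.
Proof.
  unfold psum; induction n as [|n IH]; cbn [sum_f_R0]; [ring | rewrite IH; ring].
Qed.

Lemma psum_swap n x1 x2 : psum n (x2, x1) = psum n (x1, x2).
Proof. apply sum_eq; intros; now rewrite p_swap. Qed.

Lemma psum_flip n x1 x2 : psum n ((- x1)%Z, x2) = psum n (x1, x2).
Proof. apply sum_eq; intros; now rewrite p_flip. Qed.

Lemma psum_flip' n x1 x2 : psum n (x1, (- x2)%Z) = psum n (x1, x2).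
Proof. now rewrite psum_swap, psum_flip, psum_swap. Qed.

Lemma psum_opp n x : psum n (popp x) = psum n x.
Proof.
  destruct x as [x1 x2]; unfold popp, psub, origin; cbn [fst snd]; rewrite !Z.sub_0_l.
  now rewrite psum_flip, psum_flip'.
Qed.

(** Averaging turns [p k] into [p (S k)] and shifts the summation index; the two unmatched terms at
    the ends are what is left over. In the limit this becomes the Laplace equation for [pot]. *)
Lemma psum_avg n x : avg (psum n) x = psum (S n) x - p (S n) origin + delta0 x.
Proof.
  induction n as [|n IH].
  - unfold psum; cbn [sum_f_R0]; rewrite avg_minus, avg_const.
    rewrite <- (p_S 0), (p_0 x). lra.
  - rewrite (avg_ext _ (fun y => psum n y + (p (S n) origin - p (S n) y))) by reflexivity.
    rewrite avg_plus, IH, avg_minus, avg_const, <- p_S.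
    unfold psum; cbn [sum_f_R0]; ring.
Qed.

(** The averaging identity at the origin, where [psum] vanishes, together with the equality of the
    four neighbouring values. *)
Lemma psum_unit n e : In e dirs -> psum n e = 1 - p (S n) origin.
Proof.
  intros He. pose proof (psum_avg n origin) as H.
  rewrite psum_origin in H; unfold delta0 in H; destruct pt_eq_dec; [|congruence].
  unfold origin in H; rewrite avg_eq in H; cbn in H; fold origin in H.
  pose proof (psum_swap n 1 0); pose proof (psum_swap n (-1) 0); pose proof (psum_flip n 1 0).
  cbn in *. destruct He as [<-|[<-|[<-|[<-|[]]]]]; lra.
Qed.

Lemma dirs_parity x e : In e dirs -> ~ even x -> even (padd x e).
Proof.
  intros He Hx. destruct (Z.Even_or_Odd (fst x + snd x)) as [|[m Hm]]; [contradiction|].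
  unfold even, padd; cbn [fst snd].
  destruct He as [<-|[<-|[<-|[<-|[]]]]]; cbn [fst snd];
    first [exists (m + 1)%Z; lia | exists m; lia].
Qed.

Lemma psum_even_growing x : even x -> Un_growing (fun n => psum n x).
Proof.
  intros Hx n. pose proof (p_max (S n) x Hx). unfold psum; cbn [sum_f_R0]. lra.
Qed.

(** At an odd site the terms have no fixed sign. Its partial sum is instead an average of even ones
    plus a return probability; only [n = 0] has to be computed by hand. *)
Lemma psum_nonneg n x : 0 <= psum n x.
Proof.
  assert (He : forall n x, even x -> 0 <= psum n x).
  { clear; intros n x Hx; apply cond_pos_sum; intros k; pose proof (p_max k x Hx); lra. }
  destruct (classic (even x)) as [|Hx]; [auto|].
  assert (Hd : delta0 x = 0).
  { unfold delta0; destruct pt_eq_dec as [->|]; [exfalso; apply Hx; now exists 0%Z|reflexivity]. }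
  destruct n as [|n].
  - unfold psum; cbn [sum_f_R0]; rewrite (p_0 x), (p_0 origin), Hd; unfold delta0.
    destruct pt_eq_dec; lra.
  - pose proof (psum_avg n x) as Ha; rewrite Hd in Ha.
    pose proof (p_pos (S n) origin).
    enough (0 <= avg (psum n) x) by lra.
    rewrite <- (avg_const 0 x). apply avg_le; intros. apply He, dirs_parity; assumption.
Qed.

(* A maximum principle in [y], by induction on the truncation [n]: off [0] and [x] the difference is an average of the previous one. *)
Lemma psum_increment M x n y : x <> origin ->
  (forall m, psum m x <= M) -> psum n (psub y x) - psum n y <= M.
Proof.
  intros Hx HM. pose proof (HM O). pose proof (psum_nonneg 0 x).
  revert y; induction n as [|n IH]; intros y;
    (destruct (pt_eq_dec y origin) as [->|Hy];
     [change (psub origin x) with (popp x); rewrite psum_opp, psum_origin;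
      match goal with |- psum ?k _ - _ <= _ => pose proof (HM k) end; lra|]);
    (destruct (pt_eq_dec y x) as [->|Hyx];
     [replace (psub x x) with origin by (symmetry; now apply psub_eq_origin);
      rewrite psum_origin; match goal with |- _ - psum ?k ?z <= _ => pose proof (psum_nonneg k z) end;
      lra|]);
    assert (H1 : delta0 y = 0) by (unfold delta0; destruct pt_eq_dec; [contradiction | reflexivity]);
    assert (H2 : delta0 (psub y x) = 0)
      by (unfold delta0; destruct pt_eq_dec as [E|]; [apply (proj1 (psub_eq_origin y x)) in E; contradiction | reflexivity]).
  - unfold psum; cbn [sum_f_R0]; rewrite (p_0 y), (p_0 (psub y x)), H1, H2; lra.
  - pose proof (psum_avg n y); pose proof (psum_avg n (psub y x)).
    assert (avg (psum n) (psub y x) - avg (psum n) y <= M); [|lra].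
    rewrite <- avg_shift_sub, <- avg_minus.
    apply Rle_trans with (avg (fun _ => M) y); [|rewrite avg_const; apply Rle_refl].
    apply avg_le; intros; apply IH.
Qed.

Lemma dirs_opp e : In e dirs -> In (popp e) dirs.
Proof. intros [<-|[<-|[<-|[<-|[]]]]]; cbn; tauto. Qed.

Lemma dirs_nonzero e : In e dirs -> e <> origin.
Proof. intros [<-|[<-|[<-|[<-|[]]]]]; discriminate. Qed.

Lemma popp_popp x : popp (popp x) = x.
Proof. destruct x; unfold popp, psub, origin; cbn; f_equal; lia. Qed.

Lemma psum_step n y e : In e dirs -> psum n (padd y e) <= psum n y + 1.
Proof.
  intros He. assert (psum n (psub y (popp e)) - psum n y <= 1).
  { apply psum_increment; [apply dirs_nonzero, dirs_opp, He|].
    intros m; rewrite psum_unit by (apply dirs_opp, He). pose proof (p_pos (S m) origin); lra. }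
  rewrite psub_padd, popp_popp in H; lra.
Qed.

(** A lattice path to [x] makes at most [|x1| + |x2|] unit steps, and each raises the partial sum by
    at most [1], whatever the truncation. *)
Lemma psum_bound x : exists C, forall n, psum n x <= C.
Proof.
  assert (H1 : forall j : nat, forall n, psum n (Z.of_nat j, 0%Z) <= INR j).
  { induction j as [|j IH]; intros n; [change (psum n origin <= 0); rewrite psum_origin; lra|].
    pose proof (psum_step n (Z.of_nat j, 0%Z) (1, 0)%Z ltac:(cbn; tauto)) as H.
    replace (padd (Z.of_nat j, 0%Z) (1, 0)%Z) with (Z.of_nat (S j), 0%Z) in H
      by (unfold padd; cbn [fst snd]; f_equal; lia).
    rewrite S_INR. specialize (IH n). lra. }
  assert (H2 : forall i j : nat, forall n, psum n (Z.of_nat j, Z.of_nat i) <= INR j + INR i).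
  { induction i as [|i IH]; intros j n; [specialize (H1 j n); cbn in *; lra|].
    pose proof (psum_step n (Z.of_nat j, Z.of_nat i) (0, 1)%Z ltac:(cbn; tauto)) as H.
    replace (padd (Z.of_nat j, Z.of_nat i) (0, 1)%Z) with (Z.of_nat j, Z.of_nat (S i)) in H
      by (unfold padd; cbn [fst snd]; f_equal; lia).
    rewrite S_INR. specialize (IH j n). lra. }
  destruct x as [x1 x2].
  exists (INR (Z.abs_nat x1) + INR (Z.abs_nat x2)); intros n.
  eapply Rle_trans; [|apply H2]. apply Req_le. rewrite !Zabs2Nat.id_abs.
  destruct (Z.abs_eq_or_opp x1) as [-> | ->], (Z.abs_eq_or_opp x2) as [-> | ->];
    now rewrite ?psum_flip, ?psum_flip'.
Qed.

Lemma psum_even_cv x : even x -> { l | Un_cv (fun n => psum n x) l }.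
Proof.
  intros Hx. apply growing_cv; [now apply psum_even_growing|].
  destruct (psum_bound x) as [C HC]. exists C; intros _ [n ->]; apply HC.
Qed.

(** These are the terms of a convergent series. *)
Lemma p_gap_cv x : even x -> Un_cv (fun k => p k origin - p k x) 0.
Proof.
  intros Hx. destruct (psum_even_cv x Hx) as [l Hl].
  intros eps Heps. destruct (Hl (eps / 2)) as [N HN]; [lra|].
  exists (S N); intros k Hk. destruct k as [|k]; [lia|].
  pose proof (HN (S k) ltac:(lia)) as H1; pose proof (HN k ltac:(lia)) as H2.
  unfold Rdist in *. replace (p (S k) origin - p (S k) x - 0) with ((psum (S k) x - l) - (psum k x - l))
    by (unfold psum; cbn [sum_f_R0]; ring).
  unfold Rminus at 1. eapply Rle_lt_trans; [apply Rabs_triang|]. rewrite Rabs_Ropp; lra.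
Qed.

Lemma un_cv_lsum {A} (f : A -> nat -> R) g l :
  (forall a, In a l -> Un_cv (f a) (g a)) -> Un_cv (fun n => lsum (fun a => f a n) l) (lsum g l).
Proof.
  induction l as [|a l IH]; intros H; [exact (un_cv_const 0)|].
  apply (CV_plus (f a) (fun n => lsum (fun a => f a n) l)); [apply H; now left|].
  apply IH; intros; apply H; now right.
Qed.

(* The return probability is asymptotically shared by any number [N] of even sites. *)
Lemma p_origin_cv : Un_cv (fun k => p k origin) 0.
Proof.
  intros eps Heps.
  destruct (archimed_cor1 (eps / 2)) as [N [HN HN0]]; [lra|].
  set (l := map (fun j => (2 * Z.of_nat j, 0)%Z : pt) (seq 0 N) : list pt).
  assert (Hl : NoDup l).
  { apply FinFun.Injective_map_NoDup; [|apply seq_NoDup].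
    intros i j E; apply (f_equal fst) in E; cbn [fst] in E; lia. }
  assert (HlN : length l = N) by (unfold l; now rewrite length_map, length_seq).
  destruct (un_cv_lsum (fun x k => p k origin - p k x) (fun _ => 0) l) with (eps := 1) as [K HK].
  { intros x Hx. apply p_gap_cv. unfold l in Hx; apply in_map_iff in Hx as [j [<- _]].
    exists (Z.of_nat j); cbn; lia. }
  { lra. }
  exists K; intros k Hk. specialize (HK k Hk). unfold Rdist in *.
  rewrite lsum_const, Rmult_0_r, Rminus_0_r in HK.
  rewrite (lsum_ext _ (fun x => p k origin + (-1) * p k x)) in HK by (intros; ring).
  rewrite lsum_plus, lsum_const, lsum_scal, HlN in HK.
  pose proof (p_mass k l Hl). pose proof (p_pos k origin) as Hp.
  apply Rabs_def2 in HK. rewrite Rminus_0_r, Rabs_right by lra.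
  assert (HN' : 0 < INR N) by (apply lt_0_INR; lia).
  apply Rmult_lt_reg_l with (INR N); [assumption|].
  assert (INR N * / INR N < INR N * (eps / 2)) by (apply Rmult_lt_compat_l; assumption).
  rewrite Rinv_r in H0 by lra. lra.
Qed.

(** Bounded monotone convergence settles the even sites. At an odd site [psum_avg] transfers the
    limit from the even neighbours, which is where the vanishing of [p k origin] is needed. From
    here on the chosen value [pot] is a genuine limit. *)
Lemma psum_cv x : Un_cv (fun n => psum n x) (pot x).
Proof.
  assert (He : forall x, even x -> Un_cv (fun n => psum n x) (pot x)).
  { clear; intros x Hx. destruct (psum_even_cv x Hx) as [l Hl].
    change (pot x) with (Lim (fun n => psum n x)). now rewrite (Lim_spec _ l Hl). }
  destruct (classic (even x)) as [|Hx]; [auto|].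
  assert (H : Un_cv (fun n => psum (S n) x) (avg pot x + 0 - delta0 x)).
  { apply Un_cv_ext with (fun n => avg (psum n) x + p (S n) origin - delta0 x).
    { intros n. rewrite psum_avg; ring. }
    apply CV_minus; [apply CV_plus|apply un_cv_const].
    - apply un_cv_avg; intros; apply He, dirs_parity; assumption.
    - apply (un_cv_S (fun n => p n origin)), p_origin_cv. }
  apply (un_cv_S_inv (fun n => psum n x)) in H.
  change (pot x) with (Lim (fun n => psum n x)). now rewrite (Lim_spec _ _ H).
Qed.

Lemma un_cv_le u v l l' : Un_cv u l -> Un_cv v l' -> (forall n, u n <= v n) -> l <= l'.
Proof. intros Hu Hv H. exact (Rle_cv_lim H Hu Hv). Qed.

Lemma pot_origin : pot origin = 0.
Proof.
  apply (UL_sequence (fun n => psum n origin)); [apply psum_cv|].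
  apply Un_cv_ext with (fun _ => 0); [intros; now rewrite psum_origin | apply un_cv_const].
Qed.

Lemma pot_avg x : avg pot x = pot x + delta0 x.
Proof.
  apply (UL_sequence (fun n => avg (psum n) x)); [apply un_cv_avg; intros; apply psum_cv|].
  apply Un_cv_ext with (fun n => psum (S n) x - p (S n) origin + delta0 x);
    [intros; now rewrite psum_avg|].
  replace (pot x + delta0 x) with (pot x - 0 + delta0 x) by ring.
  apply CV_plus; [apply CV_minus|apply un_cv_const].
  - apply (un_cv_S (fun n => psum n x)), psum_cv.
  - apply (un_cv_S (fun n => p n origin)), p_origin_cv.
Qed.

Lemma pot_swap x1 x2 : pot (x2, x1) = pot (x1, x2).
Proof.
  apply (UL_sequence (fun n => psum n (x2, x1))); [apply psum_cv|].
  apply Un_cv_ext with (fun n => psum n (x1, x2)); [intros; now rewrite psum_swap | apply psum_cv].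
Qed.

Lemma pot_flip x1 x2 : pot ((- x1)%Z, x2) = pot (x1, x2).
Proof.
  apply (UL_sequence (fun n => psum n ((- x1)%Z, x2))); [apply psum_cv|].
  apply Un_cv_ext with (fun n => psum n (x1, x2)); [intros; now rewrite psum_flip | apply psum_cv].
Qed.

Lemma pot_flip' x1 x2 : pot (x1, (- x2)%Z) = pot (x1, x2).
Proof. now rewrite pot_swap, pot_flip, pot_swap. Qed.

Lemma pot_opp x : pot (popp x) = pot x.
Proof.
  destruct x as [x1 x2]; unfold popp, psub, origin; cbn [fst snd]; rewrite !Z.sub_0_l.
  now rewrite pot_flip, pot_flip'.
Qed.

Lemma pot_psub_sym x y : pot (psub x y) = pot (psub y x).
Proof.
  rewrite <- pot_opp. f_equal. unfold popp, psub, origin; cbn; f_equal; lia.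
Qed.

Lemma even_pot_ge_1 x : even x -> x <> origin -> 1 <= pot x.
Proof.
  intros He Hx. replace 1 with (psum 0 x).
  - pose proof (growing_ineq _ _ (psum_even_growing x He) (psum_cv x)) as H. apply (H O).
  - unfold psum; cbn [sum_f_R0]; rewrite (p_0 x), (p_0 origin); unfold delta0.
    destruct pt_eq_dec; [|congruence]; destruct pt_eq_dec; [contradiction|ring].
Qed.

Lemma pot_unit e : In e dirs -> pot e = 1.
Proof.
  intros He. apply (UL_sequence (fun n => psum n e)); [apply psum_cv|].
  apply Un_cv_ext with (fun n => 1 - p (S n) origin); [intros; now rewrite psum_unit|].
  replace (Un_cv (fun n => 1 - p (S n) origin) 1) with (Un_cv (fun n => 1 - p (S n) origin) (1 - 0))
    by (f_equal; ring).
  apply CV_minus; [apply un_cv_const|]. apply (un_cv_S (fun n => p n origin)), p_origin_cv.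
Qed.

Lemma padd_popp_eq_origin x e : padd x e = origin -> x = popp e.
Proof.
  destruct x, e; unfold padd, popp, psub, origin; cbn; intros E; injection E; intros; f_equal; lia.
Qed.

(** At an even site the term [k = 0] alone contributes [1]. An odd site is either adjacent to the
    origin, with value exactly [1], or an average of even sites different from the origin. *)
Lemma pot_ge_1 x : x <> origin -> 1 <= pot x.
Proof.
  intros Hx. destruct (classic (even x)) as [|He]; [now apply even_pot_ge_1|].
  destruct (in_dec pt_eq_dec x dirs) as [Hd|Hd]; [rewrite pot_unit by assumption; lra|].
  pose proof (pot_avg x) as H. unfold delta0 in H; destruct pt_eq_dec; [contradiction|].
  enough (1 <= avg pot x) by lra.
  rewrite <- (avg_const 1 x). apply avg_le; intros e Hedir.
  apply even_pot_ge_1; [now apply dirs_parity|].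
  intros E; apply padd_popp_eq_origin in E; subst; apply Hd, dirs_opp, Hedir.
Qed.

Lemma pot_nonneg x : 0 <= pot x.
Proof.
  destruct (pt_eq_dec x origin) as [->|H]; [rewrite pot_origin; lra|].
  pose proof (pot_ge_1 x H); lra.
Qed.

(** The factor [2] pays for odd [x]: there the partial sums are not monotone and are only bounded by
    [pot x + 1], which is at most [2 * pot x]. *)
Lemma pot_increment x y : pot (psub y x) - pot y <= 2 * pot x.
Proof.
  destruct (pt_eq_dec x origin) as [->|Hx].
  { replace (psub y origin) with y by (destruct y; unfold psub; cbn; f_equal; lia).
    rewrite pot_origin; lra. }
  pose proof (pot_ge_1 x Hx) as H1.
  assert (He : forall m x, even x -> psum m x <= pot x).
  { intros m z Hz. apply (growing_ineq _ _ (psum_even_growing z Hz) (psum_cv z)). }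
  assert (HM : forall m, psum m x <= 2 * pot x).
  { intros m. destruct (classic (even x)) as [Hev|Hev]; [pose proof (He m x Hev); lra|].
    destruct m as [|m].
    - unfold psum; cbn [sum_f_R0]; rewrite (p_0 x), (p_0 origin); unfold delta0.
      destruct pt_eq_dec; [|congruence]; destruct pt_eq_dec; lra.
    - pose proof (psum_avg m x) as Hm. pose proof (pot_avg x) as Ha.
      unfold delta0 in *; destruct pt_eq_dec; [contradiction|].
      assert (avg (psum m) x <= avg pot x)
        by (apply avg_le; intros; apply He, dirs_parity; assumption).
      assert (p (S m) origin <= 1).
      { pose proof (p_mass (S m) (origin :: nil) (NoDup_cons _ (@in_nil _ _) (NoDup_nil _))) as Hq.
        unfold lsum in Hq; cbn [fold_right] in Hq; lra. }
      lra. }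
  apply (un_cv_le (fun n => psum n (psub y x) - psum n y) (fun _ => 2 * pot x)).
  - apply CV_minus; apply psum_cv.
  - apply un_cv_const.
  - intros n; now apply psum_increment.
Qed.

Lemma pot_step y e : In e dirs -> Rabs (pot (padd y e) - pot y) <= 1.
Proof.
  assert (H : forall y e, In e dirs -> pot (padd y e) - pot y <= 1).
  { intros z d Hd. apply (un_cv_le (fun n => psum n (padd z d) - psum n z) (fun _ => 1)).
    - apply CV_minus; apply psum_cv.
    - apply un_cv_const.
    - intros n; pose proof (psum_step n z d Hd); lra. }
  intros He. apply Rabs_le. pose proof (H y e He) as Ha. pose proof (H (padd y e) (popp e) (dirs_opp e He)) as H2.
  rewrite <- padd_assoc in H2. replace (padd y (padd e (popp e))) with y in H2; [lra|].
  destruct y, e; unfold padd, popp, psub, origin; cbn; f_equal; lia.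
Qed.

(** ** Liouville theorem *)

(* If an increment had supremum [M > 0], it would be nearly [M] along a long segment, and [g] would be unbounded. *)
Lemma bounded_harmonic_increment g B e : In e dirs ->
  (forall x, avg g x = g x) -> (forall x, Rabs (g x) <= B) -> forall x, g (padd x e) - g x <= 0.
Proof.
  intros He Hg HB x0. set (D := fun x => g (padd x e) - g x).
  assert (HD : forall x, avg D x = D x).
  { intros x. unfold D. rewrite avg_minus, avg_shift, !Hg; reflexivity. }
  destruct (Rle_or_lt (D x0) 0) as [|Hx0]; [assumption|exfalso].
  destruct (completeness (fun r => exists x, r = D x)) as [M [HM1 HM2]].
  { exists (2 * B); intros _ [x ->]; unfold D.
    pose proof (HB x) as Ha; pose proof (HB (padd x e)) as Hb.
    apply Rabs_le_between in Ha, Hb; lra. }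
  { now exists (D x0), x0. }
  assert (HM : 0 < M) by (pose proof (HM1 (D x0) (ex_intro _ x0 eq_refl)); lra).
  (* After [k] steps with gain at least [M / 2] each, [g] would have changed by more than [2 * B]. A
     deficit of [M / (2 * 4 ^ k)] at the start stays below [M / 2] when multiplied by [4] at every
     step. *)
  destruct (INR_unbounded (4 * B / M)) as [k Hk].
  assert (H4 : 0 < 4 ^ k) by (apply pow_lt; lra).
  assert (Hex : exists x, M - M / (2 * 4 ^ k) < D x).
  { apply NNPP; intros Hn. assert (0 < M / (2 * 4 ^ k)) by (apply Rdiv_lt_0_compat; lra).
    enough (M <= M - M / (2 * 4 ^ k)) by lra.
    apply HM2; intros _ [x ->]. apply Rnot_lt_le; intros Hl; apply Hn; now exists x. }
  destruct Hex as [x Hx].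
  (* Four values not exceeding [M] with average above [M - eps] are each above [M - 4 * eps]. *)
  assert (Hstep : forall y eps, M - eps < D y -> M - 4 * eps < D (padd y e)).
  { intros y eps Hy.
    pose proof (HM1 _ (ex_intro _ (padd y (1, 0)%Z) eq_refl)); pose proof (HM1 _ (ex_intro _ (padd y (-1, 0)%Z) eq_refl)).
    pose proof (HM1 _ (ex_intro _ (padd y (0, 1)%Z) eq_refl)); pose proof (HM1 _ (ex_intro _ (padd y (0, -1)%Z) eq_refl)).
    pose proof (HD y) as E. unfold avg, lsum, dirs in E; cbn [fold_right] in E.
    destruct He as [<-|[<-|[<-|[<-|[]]]]]; lra. }
  set (walk := fix walk (j : nat) := match j with O => x | S j => padd (walk j) e end).
  assert (Hw : forall j, M - 4 ^ j * (M / (2 * 4 ^ k)) < D (walk j)).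
  { induction j as [|j IH]; [cbn; lra|]. cbn [walk pow]. rewrite Rmult_assoc. now apply Hstep. }
  assert (Hg' : forall j, (j <= k)%nat -> INR j * (M / 2) <= g (walk j) - g x).
  { induction j as [|j IH]; intros Hj; [cbn; lra|].
    rewrite S_INR. specialize (IH ltac:(lia)). specialize (Hw j). unfold D in Hw.
    change (walk (S j)) with (padd (walk j) e).
    assert (4 ^ j * (M / (2 * 4 ^ k)) <= M / 2); [|lra].
    apply Rle_trans with (4 ^ k * (M / (2 * 4 ^ k))).
    - apply Rmult_le_compat_r; [apply Rlt_le, Rdiv_lt_0_compat; lra|]. apply Rle_pow; [lra|lia].
    - apply Req_le; field; lra. }
  specialize (Hg' k (le_n k)).
  pose proof (HB x) as Ha; pose proof (HB (walk k)) as Hb.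
  apply Rabs_le_between in Ha, Hb.
  apply Rmult_lt_compat_r with (r := M) in Hk; [|assumption].
  unfold Rdiv in Hk at 1; rewrite Rmult_assoc, Rinv_l in Hk by lra. lra.
Qed.

Lemma padd_popp_r x e : padd (padd x e) (popp e) = x.
Proof. destruct x, e; unfold padd, popp, psub, origin; cbn; f_equal; lia. Qed.

Lemma step_invariant_const (g : pt -> R) :
  (forall x e, In e dirs -> g (padd x e) = g x) -> forall x, g x = g origin.
Proof.
  intros H.
  assert (H1 : forall (j : nat) y, g (Z.of_nat j, y) = g (0%Z, y)).
  { induction j as [|j IH]; intros y; [reflexivity|].
    rewrite <- (IH y), <- (H (Z.of_nat j, y) (1, 0)%Z ltac:(cbn; tauto)).
    unfold padd; cbn [fst snd]; do 2 f_equal; lia. }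
  assert (H1' : forall (j : nat) y, g ((- Z.of_nat j)%Z, y) = g (0%Z, y)).
  { induction j as [|j IH]; intros y; [reflexivity|].
    rewrite <- (IH y), <- (H ((- Z.of_nat j)%Z, y) (-1, 0)%Z ltac:(cbn; tauto)).
    unfold padd; cbn [fst snd]; do 2 f_equal; lia. }
  assert (H2 : forall (j : nat), g (0%Z, Z.of_nat j) = g origin).
  { induction j as [|j IH]; [reflexivity|].
    rewrite <- IH, <- (H (0%Z, Z.of_nat j) (0, 1)%Z ltac:(cbn; tauto)).
    unfold padd; cbn [fst snd]; do 2 f_equal; lia. }
  assert (H2' : forall (j : nat), g (0%Z, (- Z.of_nat j)%Z) = g origin).
  { induction j as [|j IH]; [reflexivity|].
    rewrite <- IH, <- (H (0%Z, (- Z.of_nat j)%Z) (0, -1)%Z ltac:(cbn; tauto)).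
    unfold padd; cbn [fst snd]; do 2 f_equal; lia. }
  intros [x1 x2]. transitivity (g (0%Z, x2)).
  - destruct (Z_le_dec 0 x1).
    + rewrite <- (Z2Nat.id x1) by lia; apply H1.
    + replace x1 with (- Z.of_nat (Z.to_nat (- x1)))%Z by lia; apply H1'.
  - destruct (Z_le_dec 0 x2).
    + rewrite <- (Z2Nat.id x2) by lia; apply H2.
    + replace x2 with (- Z.of_nat (Z.to_nat (- x2)))%Z by lia; apply H2'.
Qed.

Lemma liouville g B : (forall x, avg g x = g x) -> (forall x, Rabs (g x) <= B) ->
  forall x, g x = g origin.
Proof.
  intros Hg HB. apply step_invariant_const; intros x e He.
  pose proof (bounded_harmonic_increment g B e He Hg HB x) as H1.
  pose proof (bounded_harmonic_increment g B (popp e) (dirs_opp e He) Hg HB (padd x e)) as H2.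
  rewrite padd_popp_r in H2; lra.
Qed.

(** Each increment is a bounded harmonic function, hence constant. So [h] is affine, and its users
    only have to exclude the linear part. *)
Lemma harmonic_lipschitz_increment h C : (forall x, avg h x = h x) ->
  (forall x e, In e dirs -> Rabs (h (padd x e) - h x) <= C) ->
  forall x e, In e dirs -> h (padd x e) - h x = h (padd origin e) - h origin.
Proof.
  intros Hh HC x e He.
  apply (liouville (fun x => h (padd x e) - h x) C).
  - intros y; rewrite avg_minus, avg_shift, !Hh; reflexivity.
  - intros y; now apply HC.
Qed.

(** ** Integral representation of the potential kernel *)

Lemma exp_le_exp x y : x <= y -> exp x <= exp y.
Proof. intros [H| ->]; [left; now apply exp_increasing | lra]. Qed.

Lemma derive_nonneg_le (f df : R -> R) a b : a <= b ->
  (forall t, a <= t <= b -> is_derive f t (df t)) ->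
  (forall t, a <= t <= b -> 0 <= df t) -> f a <= f b.
Proof.
  intros Hab Hd Hp.
  destruct (MVT_gen f a b df) as [c [Hc E]].
  - rewrite Rmin_left, Rmax_right by assumption. intros x Hx; apply Hd; lra.
  - rewrite Rmin_left, Rmax_right by assumption. intros x Hx.
    apply continuity_pt_filterlim, (ex_derive_continuous f). eexists; apply Hd; lra.
  - rewrite Rmin_left, Rmax_right in Hc by assumption.
    pose proof (Hp c Hc). assert (0 <= df c * (b - a)) by (apply Rmult_le_pos; lra). lra.
Qed.

Lemma sin_le_id t : 0 <= t -> sin t <= t.
Proof. intros [H| <-]; [left; now apply sin_lt_x | rewrite sin_0; lra]. Qed.

Lemma cos_ge_quadratic t : 1 - t ^ 2 / 2 <= cos t.
Proof.
  assert (H : forall t, 0 <= t -> 1 - t ^ 2 / 2 <= cos t).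
  { clear; intros t Ht.
    enough (cos 0 + 0 ^ 2 / 2 <= cos t + t ^ 2 / 2) by (rewrite cos_0 in *; lra).
    apply (derive_nonneg_le (fun t => cos t + t ^ 2 / 2) (fun t => - sin t + t)); [assumption| |].
    - intros u _; auto_derive; [easy | field].
    - intros u Hu; pose proof (sin_le_id u (proj1 Hu)); lra. }
  destruct (Rle_or_lt 0 t); [now apply H|].
  rewrite <- cos_neg. replace (t ^ 2) with ((- t) ^ 2) by ring. apply H; lra.
Qed.

Lemma sin_ge_cubic t : 0 <= t -> t - t ^ 3 / 6 <= sin t.
Proof.
  intros Ht. enough (sin 0 - 0 + 0 ^ 3 / 6 <= sin t - t + t ^ 3 / 6) by (rewrite sin_0 in *; lra).
  apply (derive_nonneg_le (fun t => sin t - t + t ^ 3 / 6) (fun t => cos t - 1 + t ^ 2 / 2)); [assumption| |].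
  - intros u _; auto_derive; [easy | field].
  - intros u _; pose proof (cos_ge_quadratic u); lra.
Qed.


(** Separation of variables: [D ^ n * cos (2 * m * t)] is harmonic in [(m, n)] when [D + 1 / D = 4 -
    2 cos (2t) = 2 + 4 sin^2 t]. The roots are [(rho - sin)^2] and [(rho + sin)^2], and [decay] is
    the one below [1] for [t] in [(0, PI/2]]. The half angle makes both roots perfect squares. *)
Definition rho (t : R) : R := sqrt (1 + sin t ^ 2).
Definition decay (t : R) : R := (rho t - sin t) ^ 2.

Lemma rho_sqr t : rho t * rho t = 1 + sin t ^ 2.
Proof. apply sqrt_sqrt; nra. Qed.

Lemma rho_pos t : 0 < rho t.
Proof. apply sqrt_lt_R0; nra. Qed.

Lemma rho_ge_1 t : 1 <= rho t.
Proof. pose proof (rho_sqr t); pose proof (rho_pos t); nra. Qed.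

Lemma rho_le t : rho t <= 1 + sin t ^ 2 / 2.
Proof.
  pose proof (rho_sqr t); pose proof (rho_pos t).
  apply Rsqr_incr_0_var; [unfold Rsqr; nra | nra].
Qed.

Lemma rho_plus_sin_pos t : 0 < rho t + sin t.
Proof. pose proof (rho_sqr t); pose proof (rho_pos t); nra. Qed.

Lemma decay_mult t : decay t * (rho t + sin t) ^ 2 = 1.
Proof.
  pose proof (rho_sqr t). unfold decay.
  replace ((rho t - sin t) ^ 2 * (rho t + sin t) ^ 2) with ((rho t * rho t - sin t ^ 2) ^ 2) by ring.
  rewrite H; ring.
Qed.

(** [ln (rho t + sin t)] is the inverse hyperbolic sine of [sin t], equal to [t] up to a cubic
    error; this is why [decay t ^ n] is compared with [exp (- 2 n t)]. *)
Lemma decay_exp t : decay t = exp (- (2 * ln (rho t + sin t))).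
Proof.
  pose proof (rho_plus_sin_pos t). pose proof (decay_mult t).
  rewrite exp_Ropp. replace (2 * ln (rho t + sin t)) with (ln (rho t + sin t) + ln (rho t + sin t)) by ring.
  rewrite exp_plus, exp_ln by assumption.
  apply Rmult_eq_reg_r with ((rho t + sin t) ^ 2); [rewrite H0; field; lra | nra].
Qed.

Section SmallAngles.
Variable t : R.
Hypothesis Ht : 0 < t <= PI / 2.

(** Since [t <= 2], the cubic term in [t - t ^ 3 / 6] takes away at most two thirds of [t]. *)
Lemma sin_lower : t / 3 <= sin t.
Proof.
  pose proof PI_4. pose proof (sin_ge_cubic t ltac:(lra)). nra.
Qed.

Lemma sin_small_pos : 0 < sin t.
Proof. pose proof sin_lower; lra. Qed.

(** The derivative of [ln (rho t + sin t)] is [cos t / rho t], which lies between [1 - 3 t^2] and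
    [1] here. Integration gives this bound and the next one. *)
Lemma ln_rho_le : ln (rho t + sin t) <= t.
Proof.
  assert (0 <= t - ln (rho t + sin t)); [|lra].
  replace 0 with (0 - ln (rho 0 + sin 0)).
  2: { unfold rho; rewrite sin_0. replace (1 + 0 ^ 2) with 1 by ring.
       rewrite sqrt_1, Rplus_0_r, ln_1; ring. }
  apply (derive_nonneg_le (fun t => t - ln (rho t + sin t)) (fun t => 1 - cos t / rho t)); [lra| |].
  - intros u _. pose proof (rho_pos u) as Hr. pose proof (rho_plus_sin_pos u).
    unfold rho in *. auto_derive; [repeat split; [nra | exact H]|].
    replace (1 + sin u * (sin u * 1)) with (1 + sin u ^ 2) by ring.
    field. lra.
  - intros u _. pose proof (rho_ge_1 u). pose proof (COS_bound u).
    enough (cos u / rho u <= 1) by lra.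
    apply Rmult_le_reg_r with (rho u); [lra|]. unfold Rdiv; rewrite Rmult_assoc, Rinv_l; lra.
Qed.

Lemma ln_rho_ge : t - t ^ 3 <= ln (rho t + sin t).
Proof.
  enough (ln (rho 0 + sin 0) - 0 + 0 ^ 3 <= ln (rho t + sin t) - t + t ^ 3).
  { unfold rho at 1 in H; rewrite sin_0 in H. replace (1 + 0 ^ 2) with 1 in H by ring.
    rewrite sqrt_1, Rplus_0_r, ln_1 in H; lra. }
  apply (derive_nonneg_le (fun t => ln (rho t + sin t) - t + t ^ 3)
           (fun t => cos t / rho t - 1 + 3 * t ^ 2)); [lra| |].
  - intros u _. pose proof (rho_pos u) as Hr. pose proof (rho_plus_sin_pos u).
    unfold rho in *. auto_derive; [repeat split; [nra | exact H]|].
    replace (1 + sin u * (sin u * 1)) with (1 + sin u ^ 2) by ring.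
    field. lra.
  - intros u Hu. pose proof (rho_ge_1 u). pose proof (rho_le u). pose proof (cos_ge_quadratic u).
    pose proof (sin_le_id u (proj1 Hu)). pose proof PI_4.
    assert (0 <= sin u) by (apply sin_ge_0; lra).
    assert (cos u / rho u - 1 >= - u ^ 2).
    { apply Rle_ge, Rmult_le_reg_r with (rho u); [lra|].
      replace ((cos u / rho u - 1) * rho u) with (cos u - rho u) by (field; lra).
      nra. }
    nra.
Qed.

(** The cubic lower bound becomes negative for [t > 1]; a linear one valid up to [PI / 2] is needed
    for exponential decay. The constant comes from [ln u >= 1 - 1 / u], which gives at least
    [sin t / 2], and from [sin t >= t / 3]. *)
Lemma ln_rho_lower : t / 6 <= ln (rho t + sin t).
Proof.
  pose proof sin_lower. pose proof (rho_ge_1 t). pose proof (SIN_bound t).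
  assert (Hi : 1 - / (rho t + sin t) <= ln (rho t + sin t)).
  { pose proof (exp_ineq1_le (- ln (rho t + sin t))) as H2.
    rewrite exp_Ropp, exp_ln in H2 by apply rho_plus_sin_pos. lra. }
  assert (/ (rho t + sin t) <= / (1 + sin t)) by (apply Rinv_le_contravar; lra).
  assert (/ (1 + sin t) <= 1 - sin t / 2).
  { apply Rmult_le_reg_r with (1 + sin t); [lra|]. rewrite Rinv_l by lra. nra. }
  lra.
Qed.

Lemma decay_pos : 0 < decay t.
Proof. rewrite decay_exp; apply exp_pos. Qed.

(** [sin t * rho t] equals [t] up to [t ^ 3], and is at least [t / 3]; the latter is the source of
    the factor [3]. *)
Lemma inv_sin_rho : Rabs (/ (sin t * rho t) - / t) <= 3 * t.
Proof.
  pose proof sin_lower as Hs. pose proof (rho_ge_1 t) as H1. pose proof (rho_le t) as H2.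
  pose proof (sin_ge_cubic t ltac:(lra)) as H3. pose proof (sin_le_id t ltac:(lra)) as H4.
  assert (Hd : Rabs (t - sin t * rho t) <= t ^ 3).
  { apply Rabs_le; split.
    - assert (sin t * rho t <= sin t * (1 + sin t ^ 2 / 2)) by (apply Rmult_le_compat_l; lra).
      assert (sin t ^ 3 <= t ^ 3) by (apply pow_incr; lra). nra.
    - assert (0 <= t ^ 3) by (apply pow_le; lra). nra. }
  assert (Hp : t / 3 <= sin t * rho t) by nra.
  replace (/ (sin t * rho t) - / t) with ((t - sin t * rho t) * (/ t * / (sin t * rho t))) by (field; lra).
  rewrite Rabs_mult, (Rabs_right (/ t * _)).
  2: { apply Rle_ge, Rmult_le_pos; apply Rlt_le, Rinv_0_lt_compat; lra. }
  apply Rle_trans with (t ^ 3 * (/ t * / (t / 3))); [|apply Req_le; field; lra].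
  apply Rmult_le_compat; [apply Rabs_pos | | assumption | ].
  - apply Rmult_le_pos; apply Rlt_le, Rinv_0_lt_compat; lra.
  - apply Rmult_le_compat_l; [apply Rlt_le, Rinv_0_lt_compat; lra|].
    apply Rinv_le_contravar; lra.
Qed.

Lemma decay_pow n : decay t ^ n = exp (- (INR n * (2 * ln (rho t + sin t)))).
Proof.
  rewrite decay_exp. induction n as [|n IH]; [cbn [pow]; rewrite Rmult_0_l, Ropp_0, exp_0; reflexivity|].
  cbn [pow]. rewrite IH, <- exp_plus, S_INR. f_equal; ring.
Qed.

(** Two replacements are made, each costing a factor [t] times an exponential: [1 / (sin t * rho t)]
    by [1 / t], with constant [3], and [decay t ^ n] by [exp (- 2 n t)], with constant [12]. The
    second error carries a factor [n t], which half of the exponential absorbs. A bound of the form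
    [t * exp (- n t / 6)] integrates to order [n^-2]. *)
Lemma remainder_bound n :
  Rabs (decay t ^ n / (sin t * rho t) - exp (- (2 * INR n * t)) / t) <= 15 * t * exp (- (INR n / 6 * t)).
Proof.
  pose proof (pos_INR n) as Hn. pose proof ln_rho_lower as Hl. pose proof ln_rho_le as Hu.
  pose proof ln_rho_ge as Hg. pose proof sin_small_pos. pose proof (rho_pos t).
  set (S := ln (rho t + sin t)) in *.
  set (x := INR n / 6 * t).
  assert (Hx : 0 <= x) by (unfold x; apply Rmult_le_pos; lra).
  (* By [ln_rho_lower], [2 n S >= n t / 3 = 2 x]. One factor [exp (- x)] is kept for the final
     bound, the other absorbs [x] through [x * exp (- x) <= 1]. *)
  assert (Hpow : decay t ^ n <= exp (- (2 * x))).
  { rewrite decay_pow. apply exp_le_exp. fold S. unfold x. nra. }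
  assert (Hpow0 : 0 < decay t ^ n) by (apply pow_lt, decay_pos).
  assert (He2 : exp (- (2 * x)) = exp (- x) * exp (- x)) by (rewrite <- exp_plus; f_equal; ring).
  assert (He1 : exp (- x) <= 1) by (rewrite <- exp_0; apply exp_le_exp; lra).
  pose proof (exp_pos (- x)) as He0.
  assert (Hxe : x * exp (- x) <= 1).
  { rewrite exp_Ropp. pose proof (exp_ineq1_le x). apply Rmult_le_reg_r with (exp x); [apply exp_pos|].
    rewrite Rmult_assoc, Rinv_l; [lra | apply Rgt_not_eq, exp_pos]. }
  replace (decay t ^ n / (sin t * rho t) - exp (- (2 * INR n * t)) / t)
    with (decay t ^ n * (/ (sin t * rho t) - / t) + (decay t ^ n - exp (- (2 * INR n * t))) / t)
    by (field; lra).
  eapply Rle_trans; [apply Rabs_triang|].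
  assert (A1 : Rabs (decay t ^ n * (/ (sin t * rho t) - / t)) <= 3 * t * exp (- x)).
  { rewrite Rabs_mult, (Rabs_right (decay t ^ n)) by lra.
    pose proof inv_sin_rho. pose proof (Rabs_pos (/ (sin t * rho t) - / t)).
    apply Rle_trans with (exp (- x) * (3 * t)); [|lra].
    apply Rmult_le_compat; nra. }
  assert (A2 : Rabs ((decay t ^ n - exp (- (2 * INR n * t))) / t) <= 12 * t * exp (- x)).
  { assert (Hd : 0 <= decay t ^ n - exp (- (2 * INR n * t)) <= decay t ^ n * (2 * INR n * t ^ 3)).
    { assert (E : exp (- (2 * INR n * t)) = decay t ^ n * exp (- (2 * INR n * (t - S)))).
      { rewrite decay_pow, <- exp_plus. f_equal. fold S. ring. }
      rewrite E. pose proof (exp_ineq1_le (- (2 * INR n * (t - S)))).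
      assert (0 <= 2 * INR n * (t - S)) by (apply Rmult_le_pos; lra).
      assert (exp (- (2 * INR n * (t - S))) <= 1) by (rewrite <- exp_0; apply exp_le_exp; lra).
      assert (2 * INR n * (t - S) <= 2 * INR n * t ^ 3) by (apply Rmult_le_compat_l; lra).
      split; nra. }
    unfold Rdiv. rewrite Rabs_mult, (Rabs_right (/ t)) by (apply Rle_ge, Rlt_le, Rinv_0_lt_compat; lra).
    rewrite Rabs_right by lra.
    apply Rmult_le_reg_r with t; [lra|]. rewrite Rmult_assoc, Rinv_l, Rmult_1_r by lra.
    eapply Rle_trans; [apply (proj2 Hd)|].
    replace (12 * t * exp (- x) * t) with (exp (- x) * 1 * (12 * t ^ 2)) by ring.
    apply Rle_trans with (exp (- x) * (x * exp (- x)) * (12 * t ^ 2)).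
    - apply Rle_trans with (exp (- (2 * x)) * (2 * INR n * t ^ 3)).
      + apply Rmult_le_compat_r; [|assumption].
        assert (0 <= t ^ 3) by (apply pow_le; lra). nra.
      + rewrite He2. unfold x. apply Req_le; field.
    - apply Rmult_le_compat_r; [nra|]. apply Rmult_le_compat_l; lra. }
  fold x. lra.
Qed.

End SmallAngles.

(* [regular f]: on the open interval, [f] agrees with a function continuous on [0, PI/2]; the integrands below have a removable singularity at [0]. *)
Definition regular (f : R -> R) : Prop :=
  exists g, (forall t, 0 <= t <= PI / 2 -> continuous g t) /\ forall t, 0 < t < PI / 2 -> f t = g t.
Definition integ (f : R -> R) : R := RInt f 0 (PI / 2).

Lemma regular_ex_RInt f : regular f -> ex_RInt f 0 (PI / 2).
Proof.
  pose proof PI2_RGT_0.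
  intros [g [Hg E]]. apply ex_RInt_ext with g.
  - rewrite Rmin_left, Rmax_right by lra. intros t Ht; symmetry; now apply E.
  - apply (ex_RInt_continuous g). rewrite Rmin_left, Rmax_right by lra. exact Hg.
Qed.

Lemma regular_continuous f : (forall t, 0 <= t <= PI / 2 -> continuous f t) -> regular f.
Proof. intros H; now exists f. Qed.

Lemma regular_ext f g : (forall t, 0 < t < PI / 2 -> f t = g t) -> regular f -> regular g.
Proof. intros E [h [H1 H2]]; exists h; split; [assumption|]. intros t Ht; rewrite <- E; auto. Qed.

Lemma regular_plus f g : regular f -> regular g -> regular (fun t => f t + g t).
Proof.
  intros [f' [F1 F2]] [g' [G1 G2]]. exists (fun t => f' t + g' t); split.
  - intros t Ht. apply (continuous_plus f' g'); auto.
  - intros t Ht. now rewrite F2, G2.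
Qed.

Lemma regular_mult f g : regular f -> regular g -> regular (fun t => f t * g t).
Proof.
  intros [f' [F1 F2]] [g' [G1 G2]]. exists (fun t => f' t * g' t); split.
  - intros t Ht. apply (continuous_mult f' g'); auto.
  - intros t Ht. now rewrite F2, G2.
Qed.

Lemma regular_const c : regular (fun _ => c).
Proof. apply regular_continuous; intros; apply continuous_const. Qed.

Lemma regular_scal c f : regular f -> regular (fun t => c * f t).
Proof. intros; apply regular_mult; [apply regular_const | assumption]. Qed.

Lemma regular_minus f g : regular f -> regular g -> regular (fun t => f t - g t).
Proof.
  intros Hf Hg. apply regular_ext with (fun t => f t + (-1) * g t); [intros; ring|].
  apply regular_plus; [|apply regular_scal]; assumption.
Qed.

Lemma regular_cos a : regular (fun t => cos (a * t)).
Proof.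
  apply regular_continuous; intros. apply (ex_derive_continuous (fun t => cos (a * t))).
  auto_derive; easy.
Qed.

Lemma regular_exp a : regular (fun t => exp (a * t)).
Proof.
  apply regular_continuous; intros. apply (ex_derive_continuous (fun t => exp (a * t))).
  auto_derive; easy.
Qed.

Lemma regular_id : regular (fun t => t).
Proof. apply regular_continuous; intros; apply continuous_id. Qed.

Lemma regular_removable f L C : (forall t, 0 < t <= PI / 2 -> continuous f t) ->
  (forall t, 0 < t <= PI / 2 -> Rabs (f t - L) <= C * t) -> regular f.
Proof.
  pose proof PI2_RGT_0 as Hpi.
  (* Continuity at [0] is two-sided, so the extension takes the value [L] on the whole negative
     side. *)
  intros Hc HL. exists (fun t => if Rle_dec t 0 then L else f t). split.
  2: { intros t Ht; destruct Rle_dec; [lra | reflexivity]. }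
  intros t [[Ht| <-] Ht'].
  - apply continuous_ext_loc with f; [|apply Hc; lra].
    exists (mkposreal t Ht). intros y Hy. unfold ball in Hy; cbn in Hy.
    unfold AbsRing_ball, abs, minus, plus, opp in Hy; cbn in Hy. apply Rabs_def2 in Hy.
    destruct Rle_dec; [lra | reflexivity].
  - apply continuity_pt_filterlim. intros eps Heps.
    assert (HC : 0 <= C).
    { pose proof (HL (PI / 2) ltac:(lra)). pose proof (Rabs_pos (f (PI / 2) - L)). nra. }
    exists (Rmin (PI / 2) (eps / (C + 1))). split.
    { apply Rmin_pos; [lra | apply Rdiv_lt_0_compat; lra]. }
    intros y [_ Hy]. cbn in *. unfold Rdist in *. rewrite Rminus_0_r in Hy.
    destruct (Rle_dec 0 0); [|lra].
    destruct (Rle_dec y 0) as [|Hy0]; [rewrite Rminus_diag, Rabs_R0; assumption|].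
    rewrite Rabs_right in Hy by lra.
    pose proof (Rmin_l (PI / 2) (eps / (C + 1))). pose proof (Rmin_r (PI / 2) (eps / (C + 1))).
    eapply Rle_lt_trans; [apply HL; lra|].
    apply Rle_lt_trans with ((C + 1) * y); [nra|].
    apply Rmult_lt_reg_l with (/ (C + 1)); [apply Rinv_0_lt_compat; lra|].
    rewrite <- Rmult_assoc, Rinv_l by lra. unfold Rdiv in *. lra.
Qed.

(** * Integration over [[0, PI / 2]] *)

Lemma integ_ext f g : (forall t, 0 < t < PI / 2 -> f t = g t) -> integ f = integ g.
Proof.
  pose proof PI2_RGT_0. intros E. apply RInt_ext. rewrite Rmin_left, Rmax_right by lra. exact E.
Qed.

Lemma integ_plus f g : regular f -> regular g -> integ (fun t => f t + g t) = integ f + integ g.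
Proof. intros; apply (RInt_plus f g); now apply regular_ex_RInt. Qed.

Lemma integ_minus f g : regular f -> regular g -> integ (fun t => f t - g t) = integ f - integ g.
Proof. intros; apply (RInt_minus f g); now apply regular_ex_RInt. Qed.

Lemma integ_scal c f : regular f -> integ (fun t => c * f t) = c * integ f.
Proof. intros; apply (RInt_scal f); now apply regular_ex_RInt. Qed.

Lemma integ_le f g : regular f -> regular g ->
  (forall t, 0 < t < PI / 2 -> f t <= g t) -> integ f <= integ g.
Proof.
  pose proof PI2_RGT_0. intros; apply RInt_le; [lra | | | assumption]; now apply regular_ex_RInt.
Qed.

Lemma integ_abs_le f g : regular f -> regular g ->
  (forall t, 0 < t < PI / 2 -> Rabs (f t) <= g t) -> Rabs (integ f) <= integ g.
Proof.
  intros Hf Hg H. apply Rabs_le; split.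
  - replace (- integ g) with (integ (fun t => -1 * g t)) by (rewrite integ_scal by assumption; ring).
    apply integ_le; [now apply regular_scal | assumption |].
    intros t Ht; specialize (H t Ht). apply Rabs_le_between in H; lra.
  - apply integ_le; [assumption .. |].
    intros t Ht; specialize (H t Ht). apply Rabs_le_between in H; lra.
Qed.

Lemma integ_const c : integ (fun _ => c) = PI / 2 * c.
Proof. unfold integ. rewrite RInt_const. unfold scal; cbn; unfold mult; cbn; ring. Qed.

Lemma integ_derive f df : (forall t, is_derive f t (df t)) -> (forall t, continuous df t) ->
  integ df = f (PI / 2) - f 0.
Proof.
  intros Hd Hc. unfold integ. apply is_RInt_unique.
  apply (is_RInt_derive f df); intros; auto.
Qed.

(** The source of the powers [n^-2]: both the remainder and the dependence on the angle reduce to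
    this integral. *)
Lemma integ_linear_exp_le k : 0 < k -> integ (fun t => t * exp (- (k * t))) <= / k ^ 2.
Proof.
  intros Hk. pose proof PI2_RGT_0.
  rewrite (integ_derive (fun t => - ((t / k + / k ^ 2) * exp (- (k * t))))).
  - rewrite Rmult_0_r, Ropp_0, exp_0.
    pose proof (exp_pos (- (k * (PI / 2)))).
    assert (0 < / k ^ 2) by (apply Rinv_0_lt_compat, pow_lt, Hk).
    assert (0 < PI / 2 / k) by (apply Rdiv_lt_0_compat; lra).
    replace (0 / k) with 0 by (field; lra). nra.
  - intros t. auto_derive; [easy|]. field; lra.
  - intros t. apply (ex_derive_continuous (fun t => t * exp (- (k * t)))). auto_derive; easy.
Qed.

(** * Logarithmic part and remainder of the kernel *)

Lemma exp_remainder_2 u : 0 <= u -> 0 <= exp (- u) - 1 + u <= u ^ 2 / 2.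
Proof.
  intros Hu. split.
  - pose proof (exp_ineq1_le (- u)). lra.
  - enough (0 ^ 2 / 2 - exp (- 0) + 1 - 0 <= u ^ 2 / 2 - exp (- u) + 1 - u)
      by (rewrite Ropp_0, exp_0 in *; lra).
    apply (derive_nonneg_le (fun u => u ^ 2 / 2 - exp (- u) + 1 - u) (fun u => u + exp (- u) - 1));
      [assumption| |].
    + intros x _. auto_derive; [easy | field].
    + intros x _. pose proof (exp_ineq1_le (- x)). lra.
Qed.

(** The real part of [(1 - exp (- (a - i b) t)) / t]; its integral grows like the real part of
    [ln (a - i b)]. *)
Definition logint (a b t : R) : R := (1 - exp (- (a * t)) * cos (b * t)) / t.

Lemma logint_regular a b : 0 <= a -> regular (logint a b).
Proof.
  intros Ha. apply regular_removable with a (a ^ 2 + b ^ 2).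
  - intros t Ht. apply (ex_derive_continuous (logint a b)). unfold logint.
    auto_derive. lra.
  - intros t Ht. unfold logint.
    replace ((1 - exp (- (a * t)) * cos (b * t)) / t - a)
      with ((- (exp (- (a * t)) - 1 + a * t) + exp (- (a * t)) * (1 - cos (b * t))) / t)
      by (field; lra).
    assert (Hat : 0 <= a * t) by (apply Rmult_le_pos; lra).
    pose proof (exp_remainder_2 (a * t) Hat).
    pose proof (cos_ge_quadratic (b * t)). pose proof (COS_bound (b * t)).
    pose proof (exp_pos (- (a * t))).
    assert (exp (- (a * t)) <= 1) by (rewrite <- exp_0; apply exp_le_exp; lra).
    unfold Rdiv. rewrite Rabs_mult, (Rabs_right (/ t)) by (apply Rle_ge, Rlt_le, Rinv_0_lt_compat; lra).
    apply Rmult_le_reg_r with t; [lra|]. rewrite Rmult_assoc, Rinv_l, Rmult_1_r by lra.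
    assert (0 <= exp (- (a * t)) * (1 - cos (b * t)) <= (b * t) ^ 2 / 2) by (split; nra).
    replace ((a ^ 2 + b ^ 2) * t * t) with ((a * t) ^ 2 + (b * t) ^ 2) by ring.
    apply Rabs_le. pose proof (pow2_ge_0 (a * t)). pose proof (pow2_ge_0 (b * t)). lra.
Qed.

(** For [n = 0] this is [1 / (sin t * rho t) - 1 / t]: each term is singular at [0], the difference
    is not. *)
Definition remainder (n : nat) (t : R) : R :=
  decay t ^ n / (sin t * rho t) - exp (- (2 * INR n * t)) / t.

Lemma remainder_regular n : regular (remainder n).
Proof.
  apply regular_removable with 0 15.
  - intros t Ht. pose proof (sin_small_pos t Ht). pose proof (rho_pos t).
    apply (ex_derive_continuous (remainder n)). unfold remainder, decay, rho in *.
    auto_derive.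
    replace (sin t * (sin t * 1)) with (sin t ^ 2) by ring.
    repeat split; nra.
  - intros t Ht. rewrite Rminus_0_r. unfold remainder.
    eapply Rle_trans; [apply remainder_bound, Ht|].
    assert (exp (- (INR n / 6 * t)) <= 1).
    { rewrite <- exp_0; apply exp_le_exp. pose proof (pos_INR n).
      assert (0 <= INR n / 6 * t) by (apply Rmult_le_pos; lra). lra. }
    nra.
Qed.

Definition kernel (n : nat) (m : Z) (t : R) : R :=
  (1 - decay t ^ n * cos (2 * IZR m * t)) / (sin t * rho t).

Lemma kernel_decompose n m t : 0 < t < PI / 2 ->
  kernel n m t = logint (2 * INR n) (2 * IZR m) t
                 + (remainder 0 t - remainder n t * cos (2 * IZR m * t)).
Proof.
  intros Ht. pose proof (sin_small_pos t ltac:(lra)). pose proof (rho_pos t).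
  unfold kernel, logint, remainder; cbn [pow INR].
  rewrite Rmult_0_r, Rmult_0_l, Ropp_0, exp_0. field. lra.
Qed.

Lemma kernel_tail_regular n m : regular (fun t => remainder 0 t - remainder n t * cos (2 * IZR m * t)).
Proof.
  apply regular_minus; [apply remainder_regular|].
  apply regular_mult; [apply remainder_regular | apply regular_cos].
Qed.

Lemma kernel_regular n m : regular (kernel n m).
Proof.
  pose proof (pos_INR n).
  eapply regular_ext; [intros t Ht; symmetry; now apply kernel_decompose|].
  apply regular_plus; [apply logint_regular; lra | apply kernel_tail_regular].
Qed.

(** The second coordinate is the exponential direction, the first the oscillating one. The exchange
    of coordinates is a hidden symmetry of this formula; it is recovered later from that of
    [pot]. *)
Definition ipot (x : pt) : R := 2 / PI * integ (kernel (Z.abs_nat (snd x)) (fst x)).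

Lemma ipot_origin : ipot origin = 0.
Proof.
  unfold ipot, origin; cbn [fst snd].
  rewrite (integ_ext _ (fun _ => 0)), integ_const; [ring|].
  intros t _. unfold kernel. change (Z.abs_nat 0) with O; cbn [pow].
  rewrite Rmult_0_r, Rmult_0_l, cos_0. unfold Rdiv; ring.
Qed.

Lemma ipot_opp x : ipot (popp x) = ipot x.
Proof.
  destruct x as [x1 x2]; unfold ipot, popp, psub, origin; cbn [fst snd].
  rewrite !Z.sub_0_l. replace (Z.abs_nat (- x2)) with (Z.abs_nat x2) by lia. f_equal. apply integ_ext; intros t _.
  unfold kernel. rewrite opp_IZR, <- cos_neg. do 4 f_equal. ring.
Qed.

Lemma decay_shift t : decay t * (2 + 2 * (2 * sin t ^ 2)) = 1 + decay t * decay t.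
Proof.
  pose proof (rho_sqr t) as H. pose proof (decay_mult t) as H2.
  replace (2 + 2 * (2 * sin t ^ 2)) with ((rho t - sin t) ^ 2 + (rho t + sin t) ^ 2) by nra.
  rewrite Rmult_plus_distr_l, H2. unfold decay. ring.
Qed.

Lemma cos_double_sin t : cos (2 * t) = 1 - 2 * sin t ^ 2.
Proof. rewrite cos_2a_sin; ring. Qed.

Lemma cos_neighbours m t :
  cos (2 * IZR (m + 1) * t) + cos (2 * IZR (m - 1) * t) = 2 * cos (2 * t) * cos (2 * IZR m * t).
Proof.
  rewrite plus_IZR, minus_IZR.
  replace (2 * (IZR m + 1) * t) with (2 * IZR m * t + 2 * t) by ring.
  replace (2 * (IZR m - 1) * t) with (2 * IZR m * t - 2 * t) by ring.
  rewrite cos_plus, cos_minus; ring.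
Qed.

Lemma kernel_harmonic_row n m t : 0 < t < PI / 2 ->
  kernel (S n) (m + 1) t + kernel (S n) (m - 1) t + kernel (S (S n)) m t + kernel n m t
  = 4 * kernel (S n) m t.
Proof.
  intros Ht. pose proof (sin_small_pos t ltac:(lra)). pose proof (rho_pos t).
  unfold kernel.
  assert (E : decay t ^ S n * (cos (2 * IZR (m + 1) * t) + cos (2 * IZR (m - 1) * t))
              + (decay t ^ S (S n) + decay t ^ n) * cos (2 * IZR m * t)
              = 4 * (decay t ^ S n * cos (2 * IZR m * t))).
  { rewrite cos_neighbours, cos_double_sin. cbn [pow].
    pose proof (decay_shift t) as Hd.
    replace (decay t * (decay t * decay t ^ n) + decay t ^ n)
      with ((1 + decay t * decay t) * decay t ^ n) by ring.
    rewrite <- Hd; ring. }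
  apply Rmult_eq_reg_r with (sin t * rho t); [|apply Rgt_not_eq, Rmult_lt_0_compat; assumption].
  field_simplify; [|lra ..]. lra.
Qed.

(** On the axis both vertical neighbours have height [1], so the separated solution has a kink. The
    defect [4 cos (2 m t)] integrates to [0] unless [m = 0], where it produces the unit mass of the
    Laplacian. *)
Lemma kernel_harmonic_axis m t : 0 < t < PI / 2 ->
  kernel 0 (m + 1) t + kernel 0 (m - 1) t + 2 * kernel 1 m t - 4 * kernel 0 m t
  = 4 * cos (2 * IZR m * t).
Proof.
  intros Ht. pose proof (sin_small_pos t ltac:(lra)). pose proof (rho_pos t).
  pose proof (rho_sqr t) as Hr. pose proof (cos_neighbours m t) as E. rewrite cos_double_sin in E.
  unfold kernel; cbn [pow].
  apply Rmult_eq_reg_r with (sin t * rho t); [|apply Rgt_not_eq, Rmult_lt_0_compat; assumption].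
  field_simplify; [|lra ..]. unfold decay in *.
  replace ((rho t - sin t) ^ 2) with (1 + 2 * sin t ^ 2 - 2 * (rho t * sin t)) by nra. lra.
Qed.

Lemma integ_cos_int m : integ (fun t => cos (2 * IZR m * t)) = if Z.eq_dec m 0 then PI / 2 else 0.
Proof.
  destruct Z.eq_dec as [->|Hm].
  - rewrite (integ_ext _ (fun _ => 1)), integ_const; [ring|].
    intros t _. now rewrite Rmult_0_r, Rmult_0_l, cos_0.
  - assert (IZR m <> 0) by (now apply not_0_IZR).
    rewrite (integ_derive (fun t => sin (2 * IZR m * t) / (2 * IZR m))).
    + replace (2 * IZR m * (PI / 2)) with (IZR m * PI) by field.
      rewrite (sin_eq_0_1 (IZR m * PI)) by (now exists m). rewrite Rmult_0_r, sin_0. field; assumption.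
    + intros t. auto_derive; [easy | field; assumption].
    + intros t. apply (ex_derive_continuous (fun t => cos (2 * IZR m * t))). auto_derive; easy.
Qed.

Lemma ipot_avg x : avg ipot x = ipot x + delta0 x.
Proof.
  pose proof PI_RGT_0 as Hpi.
  assert (Hrow : forall n m, integ (kernel (S n) (m + 1)) + integ (kernel (S n) (m - 1)) + integ (kernel (S (S n)) m)
                 + integ (kernel n m) = 4 * integ (kernel (S n) m)).
  { intros n m. pose proof kernel_regular as Hk.
    rewrite <- (integ_plus (kernel (S n) (m + 1))), <- integ_plus, <- integ_plus, <- integ_scal
      by (repeat apply regular_plus; apply Hk).
    apply integ_ext; intros; now apply kernel_harmonic_row. }
  destruct x as [m z]. rewrite avg_eq. unfold ipot; cbn [fst snd].
  destruct (Z.abs_nat z) as [|n] eqn:Ez.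
  - assert (z = 0%Z) by lia; subst z. change (Z.abs_nat (0 + 1)) with 1%nat.
    change (Z.abs_nat (0 - 1)) with 1%nat.
    assert (Hax : integ (kernel 0 (m + 1)) + integ (kernel 0 (m - 1)) + 2 * integ (kernel 1 m) - 4 * integ (kernel 0 m)
                  = 4 * integ (fun t => cos (2 * IZR m * t))).
    { pose proof kernel_regular as Hk.
      rewrite <- (integ_plus (kernel 0 (m + 1))), <- !integ_scal, <- integ_plus, <- integ_minus
        by (try apply regular_cos; repeat apply regular_plus; try apply regular_scal; apply Hk).
      apply integ_ext; intros; now apply kernel_harmonic_axis. }
    rewrite integ_cos_int in Hax. unfold delta0, origin.
    destruct Z.eq_dec as [->|Hm], pt_eq_dec as [E|E]; try congruence.
    + apply Rmult_eq_reg_r with (2 * PI); [|lra]. field_simplify; lra.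
    + apply Rmult_eq_reg_r with (2 * PI); [|lra]. field_simplify; lra.
  - assert (Hd : delta0 (m, z) = 0).
    { unfold delta0, origin; destruct pt_eq_dec as [E|]; [|reflexivity]. injection E; lia. }
    rewrite Hd. specialize (Hrow n m).
    assert (Hz : integ (kernel (Z.abs_nat (z + 1)) m) + integ (kernel (Z.abs_nat (z - 1)) m)
                 = integ (kernel (S (S n)) m) + integ (kernel n m)).
    { destruct (Z_le_dec 0 z).
      - replace (Z.abs_nat (z + 1)) with (S (S n)) by lia. now replace (Z.abs_nat (z - 1)) with n by lia.
      - replace (Z.abs_nat (z - 1)) with (S (S n)) by lia. replace (Z.abs_nat (z + 1)) with n by lia. ring. }
    apply Rmult_eq_reg_r with (2 * PI); [|lra]. field_simplify; lra.
Qed.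

(** The factor [1 - decay t = 2 sin t (rho t - sin t)] cancels the singular [sin t] of the
    denominator. In the horizontal direction a difference of cosines supplies the same factor. *)
Lemma kernel_step_vertical n m t : 0 < t < PI / 2 -> Rabs (kernel (S n) m t - kernel n m t) <= 2.
Proof.
  intros Ht. pose proof (sin_small_pos t ltac:(lra)) as Hs. pose proof (rho_ge_1 t) as Hr.
  pose proof (rho_sqr t) as Hq.
  unfold kernel; cbn [pow].
  assert (E : 1 - decay t = 2 * sin t * (rho t - sin t)) by (unfold decay; nra).
  replace ((1 - decay t * decay t ^ n * cos (2 * IZR m * t)) / (sin t * rho t) -
           (1 - decay t ^ n * cos (2 * IZR m * t)) / (sin t * rho t))
    with (decay t ^ n * cos (2 * IZR m * t) * (2 * ((rho t - sin t) / rho t))).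
  2: { transitivity (decay t ^ n * cos (2 * IZR m * t) * (1 - decay t) / (sin t * rho t));
       [rewrite E|]; field; lra. }
  assert (Hd : 0 <= decay t <= 1).
  { split; [apply Rlt_le, decay_pos; lra|].
    rewrite decay_exp, <- exp_0. apply exp_le_exp. pose proof (ln_rho_lower t ltac:(lra)). lra. }
  rewrite !Rabs_mult.
  assert (H1 : Rabs (decay t ^ n) <= 1).
  { rewrite Rabs_right by (apply Rle_ge, pow_le; lra).
    rewrite <- (pow1 n). apply pow_incr; lra. }
  assert (H2 : Rabs (cos (2 * IZR m * t)) <= 1) by (apply Rabs_le; apply COS_bound).
  assert (H3 : Rabs ((rho t - sin t) / rho t) <= 1).
  { assert (0 <= rho t - sin t) by nra.
    rewrite Rabs_right by (apply Rle_ge, Rdiv_le_0_compat; lra).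
    apply Rmult_le_reg_r with (rho t); [lra|]. unfold Rdiv; rewrite Rmult_assoc, Rinv_l; lra. }
  rewrite (Rabs_right 2) by lra.
  pose proof (Rabs_pos (decay t ^ n)). pose proof (Rabs_pos (cos (2 * IZR m * t))).
  pose proof (Rabs_pos ((rho t - sin t) / rho t)).
  assert (Rabs (decay t ^ n) * Rabs (cos (2 * IZR m * t)) <= 1) by nra.
  assert (0 <= Rabs (decay t ^ n) * Rabs (cos (2 * IZR m * t))) by nra.
  nra.
Qed.

Lemma kernel_step_horizontal n m t : 0 < t < PI / 2 -> Rabs (kernel n (m + 1) t - kernel n m t) <= 2.
Proof.
  intros Ht. pose proof (sin_small_pos t ltac:(lra)) as Hs. pose proof (rho_ge_1 t) as Hr.
  unfold kernel.
  replace ((1 - decay t ^ n * cos (2 * IZR (m + 1) * t)) / (sin t * rho t) -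
           (1 - decay t ^ n * cos (2 * IZR m * t)) / (sin t * rho t))
    with (decay t ^ n * (cos (2 * IZR m * t) - cos (2 * IZR (m + 1) * t)) / (sin t * rho t))
    by (field; lra).
  rewrite form2.
  replace ((2 * IZR m * t - 2 * IZR (m + 1) * t) / 2) with (- t) by (rewrite plus_IZR; field).
  rewrite sin_neg.
  set (u := sin ((2 * IZR m * t + 2 * IZR (m + 1) * t) / 2)).
  assert (Hd : 0 <= decay t <= 1).
  { split; [apply Rlt_le, decay_pos; lra|].
    rewrite decay_exp, <- exp_0. apply exp_le_exp. pose proof (ln_rho_lower t ltac:(lra)). lra. }
  assert (H1 : 0 <= decay t ^ n <= 1).
  { split; [apply pow_le; lra|]. rewrite <- (pow1 n). apply pow_incr; lra. }
  replace (decay t ^ n * (-2 * - sin t * u) / (sin t * rho t))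
    with (2 * (decay t ^ n * (u * / rho t))) by (field; lra).
  assert (H2 : Rabs u <= 1) by (apply Rabs_le, SIN_bound).
  assert (H3 : 0 < / rho t <= 1).
  { split; [apply Rinv_0_lt_compat; lra|]. rewrite <- Rinv_1. apply Rinv_le_contravar; lra. }
  rewrite !Rabs_mult, (Rabs_right 2), (Rabs_right (decay t ^ n)), (Rabs_right (/ rho t)) by lra.
  pose proof (Rabs_pos u). assert (Rabs u * / rho t <= 1) by nra.
  assert (0 <= Rabs u * / rho t) by nra. nra.
Qed.

Lemma ipot_step x e : In e dirs -> Rabs (ipot (padd x e) - ipot x) <= 2.
Proof.
  pose proof PI_RGT_0 as Hpi. pose proof kernel_regular as Hk.
  assert (HI : forall n m n' m', (forall t, 0 < t < PI / 2 -> Rabs (kernel n m t - kernel n' m' t) <= 2) ->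
             Rabs (2 / PI * integ (kernel n m) - 2 / PI * integ (kernel n' m')) <= 2).
  { intros n m n' m' H. rewrite <- Rmult_minus_distr_l, <- integ_minus by apply Hk.
    rewrite Rabs_mult, (Rabs_right (2 / PI)) by (apply Rle_ge, Rlt_le, Rdiv_lt_0_compat; lra).
    apply Rle_trans with (2 / PI * (PI / 2 * 2)); [|apply Req_le; field; lra].
    apply Rmult_le_compat_l; [apply Rlt_le, Rdiv_lt_0_compat; lra|].
    rewrite <- integ_const. apply integ_abs_le; [apply regular_minus; apply Hk | apply regular_const | exact H]. }
  destruct x as [m z]. unfold ipot, padd.
  intros [<-|[<-|[<-|[<-|[]]]]]; cbn [fst snd]; apply HI; intros t Ht;
    rewrite ?Z.add_0_r; try (now apply kernel_step_horizontal).
  - rewrite Rabs_minus_sym. replace m with (m + -1 + 1)%Z at 1 by lia. now apply kernel_step_horizontal.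
  - destruct (Z_le_dec 0 z).
    + replace (Z.abs_nat (z + 1)) with (S (Z.abs_nat z)) by lia. now apply kernel_step_vertical.
    + replace (Z.abs_nat z) with (S (Z.abs_nat (z + 1))) by lia. rewrite Rabs_minus_sym. now apply kernel_step_vertical.
  - destruct (Z_lt_dec 0 z).
    + replace (Z.abs_nat z) with (S (Z.abs_nat (z + -1))) by lia. rewrite Rabs_minus_sym. now apply kernel_step_vertical.
    + replace (Z.abs_nat (z + -1)) with (S (Z.abs_nat z)) by lia. now apply kernel_step_vertical.
Qed.

(** Both functions have Laplacian [delta0] and bounded increments, so their difference is affine; it
    is even, hence constant, and vanishes at the origin. *)
Lemma pot_eq_ipot x : pot x = ipot x.
Proof.
  set (h := fun x => pot x - ipot x).
  assert (Hh : forall x, avg h x = h x).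
  { intros y. unfold h. rewrite avg_minus, pot_avg, ipot_avg; ring. }
  assert (Hopp : forall x, h (popp x) = h x) by (intros y; unfold h; now rewrite pot_opp, ipot_opp).
  assert (Hinc := harmonic_lipschitz_increment h 3 Hh).
  assert (Hl : forall x e, In e dirs -> Rabs (h (padd x e) - h x) <= 3).
  { intros y e He. unfold h. pose proof (pot_step y e He) as A. pose proof (ipot_step y e He) as B.
    apply Rabs_le_between in A, B. apply Rabs_le; lra. }
  assert (Hc : forall x, h x = h origin).
  { apply step_invariant_const; intros y e He.
    (* The step from [popp e] to the origin equals the step from the origin to [e], while evenness
       makes them opposite; so both are zero. *)
    pose proof (Hinc Hl (popp e) e He) as A. pose proof (Hinc Hl y e He) as B.
    assert (E1 : padd (popp e) e = origin) by (rewrite padd_comm; destruct e; unfold padd, popp, psub, origin; cbn; f_equal; lia).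
    assert (E2 : padd origin e = e) by (destruct e; reflexivity).
    rewrite E1, E2, Hopp in A. rewrite E2 in B. lra. }
  specialize (Hc x). unfold h in Hc. rewrite pot_origin, ipot_origin in Hc. lra.
Qed.

(** ** Asymptotics of the potential kernel *)

Lemma exp_remainder_abs x : Rabs x <= / 2 -> Rabs (1 - exp (- x) - x) <= 2 * x ^ 2.
Proof.
  intros Hx. apply Rabs_le_between in Hx. pose proof (exp_ineq1_le (- x)). pose proof (exp_ineq1_le x).
  assert (Hinv : exp (- x) * exp x = 1) by (rewrite <- exp_plus, Rplus_opp_l; apply exp_0).
  pose proof (exp_pos (- x)).
  apply Rabs_le; split; [|nra].
  assert (exp (- x) * (1 + x) <= 1) by nra.
  assert (1 <= (1 - x + 2 * x ^ 2) * (1 + x)) by nra.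
  nra.
Qed.

Lemma logint_increment v u h t : 0 < t < PI / 2 ->
  logint (2 * (v + h)) (2 * u) t - logint (2 * v) (2 * u) t
    - h * (2 * (exp (- (2 * v * t)) * cos (2 * u * t)))
  = exp (- (2 * v * t)) * cos (2 * u * t) * ((1 - exp (- (2 * h * t)) - 2 * h * t) / t).
Proof.
  intros Ht. unfold logint.
  replace (- (2 * (v + h) * t)) with (- (2 * v * t) + - (2 * h * t)) by ring.
  rewrite exp_plus. field; lra.
Qed.

(** The height [|n|] and the abscissa [m] are replaced by real parameters, so that the integral can
    be differentiated in [v]. *)
Definition J (v u : R) : R := integ (logint (2 * v) (2 * u)).
Definition J' (v u : R) : R := 2 * integ (fun t => exp (- (2 * v * t)) * cos (2 * u * t)).

Lemma damped_cos_regular v u : regular (fun t => exp (- (2 * v * t)) * cos (2 * u * t)).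
Proof.
  apply regular_mult; [|apply regular_cos].
  apply regular_ext with (fun t => exp (- (2 * v) * t)); [|apply regular_exp].
  intros; f_equal; ring.
Qed.

(** Differentiation under the integral sign, done by hand: the increment differs from its linear
    part by at most [16 h^2], uniformly in [t]. *)
Lemma J_derive v u : 0 < v -> is_derive (fun v => J v u) v (J' v u).
Proof.
  intros Hv. pose proof PI2_RGT_0 as Hpi. pose proof PI_4 as Hpi4.
  apply is_derive_Reals. intros eps Heps.
  (* The bound by [v] keeps [v + h] positive, [/ 8] gives [|2 h t| <= 1 / 2] since [t < 2], and
     [eps / 64] beats the factor [32] of the final estimate. *)
  assert (Hd : 0 < Rmin v (Rmin (/ 8) (eps / 64))) by (repeat apply Rmin_pos; lra).
  exists (mkposreal _ Hd). intros h Hh0 Hh; cbn in Hh.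
  pose proof (Rmin_l v (Rmin (/ 8) (eps / 64))). pose proof (Rmin_r v (Rmin (/ 8) (eps / 64))).
  pose proof (Rmin_l (/ 8) (eps / 64)). pose proof (Rmin_r (/ 8) (eps / 64)).
  assert (Hh' : - v < h < v) by (apply Rabs_lt_between; lra).
  set (g := fun t => exp (- (2 * v * t)) * cos (2 * u * t)).
  assert (Hg : regular g) by apply damped_cos_regular.
  assert (R1 : regular (logint (2 * (v + h)) (2 * u))) by (apply logint_regular; lra).
  assert (R2 : regular (logint (2 * v) (2 * u))) by (apply logint_regular; lra).
  assert (E : J (v + h) u - J v u - h * J' v u
              = integ (fun t => logint (2 * (v + h)) (2 * u) t - logint (2 * v) (2 * u) t - h * (2 * g t))).
  { unfold J, J'. fold g. rewrite integ_minus, integ_minus, !integ_scal; auto using regular_scal, regular_minus. }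
  assert (B : Rabs (J (v + h) u - J v u - h * J' v u) <= PI / 2 * (16 * h ^ 2)).
  { rewrite E, <- integ_const. apply integ_abs_le; auto using regular_scal, regular_minus, regular_const.
    intros t Ht. unfold g. rewrite logint_increment by assumption.
    assert (Hx : Rabs (2 * h * t) <= / 2).
    { rewrite !Rabs_mult, (Rabs_right 2), (Rabs_right t) by lra.
      pose proof (Rabs_pos h). nra. }
    pose proof (exp_remainder_abs _ Hx).
    assert (Rabs ((1 - exp (- (2 * h * t)) - 2 * h * t) / t) <= 16 * h ^ 2).
    { unfold Rdiv. rewrite Rabs_mult, (Rabs_right (/ t)) by (apply Rle_ge, Rlt_le, Rinv_0_lt_compat; lra).
      apply Rmult_le_reg_r with t; [lra|]. rewrite Rmult_assoc, Rinv_l, Rmult_1_r by lra.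
      eapply Rle_trans; [eassumption|]. pose proof (pow2_ge_0 h).
      replace (2 * (2 * h * t) ^ 2) with (8 * h ^ 2 * t * t) by ring.
      apply Rmult_le_compat_r; [lra|]. nra. }
    rewrite !Rabs_mult, (Rabs_right (exp _)) by (apply Rle_ge, Rlt_le, exp_pos).
    assert (exp (- (2 * v * t)) <= 1) by (rewrite <- exp_0; apply exp_le_exp; nra).
    assert (Rabs (cos (2 * u * t)) <= 1) by (apply Rabs_le, COS_bound).
    pose proof (exp_pos (- (2 * v * t))). pose proof (Rabs_pos (cos (2 * u * t))).
    pose proof (Rabs_pos ((1 - exp (- (2 * h * t)) - 2 * h * t) / t)).
    assert (exp (- (2 * v * t)) * Rabs (cos (2 * u * t)) <= 1) by nra.
    nra. }
  replace ((J (v + h) u - J v u) / h - J' v u) with ((J (v + h) u - J v u - h * J' v u) / h) by (field; lra).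
  unfold Rdiv. rewrite Rabs_mult, Rabs_inv.
  pose proof (Rabs_pos_lt h Hh0).
  apply Rmult_lt_reg_r with (Rabs h); [assumption|]. rewrite Rmult_assoc, Rinv_l, Rmult_1_r by lra.
  eapply Rle_lt_trans; [apply B|]. rewrite <- (pow2_abs h).
  apply Rle_lt_trans with (32 * Rabs h * Rabs h); nra.
Qed.

Lemma J'_value v u : 0 < v -> J' v u = v / (v ^ 2 + u ^ 2)
  + exp (- (PI * v)) * (u * sin (PI * u) - v * cos (PI * u)) / (v ^ 2 + u ^ 2).
Proof.
  intros Hv. assert (0 < v ^ 2 + u ^ 2) by nra. unfold J'.
  rewrite (integ_derive (fun t => exp (- (2 * v * t)) * (u * sin (2 * u * t) - v * cos (2 * u * t)) / (2 * (v ^ 2 + u ^ 2)))).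
  - rewrite !Rmult_0_r, Ropp_0, exp_0, sin_0, cos_0.
    replace (2 * v * (PI / 2)) with (PI * v) by field.
    replace (2 * u * (PI / 2)) with (PI * u) by field. field. lra.
  - intros t. auto_derive; [easy|]. field. lra.
  - intros t. apply (ex_derive_continuous (fun t => exp (- (2 * v * t)) * cos (2 * u * t))).
    auto_derive; easy.
Qed.

(** The main term [v / (v^2 + u^2)] of [J'] is the derivative of the subtracted logarithm. Only the
    boundary term at [PI / 2] survives, and it is exponentially small in [v]. *)
Definition Jlog (u v : R) : R := J v u - / 2 * ln (v ^ 2 + u ^ 2).

Lemma Jlog_derive u v : 0 < v -> is_derive (Jlog u) v
  (exp (- (PI * v)) * (u * sin (PI * u) - v * cos (PI * u)) / (v ^ 2 + u ^ 2)).
Proof.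
  intros Hv. assert (0 < v ^ 2 + u ^ 2) by nra. unfold Jlog.
  replace (exp (- (PI * v)) * (u * sin (PI * u) - v * cos (PI * u)) / (v ^ 2 + u ^ 2))
    with (J' v u - v / (v ^ 2 + u ^ 2)) by (rewrite J'_value by assumption; field; lra).
  apply (is_derive_minus (fun v => J v u) (fun v => / 2 * ln (v ^ 2 + u ^ 2))).
  - now apply J_derive.
  - auto_derive; [nra | field; nra].
Qed.

(** A bound free of [u] is wanted. The shape [2 / v ^ 3] is chosen because it is minus the
    derivative of [/ v ^ 2], which the next lemma integrates. *)
Lemma Jlog_derive_bound u v : 0 < v ->
  Rabs (exp (- (PI * v)) * (u * sin (PI * u) - v * cos (PI * u)) / (v ^ 2 + u ^ 2)) <= 2 / v ^ 3.
Proof.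
  intros Hv. assert (Hp : 0 < v ^ 2 + u ^ 2) by nra. pose proof PI2_3_2 as Hpi.
  assert (He : exp (- (PI * v)) <= / v ^ 2).
  { pose proof (exp_ineq1_le (PI * v / 2)) as A.
    assert (E : exp (PI * v) = exp (PI * v / 2) * exp (PI * v / 2)) by (rewrite <- exp_plus; f_equal; field).
    rewrite exp_Ropp. apply Rinv_le_contravar; [nra|]. rewrite E. assert (v <= exp (PI * v / 2)) by nra. nra. }
  pose proof (exp_pos (- (PI * v))).
  assert (Hn : Rabs (u * sin (PI * u) - v * cos (PI * u)) <= Rabs u + v).
  { pose proof (SIN_bound (PI * u)). pose proof (COS_bound (PI * u)).
    unfold Rminus. eapply Rle_trans; [apply Rabs_triang|].
    rewrite Rabs_Ropp, !Rabs_mult, (Rabs_right v) by lra.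
    assert (Rabs (sin (PI * u)) <= 1) by (apply Rabs_le; lra).
    assert (Rabs (cos (PI * u)) <= 1) by (apply Rabs_le; lra).
    pose proof (Rabs_pos u). nra. }
  unfold Rdiv. rewrite !Rabs_mult, (Rabs_right (exp _)), (Rabs_right (/ _))
    by (apply Rle_ge, Rlt_le; try apply Rinv_0_lt_compat; assumption).
  assert (Hq : (Rabs u + v) * / (v ^ 2 + u ^ 2) <= 2 * / v).
  { apply Rmult_le_reg_r with (v ^ 2 + u ^ 2); [assumption|].
    rewrite Rmult_assoc, Rinv_l by lra. apply Rmult_le_reg_l with v; [assumption|].
    replace (v * (2 * / v * (v ^ 2 + u ^ 2))) with (2 * (v ^ 2 + u ^ 2)) by (field; lra).
    rewrite <- (pow2_abs u). pose proof (Rabs_pos u). nra. }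
  apply Rle_trans with (/ v ^ 2 * (2 * / v)); [|apply Req_le; field; lra].
  rewrite Rmult_assoc. apply Rmult_le_compat; [lra | | assumption |].
  - apply Rmult_le_pos; [apply Rabs_pos | apply Rlt_le, Rinv_0_lt_compat; assumption].
  - eapply Rle_trans; [|apply Hq]. apply Rmult_le_compat_r; [|assumption].
    apply Rlt_le, Rinv_0_lt_compat; assumption.
Qed.

(** Both [Jlog u v - / v ^ 2] and [- Jlog u v - / v ^ 2] are nondecreasing in [v]. *)
Lemma Jlog_gap u a b : 0 < a <= b -> Rabs (Jlog u a - Jlog u b) <= / a ^ 2.
Proof.
  intros [Ha Hab].
  assert (Hb2 : 0 < / b ^ 2) by (apply Rinv_0_lt_compat; nra).
  set (d := fun v => exp (- (PI * v)) * (u * sin (PI * u) - v * cos (PI * u)) / (v ^ 2 + u ^ 2)).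
  assert (Hinv : forall v, 0 < v -> is_derive (fun v => / v ^ 2) v (- (2 / v ^ 3))).
  { intros v Hv. auto_derive; [nra | field; lra]. }
  assert (A1 : Jlog u a - / a ^ 2 <= Jlog u b - / b ^ 2).
  { apply (derive_nonneg_le (fun v => Jlog u v - / v ^ 2) (fun v => d v - (- (2 / v ^ 3)))); [assumption| |].
    - intros v Hv. apply (is_derive_minus (Jlog u) (fun v => / v ^ 2)); [apply Jlog_derive | apply Hinv]; lra.
    - intros v Hv. pose proof (Jlog_derive_bound u v ltac:(lra)) as B. apply Rabs_le_between in B.
      unfold d; lra. }
  assert (A2 : - Jlog u a - / a ^ 2 <= - Jlog u b - / b ^ 2).
  { apply (derive_nonneg_le (fun v => - Jlog u v - / v ^ 2) (fun v => - d v - (- (2 / v ^ 3)))); [assumption| |].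
    - intros v Hv. apply (is_derive_minus (fun v => - Jlog u v) (fun v => / v ^ 2)); [|apply Hinv; lra].
      apply (is_derive_opp (Jlog u)), Jlog_derive; lra.
    - intros v Hv. pose proof (Jlog_derive_bound u v ltac:(lra)) as B. apply Rabs_le_between in B.
      unfold d; lra. }
  apply Rabs_le; lra.
Qed.

Lemma inv_sq_small eps : 0 < eps -> exists N, forall n, (N <= n)%nat -> / INR (S n) ^ 2 < eps.
Proof.
  intros He. destruct (archimed_cor1 eps He) as [N [HN HN0]]. exists N; intros n Hn.
  assert (0 < INR N) by (apply lt_0_INR; lia).
  assert (INR N <= INR (S n)) by (apply le_INR; lia).
  assert (1 <= INR (S n)) by (change 1 with (INR 1); apply le_INR; lia).
  eapply Rle_lt_trans; [|apply HN]. apply Rinv_le_contravar; [assumption|]. nra.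
Qed.

Lemma Jlog_limit : exists c, forall a, 0 < a -> Rabs (Jlog 0 a - c) <= / a ^ 2.
Proof.
  assert (Hc : Cauchy_crit (fun n => Jlog 0 (INR (S n)))).
  { intros eps Heps. destruct (inv_sq_small eps Heps) as [N HN]. exists N.
    assert (Hle : forall n m, (N <= n)%nat -> (n <= m)%nat -> Rabs (Jlog 0 (INR (S n)) - Jlog 0 (INR (S m))) < eps).
    { intros n m Hn Hm. eapply Rle_lt_trans; [apply Jlog_gap | apply (HN n Hn)].
      split; [apply lt_0_INR; lia | apply le_INR; lia]. }
    intros n m Hn Hm. unfold Rdist. destruct (Nat.le_ge_cases n m).
    - apply Hle; lia.
    - rewrite Rabs_minus_sym. apply Hle; lia. }
  destruct (R_complete _ Hc) as [c Hcv]. exists c; intros a Ha.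
  apply le_epsilon; intros eps Heps. destruct (Hcv eps Heps) as [N HN].
  destruct (INR_unbounded a) as [m Hm].
  specialize (HN (Nat.max N m) ltac:(lia)). unfold Rdist in HN.
  assert (Hle : a <= INR (S (Nat.max N m))) by (apply Rlt_le, (Rlt_le_trans _ _ _ Hm), le_INR; lia).
  pose proof (Jlog_gap 0 a _ (conj Ha Hle)) as B.
  replace (Jlog 0 a - c) with ((Jlog 0 a - Jlog 0 (INR (S (Nat.max N m)))) + (Jlog 0 (INR (S (Nat.max N m))) - c)) by ring.
  eapply Rle_trans; [apply Rabs_triang|]. lra.
Qed.

Lemma J_gap u v : 0 < v -> Rabs (J v u - J v 0) <= u ^ 2 / v ^ 2.
Proof.
  intros Hv. unfold J.
  rewrite <- integ_minus by (apply logint_regular; lra).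
  apply Rle_trans with (2 * u ^ 2 * / (2 * v) ^ 2).
  2: { apply Rle_trans with (/ 2 * (u ^ 2 / v ^ 2)); [apply Req_le; field; lra|].
       assert (0 <= u ^ 2 / v ^ 2) by (apply Rdiv_le_0_compat; nra). lra. }
  assert (Hr : regular (fun t => t * exp (- (2 * v * t)))).
  { apply regular_mult; [apply regular_id|].
    apply regular_ext with (fun t => exp (- (2 * v) * t)); [intros; f_equal; ring | apply regular_exp]. }
  apply Rle_trans with (integ (fun t => 2 * u ^ 2 * (t * exp (- (2 * v * t))))).
  - apply integ_abs_le; [apply regular_minus; apply logint_regular; lra | apply regular_scal, Hr |].
    intros t Ht. unfold logint. rewrite Rmult_0_r, Rmult_0_l, cos_0.
    replace ((1 - exp (- (2 * v * t)) * cos (2 * u * t)) / t - (1 - exp (- (2 * v * t)) * 1) / t)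
      with (exp (- (2 * v * t)) * (1 - cos (2 * u * t)) * / t) by (field; lra).
    pose proof (exp_pos (- (2 * v * t))). pose proof (COS_bound (2 * u * t)).
    pose proof (cos_ge_quadratic (2 * u * t)).
    rewrite Rabs_right.
    + apply Rmult_le_reg_r with t; [lra|]. rewrite Rmult_assoc, Rinv_l, Rmult_1_r by lra.
      replace (2 * u ^ 2 * (t * exp (- (2 * v * t))) * t) with (exp (- (2 * v * t)) * ((2 * u * t) ^ 2 / 2)) by field.
      apply Rmult_le_compat_l; lra.
    + apply Rle_ge, Rmult_le_pos; [apply Rmult_le_pos; lra | apply Rlt_le, Rinv_0_lt_compat; lra].
  - rewrite integ_scal by exact Hr. apply Rmult_le_compat_l; [nra|]. apply integ_linear_exp_le; lra.
Qed.

Lemma ln_le_minus_1 x : 0 < x -> ln x <= x - 1.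
Proof. intros Hx. pose proof (exp_ineq1_le (ln x)) as A. rewrite exp_ln in A by assumption. lra. Qed.

Lemma Jlog_gap_angle u v : 0 < v -> Rabs (Jlog u v - Jlog 0 v) <= 2 * u ^ 2 / v ^ 2.
Proof.
  intros Hv. unfold Jlog. pose proof (J_gap u v Hv) as A.
  assert (Hv2 : 0 < v ^ 2) by nra. assert (Hu : 0 <= u ^ 2 / v ^ 2) by (apply Rdiv_le_0_compat; nra).
  assert (B : 0 <= ln (v ^ 2 + u ^ 2) - ln (v ^ 2 + 0 ^ 2) <= u ^ 2 / v ^ 2).
  { replace (v ^ 2 + 0 ^ 2) with (v ^ 2) by ring. rewrite <- ln_div by nra.
    replace ((v ^ 2 + u ^ 2) / v ^ 2) with (1 + u ^ 2 / v ^ 2) by (field; lra). split.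
    - rewrite <- ln_1. apply ln_le; lra.
    - pose proof (ln_le_minus_1 (1 + u ^ 2 / v ^ 2) ltac:(lra)). lra. }
  apply Rabs_le_between in A. apply Rabs_le.
  replace (2 * u ^ 2 / v ^ 2) with (2 * (u ^ 2 / v ^ 2)) by (field; lra). lra.
Qed.

(** The constant must not depend on [u]. From [(u, a)] the parameter [v] is raised to some [b] so
    large, in terms of [u], that the angle no longer matters; there the value is compared with the
    limit along [u = 0]. The cost of the rise is at most [/ a ^ 2], whatever [u] is. *)
Lemma Jlog_asymptotic : exists c, forall u a, 0 < a -> Rabs (Jlog u a - c) <= / a ^ 2.
Proof.
  destruct Jlog_limit as [c Hc]. exists c; intros u a Ha.
  apply le_epsilon; intros eps Heps.
  destruct (inv_sq_small (eps / (2 * u ^ 2 + 1))) as [N HN]; [apply Rdiv_lt_0_compat; nra|].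
  destruct (INR_unbounded a) as [m Hm].
  specialize (HN (Nat.max N m) ltac:(lia)). set (b := INR (S (Nat.max N m))) in *.
  assert (Hab : a <= b) by (apply Rlt_le, (Rlt_le_trans _ _ _ Hm), le_INR; lia).
  pose proof (Jlog_gap u a b (conj Ha Hab)) as B1. pose proof (Jlog_gap_angle u b ltac:(lra)) as B2.
  pose proof (Hc b ltac:(lra)) as B3.
  assert (Hb : 0 < / b ^ 2) by (apply Rinv_0_lt_compat; nra).
  assert (2 * u ^ 2 / b ^ 2 + / b ^ 2 <= eps).
  { replace (2 * u ^ 2 / b ^ 2 + / b ^ 2) with ((2 * u ^ 2 + 1) * / b ^ 2) by (field; lra).
    apply Rlt_le, Rmult_lt_reg_l with (/ (2 * u ^ 2 + 1)); [apply Rinv_0_lt_compat; nra|].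
    rewrite <- Rmult_assoc, Rinv_l by nra. unfold Rdiv in HN. lra. }
  apply Rabs_le_between in B1, B2, B3. apply Rabs_le; lra.
Qed.

(** The constant is [15 * 6 ^ 2], from [remainder_bound] and the rate [n / 6]. *)
Lemma remainder_integral n u : (0 < n)%nat ->
  Rabs (integ (fun t => remainder n t * cos (2 * u * t))) <= 540 / INR n ^ 2.
Proof.
  intros Hn. assert (Hn' : 0 < INR n) by (apply lt_0_INR; lia).
  assert (Hr : regular (fun t => t * exp (- (INR n / 6 * t)))).
  { apply regular_mult; [apply regular_id|].
    apply regular_ext with (fun t => exp (- (INR n / 6) * t)); [intros; f_equal; ring | apply regular_exp]. }
  apply Rle_trans with (integ (fun t => 15 * (t * exp (- (INR n / 6 * t))))).
  - apply integ_abs_le; [apply regular_mult; [apply remainder_regular | apply regular_cos] | apply regular_scal, Hr |].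
    intros t Ht. pose proof (remainder_bound t ltac:(lra) n). rewrite Rabs_mult.
    assert (Rabs (cos (2 * u * t)) <= 1) by (apply Rabs_le, COS_bound).
    pose proof (Rabs_pos (remainder n t)). pose proof (Rabs_pos (cos (2 * u * t))).
    unfold remainder in *. nra.
  - rewrite integ_scal by exact Hr.
    apply Rle_trans with (15 * / (INR n / 6) ^ 2); [|apply Req_le; field; lra].
    apply Rmult_le_compat_l; [lra|]. apply integ_linear_exp_le; lra.
Qed.

(** In this cone [z ^ 2] is comparable with the squared norm. The numerator is [1] from [Jlog] plus
    [540] from the remainder. *)
Lemma pot_asymptotic_cone : exists g, forall m z, (Z.abs m <= Z.abs z)%Z -> z <> 0%Z ->
  Rabs (pot (m, z) - 1 / PI * ln (IZR m ^ 2 + IZR z ^ 2) - g) <= 541 / IZR z ^ 2.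
Proof.
  destruct Jlog_asymptotic as [c Hc]. pose proof PI2_3_2 as Hpi.
  exists (2 / PI * (c + integ (remainder 0))). intros m z Hmz Hz.
  set (n := Z.abs_nat z). assert (Hn : (0 < n)%nat) by (unfold n; lia).
  assert (Hz2 : INR n ^ 2 = IZR z ^ 2).
  { unfold n. rewrite INR_IZR_INZ, Zabs2Nat.id_abs, abs_IZR. apply pow2_abs. }
  assert (Hn' : 0 < INR n) by (apply lt_0_INR; lia).
  rewrite pot_eq_ipot. unfold ipot; cbn [fst snd]. fold n.
  rewrite (integ_ext _ _ (kernel_decompose n m)).
  rewrite integ_plus by (apply logint_regular || apply kernel_tail_regular; lra).
  rewrite integ_minus by (apply remainder_regular || (apply regular_mult; [apply remainder_regular | apply regular_cos])).
  pose proof (remainder_integral n (IZR m) Hn) as A. pose proof (Hc (IZR m) (INR n) Hn') as B.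
  unfold Jlog, J in B. rewrite <- Hz2.
  replace (IZR m ^ 2 + INR n ^ 2) with (INR n ^ 2 + IZR m ^ 2) by ring.
  set (L := ln (INR n ^ 2 + IZR m ^ 2)) in *. set (X := integ (logint _ _)) in *.
  set (Y := integ (remainder 0)) in *. set (W := integ _) in A |- *.
  replace (2 / PI * (X + (Y - W)) - 1 / PI * L - 2 / PI * (c + Y))
    with (2 / PI * (X - / 2 * L - c - W)) by (field; lra).
  rewrite Rabs_mult. assert (H2 : 0 < 2 / PI < 1).
  { split; [apply Rdiv_lt_0_compat; lra|]. apply Rmult_lt_reg_r with PI; [lra|].
    unfold Rdiv; rewrite Rmult_assoc, Rinv_l; lra. }
  rewrite (Rabs_right (2 / PI)) by lra.
  assert (Rabs (X - / 2 * L - c - W) <= 541 / INR n ^ 2).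
  { replace (541 / INR n ^ 2) with (/ INR n ^ 2 + 540 / INR n ^ 2) by (field; lra).
    unfold Rminus at 1. eapply Rle_trans; [apply Rabs_triang|]. rewrite Rabs_Ropp. lra. }
  pose proof (Rabs_pos (X - / 2 * L - c - W)). nra.
Qed.

Lemma norm_sq x : norm x ^ 2 = IZR (fst x) ^ 2 + IZR (snd x) ^ 2.
Proof. unfold norm. rewrite pow2_sqrt; [reflexivity | nra]. Qed.

Lemma norm_pos x : x <> origin -> 1 <= norm x.
Proof.
  intros Hx. unfold norm. rewrite <- sqrt_1. apply sqrt_le_1_alt.
  destruct x as [m z]; cbn [fst snd].
  assert (m <> 0 \/ z <> 0)%Z.
  { destruct (Z.eq_dec m 0) as [->|]; [|tauto]. destruct (Z.eq_dec z 0) as [->|]; [|tauto].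
    exfalso; now apply Hx. }
  rewrite !pow_IZR, <- plus_IZR. apply IZR_le.
  change (Z.of_nat 2) with 2%Z. nia.
Qed.

(** The two cones around the axes are exchanged by [pot_swap]. Inside a cone the squared norm is at
    most twice the square of the larger coordinate, whence [1082 = 2 * 541]. *)
Lemma pot_asymptotic : exists g C, 0 < C /\ forall x, x <> origin ->
  Rabs (pot x - 2 / PI * ln (norm x) - g) <= C / norm x ^ 2.
Proof.
  destruct pot_asymptotic_cone as [g Hg]. exists g, 1082. split; [lra|].
  assert (Hln : forall x, x <> origin -> 2 / PI * ln (norm x) = 1 / PI * ln (norm x ^ 2)).
  { intros x Hx. pose proof (norm_pos x Hx). pose proof PI_RGT_0.
    rewrite ln_pow by lra. cbn [INR]. field; lra. }
  assert (H1 : forall m z, (Z.abs m <= Z.abs z)%Z -> z <> 0%Z ->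
     541 / IZR z ^ 2 <= 1082 / (IZR m ^ 2 + IZR z ^ 2)).
  { intros m z Hmz Hz. assert (IZR m ^ 2 <= IZR z ^ 2).
    { rewrite <- (pow2_abs (IZR m)), <- (pow2_abs (IZR z)), <- !abs_IZR.
      apply pow_incr; split; apply IZR_le; lia. }
    assert (IZR z <> 0) by (now apply not_0_IZR). assert (0 < IZR z ^ 2) by (apply pow2_gt_0; assumption).
    pose proof (pow2_ge_0 (IZR m)).
    replace (541 / IZR z ^ 2) with (1082 / (IZR z ^ 2 + IZR z ^ 2)) by (field; nra).
    apply Rmult_le_compat_l; [lra|]. apply Rinv_le_contravar; lra. }
  intros [m z] Hx. rewrite Hln, norm_sq by assumption. cbn [fst snd].
  destruct (Z_le_dec (Z.abs m) (Z.abs z)) as [Hmz|Hmz].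
  - assert (z <> 0%Z) by (intros ->; apply Hx; unfold origin; f_equal; lia).
    eapply Rle_trans; [apply Hg | apply H1]; assumption.
  - rewrite pot_swap, (Rplus_comm (IZR m ^ 2)).
    eapply Rle_trans; [apply Hg | apply H1]; lia.
Qed.

(** ** Behaviour at infinity *)

Lemma norm_nonneg x : 0 <= norm x.
Proof. apply sqrt_pos. Qed.

Lemma norm_triang x y : norm (padd x y) <= norm x + norm y.
Proof.
  pose proof (norm_nonneg x); pose proof (norm_nonneg y).
  apply Rsqr_incr_0_var; [|lra]. unfold Rsqr.
  pose proof (norm_sq (padd x y)) as E. pose proof (norm_sq x) as Ex. pose proof (norm_sq y) as Ey.
  unfold padd in E at 2 3; cbn [fst snd] in E; rewrite !plus_IZR in E.
  set (a := IZR (fst x)) in *; set (b := IZR (snd x)) in *; set (c := IZR (fst y)) in *; set (d := IZR (snd y)) in *.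
  assert (a * c + b * d <= norm x * norm y); [|nra].
  apply Rsqr_incr_0_var; [|nra]. unfold Rsqr.
  replace (norm x * norm y * (norm x * norm y)) with (norm x ^ 2 * norm y ^ 2) by ring.
  rewrite Ex, Ey. pose proof (pow2_ge_0 (a * d - b * c)). nra.
Qed.

Lemma norm_popp x : norm (popp x) = norm x.
Proof.
  unfold norm, popp, psub, origin; cbn [fst snd]. rewrite !minus_IZR. f_equal; ring.
Qed.

Lemma norm_origin : norm origin = 0.
Proof. unfold norm, origin; cbn [fst snd]. replace (0 ^ 2 + 0 ^ 2) with 0 by ring. apply sqrt_0. Qed.

Lemma norm_psub_le x z : norm (psub x z) <= norm x + norm z.
Proof. rewrite psub_padd, <- (norm_popp z). apply norm_triang. Qed.

Lemma psub_padd_cancel x z : padd (psub x z) z = x.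
Proof. destruct x, z; unfold padd, psub; cbn; f_equal; lia. Qed.

Lemma norm_psub_ge x z : norm x - norm z <= norm (psub x z).
Proof. pose proof (norm_triang (psub x z) z) as H. rewrite psub_padd_cancel in H. lra. Qed.

Lemma norm_gt_nonorigin x : 0 < norm x -> x <> origin.
Proof. intros H ->. rewrite norm_origin in H; lra. Qed.

Lemma pot_log : exists C, 0 < C /\ forall x, x <> origin -> Rabs (pot x - 2 / PI * ln (norm x)) <= C.
Proof.
  destruct pot_asymptotic as [g [C [HC H]]]. exists (C + Rabs g).
  pose proof (Rabs_pos g). split; [lra|]. intros x Hx.
  specialize (H x Hx). pose proof (norm_pos x Hx).
  assert (C / norm x ^ 2 <= C).
  { assert (1 <= norm x ^ 2) by nra. apply Rmult_le_reg_r with (norm x ^ 2); [lra|].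
    unfold Rdiv. rewrite Rmult_assoc, Rinv_l; nra. }
  replace (pot x - 2 / PI * ln (norm x)) with ((pot x - 2 / PI * ln (norm x) - g) + g) by ring.
  eapply Rle_trans; [apply Rabs_triang|]. lra.
Qed.

Lemma ln_gap a b m : 0 < m -> m <= a -> m <= b -> Rabs (ln a - ln b) <= Rabs (a - b) / m.
Proof.
  assert (H : forall a b m, 0 < m -> m <= a -> a <= b -> 0 <= ln b - ln a <= (b - a) / m).
  { clear; intros a b m Hm Ha Hab. split; [pose proof (ln_le a b ltac:(lra) Hab); lra|].
    rewrite <- ln_div by lra. eapply Rle_trans; [apply ln_le_minus_1, Rdiv_lt_0_compat; lra|].
    replace (b / a - 1) with ((b - a) / a) by (field; lra).
    apply Rmult_le_compat_l; [lra|]. apply Rinv_le_contravar; lra. }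
  intros Hm Ha Hb. destruct (Rle_or_lt a b) as [Hab|Hab].
  - pose proof (H a b m Hm Ha Hab). rewrite (Rabs_minus_sym (ln a)), (Rabs_minus_sym a).
    rewrite !Rabs_right; lra.
  - pose proof (H b a m Hm Hb ltac:(lra)). rewrite !Rabs_right; lra.
Qed.

(** The source of the errors [r / norm x] when a distant point is added to a set. *)
Lemma pot_shift : exists C, 0 < C /\ forall x z r, 1 <= r -> norm z <= r -> 2 * r <= norm x ->
  Rabs (pot (psub x z) - pot x) <= C * (r / norm x).
Proof.
  (* The asymptotic errors at [x] and at [psub x z] give [C] and [4 * C], the latter because the
     norm may be halved; the logarithms differ by at most [2 * (r / norm x)]. *)
  destruct pot_asymptotic as [g [C [HC H]]]. exists (5 * C + 2). split; [lra|].
  intros x z r Hr Hz Hx. pose proof (norm_psub_ge x z). pose proof (norm_psub_le x z).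
  set (N := norm x) in *. assert (HN : 0 < N) by lra.
  assert (A1 := H x (norm_gt_nonorigin x ltac:(fold N; lra))). fold N in A1.
  assert (A2 := H (psub x z) (norm_gt_nonorigin (psub x z) ltac:(lra))).
  set (M := norm (psub x z)) in *.
  assert (B : Rabs (ln M - ln N) <= r / (N / 2)).
  { eapply Rle_trans; [apply (ln_gap M N (N / 2)); lra|].
    apply Rmult_le_compat_r; [apply Rlt_le, Rinv_0_lt_compat; lra|]. apply Rabs_le; lra. }
  assert (Hpi : 0 < 2 / PI < 1).
  { pose proof PI2_3_2. split; [apply Rdiv_lt_0_compat; lra|]. apply Rmult_lt_reg_r with PI; [lra|].
    unfold Rdiv; rewrite Rmult_assoc, Rinv_l; lra. }
  assert (E1 : C / N ^ 2 <= C * (r / N)).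
  { replace (C / N ^ 2) with (C * (/ N * / N)) by (field; lra).
    apply Rmult_le_compat_l; [lra|]. apply Rmult_le_compat_r; [apply Rlt_le, Rinv_0_lt_compat; lra|].
    apply Rle_trans with 1; [|lra]. rewrite <- Rinv_1. apply Rinv_le_contravar; lra. }
  assert (E2 : C / M ^ 2 <= 4 * (C * (r / N))).
  { apply Rle_trans with (4 * (C / N ^ 2)); [|lra].
    replace (4 * (C / N ^ 2)) with (C * / (N / 2) ^ 2) by (field; lra).
    apply Rmult_le_compat_l; [lra|]. apply Rinv_le_contravar; [nra|]. apply pow_incr; lra. }
  replace (r / (N / 2)) with (2 * (r / N)) in B by (field; lra).
  replace (pot (psub x z) - pot x) with
    ((pot (psub x z) - 2 / PI * ln M - g) - (pot x - 2 / PI * ln N - g) + 2 / PI * (ln M - ln N)) by ring.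
  assert (Rabs (2 / PI * (ln M - ln N)) <= 2 * (r / N)).
  { rewrite Rabs_mult, (Rabs_right (2 / PI)) by lra. pose proof (Rabs_pos (ln M - ln N)). nra. }
  eapply Rle_trans; [apply Rabs_triang|].
  unfold Rminus at 1. eapply Rle_trans; [apply Rplus_le_compat_r, Rabs_triang|]. rewrite Rabs_Ropp. lra.
Qed.

(** The predicate under the choice operator of [LimInf], stated separately so that the choice
    specification applies to it. *)
Definition tends_inf (f : pt -> R) (L : R) : Prop :=
  forall eps, 0 < eps -> exists R0, forall y, R0 <= norm y -> Rabs (f y - L) < eps.

Lemma far_point r : exists y, r <= norm y.
Proof.
  destruct (INR_unbounded r) as [n Hn]. exists (Z.of_nat n, 0%Z).
  unfold norm; cbn [fst snd]. rewrite <- INR_IZR_INZ.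
  replace (INR n ^ 2 + 0 ^ 2) with (INR n ^ 2) by ring. rewrite sqrt_pow2 by apply pos_INR. lra.
Qed.

Lemma tends_inf_unique f L L' : tends_inf f L -> tends_inf f L' -> L = L'.
Proof.
  intros H H'. apply NNPP; intros Hn.
  assert (He : 0 < Rabs (L - L') / 2) by (pose proof (Rabs_pos_lt (L - L')); lra).
  destruct (H _ He) as [R0 HR]. destruct (H' _ He) as [R1 HR'].
  destruct (far_point (Rmax R0 R1)) as [y Hy].
  pose proof (Rmax_l R0 R1). pose proof (Rmax_r R0 R1).
  specialize (HR y ltac:(lra)). specialize (HR' y ltac:(lra)).
  rewrite Rabs_minus_sym in HR. pose proof (Rabs_triang (L - f y) (f y - L')) as T.
  replace (L - f y + (f y - L')) with (L - L') in T by ring. lra.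
Qed.

Lemma LimInf_spec f L : tends_inf f L -> LimInf f = L.
Proof.
  intros H. apply (tends_inf_unique f); [|assumption].
  unfold LimInf. apply (epsilon_spec (inhabits 0) (tends_inf f)). now exists L.
Qed.

Lemma tends_inf_ext_far f g L r : (forall y, r <= norm y -> f y = g y) -> tends_inf f L -> tends_inf g L.
Proof.
  intros E H eps Heps. destruct (H eps Heps) as [R0 HR]. exists (Rmax r R0); intros y Hy.
  pose proof (Rmax_l r R0). pose proof (Rmax_r r R0). rewrite <- E by lra. apply HR; lra.
Qed.

Lemma tends_inf_const c : tends_inf (fun _ => c) c.
Proof. intros eps Heps; exists 0; intros; now rewrite Rminus_diag, Rabs_R0. Qed.

Lemma tends_inf_plus f g L M : tends_inf f L -> tends_inf g M -> tends_inf (fun y => f y + g y) (L + M).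
Proof.
  intros Hf Hg eps Heps. destruct (Hf (eps / 2)) as [R0 H0]; [lra|]. destruct (Hg (eps / 2)) as [R1 H1]; [lra|].
  exists (Rmax R0 R1); intros y Hy. pose proof (Rmax_l R0 R1). pose proof (Rmax_r R0 R1).
  specialize (H0 y ltac:(lra)). specialize (H1 y ltac:(lra)).
  replace (f y + g y - (L + M)) with ((f y - L) + (g y - M)) by ring.
  eapply Rle_lt_trans; [apply Rabs_triang|]. lra.
Qed.

Lemma tends_inf_scal c f L : tends_inf f L -> tends_inf (fun y => c * f y) (c * L).
Proof.
  intros Hf eps Heps. pose proof (Rabs_pos c).
  destruct (Hf (eps / (Rabs c + 1))) as [R0 H0]; [apply Rdiv_lt_0_compat; lra|].
  exists R0; intros y Hy. specialize (H0 y Hy).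
  rewrite <- Rmult_minus_distr_l, Rabs_mult.
  apply Rle_lt_trans with ((Rabs c + 1) * Rabs (f y - L)); [pose proof (Rabs_pos (f y - L)); nra|].
  apply Rmult_lt_compat_l with (r := Rabs c + 1) in H0; [|lra].
  replace ((Rabs c + 1) * (eps / (Rabs c + 1))) with eps in H0 by (field; lra). assumption.
Qed.

Lemma tends_inf_lsum {A} (f : A -> pt -> R) (L : A -> R) l :
  (forall a, In a l -> tends_inf (f a) (L a)) -> tends_inf (fun y => lsum (fun a => f a y) l) (lsum L l).
Proof.
  induction l as [|a l IH]; intros H; [exact (tends_inf_const 0)|].
  apply (tends_inf_plus (f a) (fun y => lsum (fun a => f a y) l)); [apply H; now left|].
  apply IH; intros; apply H; now right.
Qed.

Lemma pot_shift_tends z : tends_inf (fun y => pot (psub y z) - pot y) 0.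
Proof.
  destruct pot_shift as [C [HC H]]. intros eps Heps.
  set (r := Rmax 1 (norm z)). pose proof (Rmax_l 1 (norm z)). pose proof (Rmax_r 1 (norm z)). fold r in H0, H1.
  exists (2 * r + C * r / eps + 1). intros y Hy.
  assert (0 < C * r / eps) by (apply Rdiv_lt_0_compat; [nra | lra]).
  rewrite Rminus_0_r. eapply Rle_lt_trans; [apply (H y z r); lra|].
  assert (HN : C * r / eps < norm y) by lra.
  apply Rmult_lt_reg_r with (norm y / eps); [apply Rdiv_lt_0_compat; lra|].
  replace (C * (r / norm y) * (norm y / eps)) with (C * r / eps) by (field; lra).
  replace (eps * (norm y / eps)) with (norm y) by (field; lra). assumption.
Qed.

(** Seen from afar, a finite charge distribution acts as its total charge placed at the origin. *)
Lemma potential_tends (c : pt -> R) l :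
  tends_inf (fun y => lsum (fun z => c z * pot (psub y z)) l - lsum c l * pot y) 0.
Proof.
  assert (H : tends_inf (fun y => lsum (fun z => c z * (pot (psub y z) - pot y)) l) (lsum (fun z => c z * 0) l)).
  { apply tends_inf_lsum; intros; apply tends_inf_scal, pot_shift_tends. }
  rewrite (lsum_ext _ (fun _ => 0)), lsum_const, Rmult_0_r in H by (intros; ring).
  apply (tends_inf_ext_far _ _ _ 0) with (2 := H). intros y _.
  rewrite (lsum_ext _ (fun z => c z * pot (psub y z) + (- pot y) * c z)) by (intros; ring).
  rewrite lsum_plus, lsum_scal. ring.
Qed.

Lemma pot_unbounded M : exists r, forall x, r <= norm x -> M <= pot x.
Proof.
  destruct pot_log as [C [HC H]]. pose proof PI_RGT_0.
  exists (Rmax 1 (exp (PI / 2 * (M + C)))). intros x Hx.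
  pose proof (Rmax_l 1 (exp (PI / 2 * (M + C)))). pose proof (Rmax_r 1 (exp (PI / 2 * (M + C)))).
  specialize (H x (norm_gt_nonorigin x ltac:(lra))). apply Rabs_le_between in H.
  assert (L : PI / 2 * (M + C) <= ln (norm x)).
  { rewrite <- (ln_exp (PI / 2 * (M + C))). apply ln_le; [apply exp_pos | lra]. }
  apply Rmult_le_compat_l with (r := 2 / PI) in L; [|apply Rlt_le, Rdiv_lt_0_compat; lra].
  replace (2 / PI * (PI / 2 * (M + C))) with (M + C) in L by (field; lra). lra.
Qed.

(** ** Bounded functions harmonic off a finite set *)

Lemma lsum_abs_le {A} (f g : A -> R) l : (forall a, In a l -> Rabs (f a) <= g a) -> Rabs (lsum f l) <= lsum g l.
Proof.
  induction l as [|a l IH]; intros H; [unfold lsum; cbn; rewrite Rabs_R0; lra|].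
  change (Rabs (f a + lsum f l) <= g a + lsum g l). eapply Rle_trans; [apply Rabs_triang|].
  apply Rplus_le_compat; [apply H; now left | apply IH; intros; apply H; now right].
Qed.

Lemma potential_lap (c : pt -> R) l y : NoDup l ->
  lap (fun y => lsum (fun z => c z * pot (psub y z)) l) y = if in_dec pt_eq_dec y l then c y else 0.
Proof.
  intros Hl. unfold lap. rewrite (avg_lsum (fun z y => c z * pot (psub y z))).
  rewrite (lsum_ext _ (fun z => c z * pot (psub y z) + (if pt_eq_dec z y then c z else 0))).
  2: { intros z _. rewrite avg_scal, avg_shift_sub, pot_avg. unfold delta0.
       destruct (pt_eq_dec (psub y z) origin) as [E|E], (pt_eq_dec z y) as [E'|E']; try ring.
       - apply (proj1 (psub_eq_origin y z)) in E; congruence.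
       - exfalso; apply E, psub_eq_origin; congruence. }
  rewrite lsum_plus. destruct in_dec.
  - rewrite lsum_delta by assumption; ring.
  - rewrite lsum_delta_out by assumption; ring.
Qed.

Lemma lap_minus f g y : lap (fun y => f y - g y) y = lap f y - lap g y.
Proof. unfold lap. rewrite avg_minus; ring. Qed.

Fixpoint multiple (k : nat) (e : pt) : pt :=
  match k with O => origin | S k => padd (multiple k e) e end.

Lemma multiple_popp k e : multiple k (popp e) = popp (multiple k e).
Proof.
  induction k as [|k IH]; [reflexivity|]. cbn [multiple]. rewrite IH.
  unfold popp, padd, psub, origin; cbn; f_equal; lia.
Qed.

(* Since [pot] is even, [pot (k e - z) - pot (- k e - z)] stays bounded as [k] grows, which rules out a linear term. *)
Lemma bounded_representation f B l : NoDup l -> (forall x, Rabs (f x) <= B) ->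
  (forall x, ~ In x l -> lap f x = 0) ->
  lsum (lap f) l = 0 /\ exists k, tends_inf f k /\
    forall y, f y = k + lsum (fun z => lap f z * pot (psub y z)) l.
Proof.
  intros Hl HB Hf. set (P := fun y => lsum (fun z => lap f z * pot (psub y z)) l).
  set (v := fun y => f y - P y).
  assert (Hv : forall x, avg v x = v x).
  { intros x. enough (lap v x = 0) by (unfold lap in *; lra).
    unfold v; rewrite lap_minus. unfold P. rewrite potential_lap by assumption.
    destruct in_dec; [ring | rewrite Hf by assumption; ring]. }
  assert (HP : forall x e, In e dirs -> Rabs (P (padd x e) - P x) <= lsum (fun z => Rabs (lap f z)) l).
  { intros x e He. unfold P.
    replace (lsum (fun z => lap f z * pot (psub (padd x e) z)) l - lsum (fun z => lap f z * pot (psub x z)) l)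
      with (lsum (fun z => lap f z * (pot (padd (psub x z) e) - pot (psub x z))) l).
    2: { rewrite (lsum_ext _ (fun z => lap f z * pot (psub (padd x e) z) + (-1) * (lap f z * pot (psub x z)))).
         - rewrite lsum_plus, lsum_scal; ring.
         - intros z _. replace (padd (psub x z) e) with (psub (padd x e) z); [ring|].
           unfold padd, psub; cbn; f_equal; lia. }
    apply lsum_abs_le. intros z _. rewrite Rabs_mult. pose proof (pot_step (psub x z) e He).
    pose proof (Rabs_pos (lap f z)). nra. }
  assert (Hinc := harmonic_lipschitz_increment v (2 * B + lsum (fun z => Rabs (lap f z)) l) Hv).
  assert (Hinc' : forall x e, In e dirs -> v (padd x e) - v x = v (padd origin e) - v origin).
  { apply Hinc. intros x e He. pose proof (HP x e He) as A. pose proof (HB x) as B1. pose proof (HB (padd x e)) as B2.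
    unfold v. apply Rabs_le_between in A, B1, B2. apply Rabs_le; lra. }
  assert (Hlin : forall e, In e dirs -> forall k, v (multiple k e) = v origin + INR k * (v (padd origin e) - v origin)).
  { intros e He. induction k as [|k IH]; [cbn; ring|]. rewrite S_INR. cbn [multiple].
    pose proof (Hinc' (multiple k e) e He). lra. }
  assert (Hc : forall e, In e dirs -> v (padd origin e) - v origin <= 0).
  { intros e He. apply Rnot_lt_le; intros Hpos.
    (* [M] bounds [P y - P (popp y)] for every [y]: by evenness of [pot] the two arguments [y - z]
       and [y + z] differ by the fixed shift [2 z]. *)
    set (M := lsum (fun z => Rabs (lap f z) * (2 * pot (padd z z) + 2 * pot (popp (padd z z)))) l).
    destruct (INR_unbounded ((2 * B + M) / (v (padd origin e) - v origin))) as [k Hk].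
    apply Rmult_lt_compat_r with (r := v (padd origin e) - v origin) in Hk; [|assumption].
    replace ((2 * B + M) / (v (padd origin e) - v origin) * (v (padd origin e) - v origin)) with (2 * B + M) in Hk by (field; lra).
    pose proof (Hlin e He k) as L1. pose proof (Hlin (popp e) (dirs_opp e He) k) as L2.
    assert (L3 : v (padd origin (popp e)) - v origin = - (v (padd origin e) - v origin)).
    { pose proof (Hinc' (padd origin (popp e)) e He) as A.
      replace (padd (padd origin (popp e)) e) with origin in A; [lra|].
      destruct e; unfold padd, popp, psub, origin; cbn; f_equal; lia. }
    rewrite L3, multiple_popp in L2. set (y := multiple k e) in *.
    assert (HM : Rabs (P y - P (popp y)) <= M).
    { unfold P.
      replace (lsum (fun z => lap f z * pot (psub y z)) l - lsum (fun z => lap f z * pot (psub (popp y) z)) l)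
        with (lsum (fun z => lap f z * (pot (psub y z) - pot (padd y z))) l).
      2: { rewrite (lsum_ext _ (fun z => lap f z * pot (psub y z) + (-1) * (lap f z * pot (psub (popp y) z)))).
           - rewrite lsum_plus, lsum_scal; ring.
           - intros z _. replace (psub (popp y) z) with (popp (padd y z)); [rewrite pot_opp; ring|].
             unfold padd, psub, popp, psub, origin; cbn; f_equal; lia. }
      apply lsum_abs_le. intros z _. rewrite Rabs_mult. apply Rmult_le_compat_l; [apply Rabs_pos|].
      pose proof (pot_increment (padd z z) (padd y z)) as A.
      pose proof (pot_increment (popp (padd z z)) (psub y z)) as A'.
      replace (psub (padd y z) (padd z z)) with (psub y z) in A by (unfold padd, psub; cbn; f_equal; lia).
      replace (psub (psub y z) (popp (padd z z))) with (padd y z) in A' by (unfold padd, psub, popp, psub, origin; cbn; f_equal; lia).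
      pose proof (pot_nonneg (padd z z)). pose proof (pot_nonneg (popp (padd z z))).
      apply Rabs_le; lra. }
    pose proof (HB y) as B1. pose proof (HB (popp y)) as B2.
    apply Rabs_le_between in HM, B1, B2.
    assert (Ey : v y = f y - P y) by reflexivity.
    assert (Ey' : v (popp y) = f (popp y) - P (popp y)) by reflexivity.
    assert (0 <= INR k * (v (padd origin e) - v origin)) by (apply Rmult_le_pos; [apply pos_INR | lra]).
    lra. }
  assert (Hconst : forall y, v y = v origin).
  { apply step_invariant_const. intros x e He.
    pose proof (Hc e He) as A. pose proof (Hc (popp e) (dirs_opp e He)) as A'.
    pose proof (Hinc' x e He) as I1. pose proof (Hinc' (padd x e) (popp e) (dirs_opp e He)) as I2.
    rewrite padd_popp_r in I2. lra. }
  assert (Hrep : forall y, f y = v origin + P y).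
  { intros y. rewrite <- (Hconst y). unfold v; ring. }
  (* With total charge [s] nonzero, [P] would follow [s * pot] to infinity, whereas [f] is
     bounded. *)
  assert (Hsum : lsum (lap f) l = 0).
  { apply NNPP; intros Hn. set (s := lsum (lap f) l) in *.
    destruct (potential_tends (lap f) l 1 ltac:(lra)) as [R0 HR].
    destruct (pot_unbounded ((B + Rabs (v origin) + 1) / Rabs s)) as [R1 HR1].
    destruct (far_point (Rmax R0 R1)) as [y Hy]. pose proof (Rmax_l R0 R1). pose proof (Rmax_r R0 R1).
    specialize (HR y ltac:(lra)). specialize (HR1 y ltac:(lra)). fold (P y) s in HR.
    pose proof (Rabs_pos_lt s Hn).
    apply Rmult_le_compat_l with (r := Rabs s) in HR1; [|lra].
    replace (Rabs s * ((B + Rabs (v origin) + 1) / Rabs s)) with (B + Rabs (v origin) + 1) in HR1 by (field; lra).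
    pose proof (pot_nonneg y). rewrite <- (Rabs_right (pot y)), <- Rabs_mult in HR1 by lra.
    pose proof (HB y) as B1. rewrite (Hrep y) in B1.
    rewrite Rminus_0_r in HR.
    pose proof (Rabs_triang (v origin + P y) (- v origin)) as T1.
    pose proof (Rabs_triang (P y) (- (P y - s * pot y))) as T2.
    rewrite Rabs_Ropp in T1, T2.
    replace (v origin + P y + - v origin) with (P y) in T1 by ring.
    replace (P y + - (P y - s * pot y)) with (s * pot y) in T2 by ring. lra. }
  split; [assumption|]. exists (v origin). split; [|exact Hrep].
  apply (tends_inf_ext_far (fun y => v origin + (P y - lsum (lap f) l * pot y)) _ _ 0).
  - intros y _. rewrite Hsum, (Hrep y). ring.
  - rewrite <- (Rplus_0_r (v origin)) at 1.
    apply (tends_inf_plus (fun _ => v origin)); [apply tends_inf_const|]. apply potential_tends.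
Qed.

(** ** Equilibrium measures *)

Definition potential (S : list pt) (g : pt -> R) (y : pt) : R :=
  lsum (fun z => g z * pot (psub y z)) S.

Definition equilibrium (S : list pt) (g : pt -> R) (c : R) : Prop :=
  NoDup S /\ lsum g S = 1 /\ (forall z, In z S -> 0 <= g z) /\
  forall y, In y S -> potential S g y = c.

Lemma lsum_perm {A} (f : A -> R) l l' : Permutation l l' -> lsum f l = lsum f l'.
Proof.
  induction 1; unfold lsum in *; cbn [fold_right] in *; try lra.
Qed.

Lemma lsum_swap {A B} (f : A -> B -> R) l l' :
  lsum (fun a => lsum (f a) l') l = lsum (fun b => lsum (fun a => f a b) l) l'.
Proof.
  induction l as [|a l IH].
  - transitivity (lsum (fun _ : B => 0) l'); [rewrite lsum_const, Rmult_0_r|]; reflexivity.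
  - change (lsum (f a) l' + lsum (fun a => lsum (f a) l') l
            = lsum (fun b => f a b + lsum (fun a => f a b) l) l').
    now rewrite lsum_plus, IH.
Qed.

Lemma lsum_mult_r {A} c (f : A -> R) l : lsum (fun a => f a * c) l = lsum f l * c.
Proof. rewrite (lsum_ext _ (fun a => c * f a)) by (intros; ring). rewrite lsum_scal; ring. Qed.

Lemma potential_pairing S g S' g' :
  lsum (fun y => g y * potential S' g' y) S = lsum (fun z => g' z * potential S g z) S'.
Proof.
  unfold potential.
  rewrite (lsum_ext _ (fun y => lsum (fun z => g y * (g' z * pot (psub y z))) S'))
    by (intros; now rewrite lsum_scal).
  rewrite lsum_swap. apply lsum_ext; intros z _. rewrite <- lsum_scal.
  apply lsum_ext; intros y _. rewrite (pot_psub_sym y z); ring.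
Qed.

Lemma equilibrium_pair S g c (f : pt -> R) k : equilibrium S g c -> (forall y, In y S -> f y = k) ->
  lsum (fun y => g y * f y) S = k.
Proof.
  intros [_ [H2 _]] Hf. rewrite (lsum_ext _ (fun y => g y * k)).
  - rewrite lsum_mult_r, H2; ring.
  - intros y Hy; now rewrite Hf.
Qed.

(** The double sum of the two measures equals [c'] when read as an integral over [S], and is at
    least [c] when read as an integral over [S']. The second reading needs the lower bound on the
    potential outside [S] as well. *)
Lemma equilibrium_mono S g c S' g' c' : equilibrium S g c -> equilibrium S' g' c' ->
  incl S S' -> (forall y, c <= potential S g y) -> c <= c'.
Proof.
  intros E E' Hi Hc.
  rewrite <- (equilibrium_pair S g c (potential S' g') c' E).
  2: { intros y Hy. apply E', Hi, Hy. }
  rewrite potential_pairing. destruct E' as [_ [H2 [H3 _]]].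
  apply Rle_trans with (lsum (fun z => g' z * c) S'); [rewrite lsum_mult_r, H2; lra|].
  apply lsum_le. intros z Hz. apply Rmult_le_compat_l; auto.
Qed.

Lemma equilibrium_unique S g c g' c' : equilibrium S g c -> equilibrium S g' c' -> c = c'.
Proof.
  intros E E'. rewrite <- (equilibrium_pair S g' c' _ c E' (proj2 (proj2 (proj2 E)))).
  rewrite potential_pairing. apply (equilibrium_pair S g c); [assumption|]. apply E'.
Qed.

Lemma equilibrium_pullback (phi : pt -> pt) S g c :
  (forall u v, pot (psub (phi u) (phi v)) = pot (psub u v)) ->
  equilibrium (map phi S) g c -> equilibrium S (fun z => g (phi z)) c.
Proof.
  intros Hphi [H1 [H2 [H3 H4]]]. repeat split.
  - now apply NoDup_map_inv in H1.
  - now rewrite <- (lsum_map phi g).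
  - intros z Hz; apply H3, in_map, Hz.
  - intros y Hy. rewrite <- (H4 (phi y)) by (now apply in_map).
    unfold potential. rewrite lsum_map. apply lsum_ext; intros; now rewrite Hphi.
Qed.

Lemma memb_spec z A : memb z A = true <-> In z A.
Proof.
  unfold memb. rewrite existsb_exists. split.
  - intros [w [Hw E]]. destruct pt_eq_dec as [->|]; [assumption | discriminate].
  - intros H; exists z; split; [assumption|]. destruct pt_eq_dec; [reflexivity | contradiction].
Qed.

Lemma memb_false z A : memb z A = false <-> ~ In z A.
Proof. rewrite <- memb_spec. destruct (memb z A); split; intuition congruence. Qed.

(** * The conditioned walk as a Doob transform *)

Section ConditionedWalk.
Variable A : list pt.

(** Multiplying by [pot] cancels the denominators of the transition probabilities, so one step
    becomes a plain average. [hit_weight0] also counts a visit at time [0], which is what the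
    recursion tests at the neighbours. *)
Definition hit_weight (n : nat) (y : pt) : R := pot y * ret_hat n A y.
Definition hit_weight0 (n : nat) (y : pt) : R := if memb y A then pot y else hit_weight n y.

Lemma hit_weight_origin n : hit_weight n origin = 0.
Proof. unfold hit_weight; rewrite pot_origin; ring. Qed.

Lemma hit_weight_S n y : y <> origin -> hit_weight (S n) y = avg (hit_weight0 n) y.
Proof.
  intros Hy. pose proof (pot_ge_1 y Hy).
  unfold hit_weight; cbn [ret_hat]. rewrite <- lsum_scal. unfold avg.
  apply lsum_ext; intros e _. unfold hit_weight0, hit_weight.
  destruct memb; field; lra.
Qed.

Lemma hit_weight_bounds n y : 0 <= hit_weight n y <= pot y /\ hit_weight n y <= hit_weight (S n) y.
Proof.
  assert (B : forall n y, 0 <= hit_weight n y <= pot y).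
  { clear n y; induction n as [|n IH]; intros y.
    - unfold hit_weight; cbn [ret_hat]. pose proof (pot_nonneg y). lra.
    - destruct (pt_eq_dec y origin) as [->|Hy]; [rewrite hit_weight_origin, pot_origin; lra|].
      rewrite hit_weight_S by assumption.
      assert (B : forall z, 0 <= hit_weight0 n z <= pot z).
      { intros z; unfold hit_weight0. pose proof (pot_nonneg z). destruct memb; [lra | apply IH]. }
      split; [rewrite <- (avg_const 0 y) at 1; apply avg_le; intros; apply B|].
      replace (pot y) with (avg pot y); [apply avg_le; intros; apply B|].
      rewrite pot_avg. unfold delta0; destruct pt_eq_dec; [contradiction | ring]. }
  split; [apply B|]. revert y; induction n as [|n IH]; intros y.
  - replace (hit_weight 0 y) with 0 by (unfold hit_weight; cbn [ret_hat]; ring). apply B.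
  - destruct (pt_eq_dec y origin) as [->|Hy]; [rewrite !hit_weight_origin; lra|].
    rewrite !hit_weight_S by assumption. apply avg_le; intros e _.
    unfold hit_weight0; destruct memb; [lra | apply IH].
Qed.

(* The function [K / pot] is superharmonic for the conditioned walk, hence bounds the hitting probability. *)
Lemma hit_weight_bounded : exists K, forall n y, hit_weight0 n y <= K.
Proof.
  assert (HK : exists K, 0 <= K /\ forall z, In z A -> pot z <= K).
  { induction A as [|a l [K [HK0 HK]]]; [exists 0; split; [lra | intros z []]|].
    exists (Rmax K (pot a)). pose proof (Rmax_l K (pot a)). pose proof (Rmax_r K (pot a)).
    split; [lra|]. intros z [<-|Hz]; [assumption | specialize (HK z Hz); lra]. }
  destruct HK as [K [HK0 HK]]. exists K.
  enough (B : forall n y, hit_weight n y <= K).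
  { intros n y; unfold hit_weight0. destruct (memb y A) eqn:E; [apply HK, memb_spec, E | apply B]. }
  induction n as [|n IH]; intros y; [unfold hit_weight; cbn [ret_hat]; lra|].
  destruct (pt_eq_dec y origin) as [->|Hy]; [rewrite hit_weight_origin; assumption|].
  rewrite hit_weight_S by assumption.
  apply Rle_trans with (avg (fun _ => K) y); [|rewrite avg_const; lra].
  apply avg_le; intros e _. unfold hit_weight0.
  destruct memb eqn:E; [apply HK, memb_spec, E | apply IH].
Qed.

Lemma hit_weight_cv y : Un_cv (fun n => hit_weight n y) (pot y * Lim (fun n => ret_hat n A y)).
Proof.
  destruct (pt_eq_dec y origin) as [->|Hy].
  - rewrite pot_origin, Rmult_0_l.
    apply Un_cv_ext with (fun _ => 0); [intros; now rewrite hit_weight_origin | apply un_cv_const].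
  - pose proof (pot_ge_1 y Hy) as H1.
    destruct (growing_cv (fun n => hit_weight n y)) as [l Hl].
    { intros n; apply hit_weight_bounds. }
    { exists (pot y); intros _ [n ->]; apply hit_weight_bounds. }
    rewrite (Lim_spec _ (/ pot y * l)).
    + replace (pot y * (/ pot y * l)) with l by (field; lra). exact Hl.
    + apply Un_cv_ext with (fun n => / pot y * hit_weight n y).
      * intros n; unfold hit_weight; field; lra.
      * apply (CV_mult (fun _ => / pot y)); [apply un_cv_const | exact Hl].
Qed.

Definition hit_limit (y : pt) : R := if memb y A then pot y else pot y * Lim (fun n => ret_hat n A y).
(** The function a(y) times the probability of never visiting [A], time [0] included. It vanishes on
    [A] and at the origin and is harmonic elsewhere. *)
Definition escape_weight (y : pt) : R := pot y - hit_limit y.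

Lemma hit_weight0_cv y : Un_cv (fun n => hit_weight0 n y) (hit_limit y).
Proof.
  unfold hit_weight0, hit_limit. destruct memb; [apply un_cv_const | apply hit_weight_cv].
Qed.

Lemma hit_limit_avg y : y <> origin -> pot y * Lim (fun n => ret_hat n A y) = avg hit_limit y.
Proof.
  intros Hy. apply (UL_sequence (fun n => hit_weight (S n) y)).
  - apply (un_cv_S (fun n => hit_weight n y)), hit_weight_cv.
  - apply Un_cv_ext with (fun n => avg (hit_weight0 n) y); [intros; now rewrite hit_weight_S|].
    apply un_cv_avg; intros; apply hit_weight0_cv.
Qed.

Lemma hit_limit_bounds : exists K, forall y, 0 <= hit_limit y <= Rmin K (pot y).
Proof.
  destruct hit_weight_bounded as [K HK]. exists K; intros y. split.
  - apply (un_cv_le (fun _ => 0) (fun n => hit_weight0 n y)); [apply un_cv_const | apply hit_weight0_cv|].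
    intros n; unfold hit_weight0. destruct memb; [apply pot_nonneg | apply hit_weight_bounds].
  - apply (un_cv_le (fun n => hit_weight0 n y) (fun _ => Rmin K (pot y))); [apply hit_weight0_cv | apply un_cv_const|].
    intros n. apply Rmin_glb; [apply HK|]. unfold hit_weight0.
    destruct memb; [lra | apply hit_weight_bounds].
Qed.

Lemma escape_weight_nonneg y : 0 <= escape_weight y.
Proof.
  destruct hit_limit_bounds as [K HK]. specialize (HK y). pose proof (Rmin_r K (pot y)).
  unfold escape_weight; lra.
Qed.

Lemma escape_weight_zero y : In y (origin :: A) -> escape_weight y = 0.
Proof.
  unfold escape_weight, hit_limit. intros [<-|H].
  - rewrite pot_origin. destruct memb; ring.
  - apply memb_spec in H; rewrite H; ring.
Qed.

Lemma escape_weight_lap y : ~ In y (origin :: A) -> lap escape_weight y = 0.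
Proof.
  intros Hy. assert (Ho : y <> origin) by (intros ->; apply Hy; now left).
  unfold escape_weight. rewrite lap_minus. unfold lap. rewrite pot_avg, <- hit_limit_avg by assumption.
  unfold hit_limit, delta0. destruct pt_eq_dec; [contradiction|].
  rewrite (proj2 (memb_false y A)); [ring|]. intros H; apply Hy; now right.
Qed.

(** On [A] the escape weight is zero, so its Laplacian is the average over the neighbours, namely
    [pot y] times the probability of no return. One of the two factors [pot y] of [ehat] is thereby
    absorbed. *)
Lemma ehat_escape_weight y : In y A -> ehat A y = pot y * lap escape_weight y.
Proof.
  intros Hy. unfold ehat. rewrite (proj2 (memb_spec y A) Hy).
  destruct (pt_eq_dec y origin) as [->|Ho]; [rewrite pot_origin; ring|].
  unfold lap. rewrite (escape_weight_zero y) by (now right).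
  unfold escape_weight. rewrite avg_minus, pot_avg, <- hit_limit_avg by assumption.
  unfold delta0, escape_hat; destruct pt_eq_dec; [contradiction | ring].
Qed.

Lemma dedup_spec (l : list pt) : NoDup (dedup l) /\ forall z, In z (dedup l) <-> In z l.
Proof. split; [apply NoDup_nodup | intros z; apply nodup_In]. Qed.

(** The origin enters the set at no cost, because [pot] vanishes there. *)
Lemma caphat_lsum : caphat A = lsum (fun z => lap escape_weight z * pot z) (dedup (origin :: A)).
Proof.
  unfold caphat. transitivity (lsum (fun z => lap escape_weight z * pot z) (dedup A)).
  - apply lsum_ext; intros z Hz. rewrite ehat_escape_weight; [ring|].
    now apply (proj2 (dedup_spec A)).
  - unfold dedup; cbn [nodup]. destruct in_dec; [reflexivity|].
    unfold lsum at 2; cbn [fold_right]. rewrite pot_origin, Rmult_0_r, Rplus_0_l. reflexivity.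
Qed.

(** The escape weight minus [pot] is bounded, and its charge is that of the escape weight minus a
    unit mass at the origin. Zero total charge gives mass [1], and the representation makes the
    potential equal to the escape weight plus a constant, hence smallest on [L]. The lower bound
    serves monotonicity; the vanishing at interior points serves balls. *)
Theorem caphat_equilibrium L : NoDup L -> (forall z, In z (origin :: A) <-> In z L) ->
  exists g, equilibrium L g (caphat A) /\ (forall y, caphat A <= potential L g y) /\
    forall z, In z L -> (forall e, In e dirs -> In (padd z e) L) -> g z = 0.
Proof.
  intros HL Hm. set (w := escape_weight).
  destruct hit_limit_bounds as [K HK].
  set (f := fun y => w y - pot y).
  assert (Hlapf : forall y, lap f y = lap w y - delta0 y).
  { intros y. unfold f; rewrite lap_minus. unfold lap at 2. rewrite pot_avg; ring. }
  destruct (bounded_representation f K L HL) as [Hsum [k [_ Hk]]].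
  { intros y. unfold f, w, escape_weight. specialize (HK y). pose proof (Rmin_l K (pot y)).
    replace (pot y - hit_limit y - pot y) with (- hit_limit y) by ring.
    rewrite Rabs_Ropp, Rabs_right; lra. }
  { intros y Hy. rewrite Hlapf. unfold w. rewrite escape_weight_lap by (rewrite Hm; assumption).
    unfold delta0; destruct pt_eq_dec as [->|]; [|ring]. exfalso; apply Hy, Hm; now left. }
  assert (Ho : In origin L) by (apply Hm; now left).
  assert (Hd : forall h : pt -> R, lsum (fun z => delta0 z * h z) L = h origin).
  { intros h. rewrite (lsum_ext _ (fun z => if pt_eq_dec z origin then h z else 0)).
    - now apply lsum_delta.
    - intros z _; unfold delta0; destruct pt_eq_dec; ring. }
  assert (Hpot : forall y, potential L (lap w) y = w y - k).
  { intros y. pose proof (Hk y) as E.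
    rewrite (lsum_ext _ (fun z => lap w z * pot (psub y z) + (-1) * (delta0 z * pot (psub y z)))) in E
      by (intros; rewrite Hlapf; ring).
    rewrite lsum_plus, lsum_scal, Hd in E. fold (potential L (lap w) y) in E.
    replace (psub y origin) with y in E by (destruct y; unfold psub, origin; cbn; f_equal; lia).
    unfold f in E. lra. }
  (* At the origin the escape weight is zero and the potential is the sum of [g z * pot z], which is
     [caphat A]. *)
  assert (Hc : caphat A = - k).
  { rewrite caphat_lsum.
    rewrite (lsum_perm _ _ L).
    2: { apply NoDup_Permutation; [apply dedup_spec | assumption |]. intros z. rewrite <- Hm. apply dedup_spec. }
    pose proof (Hpot origin) as E. unfold w in E at 2. rewrite escape_weight_zero in E by (now left).
    unfold potential in E. rewrite Rminus_0_l in E. rewrite <- E. apply lsum_ext; intros z _.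
    fold w. now rewrite <- (pot_opp z). }
  exists (lap w). split; [repeat split|split].
  - assumption.
  - rewrite (lsum_ext _ (fun z => lap w z + (-1) * (delta0 z * 1))) in Hsum by (intros; rewrite Hlapf; ring).
    rewrite lsum_plus, lsum_scal, (Hd (fun _ => 1)) in Hsum. lra.
  - intros z Hz. unfold lap, w. rewrite escape_weight_zero by (now apply Hm).
    rewrite Rminus_0_r, <- (avg_const 0 z). apply avg_le; intros; apply escape_weight_nonneg.
  - intros y Hy. rewrite Hpot, Hc. unfold w. rewrite escape_weight_zero by (now apply Hm). ring.
  - intros y. rewrite Hpot, Hc. pose proof (escape_weight_nonneg y). unfold w; lra.
  - intros z Hz He. unfold lap, w. rewrite (escape_weight_zero z) by (now apply Hm).
    rewrite (avg_ext _ (fun _ => 0)), avg_const; [ring|].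
    intros e Hdir. apply escape_weight_zero, Hm, He, Hdir.
Qed.

End ConditionedWalk.

(** Only the sets completed by the origin have to correspond, so [phi] may move the origin. For a
    map exchanging [0] and [x] this is the symmetry of the law conditioned on [x] being vacant. *)
Lemma caphat_invariant (phi : pt -> pt) A B :
  (forall u v, pot (psub (phi u) (phi v)) = pot (psub u v)) ->
  (forall u v, phi u = phi v -> u = v) ->
  (forall z, In z (origin :: B) <-> In z (map phi (origin :: A))) ->
  caphat A = caphat B.
Proof.
  intros Hphi Hinj HB. set (L := dedup (origin :: A)).
  destruct (dedup_spec (origin :: A)) as [D1 D2]. fold L in D1, D2.
  destruct (caphat_equilibrium A L D1) as [g [E _]]; [intros; symmetry; apply D2|].
  destruct (caphat_equilibrium B (map phi L)) as [g' [E' _]].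
  { apply FinFun.Injective_map_NoDup; assumption. }
  { intros z. rewrite HB, !in_map_iff. split; intros [y [Ey Hy]]; exists y; split; auto; now apply D2. }
  apply (equilibrium_unique L g _ (fun z => g' (phi z)) _ E). now apply equilibrium_pullback.
Qed.

(** ** Harmonic measure *)

Section HarmonicMeasure.
Variables (A : list pt) (x : pt).

Definition hit0 (n : nat) (y : pt) : R :=
  if memb y A then (if pt_eq_dec y x then 1 else 0) else hit_at n A x y.

Lemma hit_at_S n y : hit_at (S n) A x y = avg (hit0 n) y.
Proof. reflexivity. Qed.

Lemma hit_at_bounds n y : 0 <= hit_at n A x y <= 1 /\ hit_at n A x y <= hit_at (S n) A x y.
Proof.
  assert (B : forall n y, 0 <= hit_at n A x y <= 1).
  { clear n y; induction n as [|n IH]; intros y; [cbn; lra|]. rewrite hit_at_S.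
    assert (B : forall z, 0 <= hit0 n z <= 1).
    { intros z; unfold hit0. destruct memb; [destruct pt_eq_dec; lra | apply IH]. }
    split; [rewrite <- (avg_const 0 y) at 1 | rewrite <- (avg_const 1 y)]; apply avg_le; intros; apply B. }
  split; [apply B|]. revert y; induction n as [|n IH]; intros y; [apply B|].
  rewrite !hit_at_S. apply avg_le; intros e _. unfold hit0. destruct memb; [lra | apply IH].
Qed.

Definition hit_prob (y : pt) : R :=
  if memb y A then (if pt_eq_dec y x then 1 else 0) else Lim (fun n => hit_at n A x y).

Lemma hit_at_cv y : Un_cv (fun n => hit_at n A x y) (Lim (fun n => hit_at n A x y)).
Proof.
  destruct (growing_cv (fun n => hit_at n A x y)) as [l Hl].
  { intros n; apply hit_at_bounds. }
  { exists 1; intros _ [n ->]; apply hit_at_bounds. }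
  now rewrite (Lim_spec _ l).
Qed.

Lemma hit0_cv y : Un_cv (fun n => hit0 n y) (hit_prob y).
Proof. unfold hit0, hit_prob. destruct memb; [apply un_cv_const | apply hit_at_cv]. Qed.

Lemma hit_prob_bounds y : 0 <= hit_prob y <= 1.
Proof.
  split.
  - apply (un_cv_le (fun _ => 0) (fun n => hit0 n y)); [apply un_cv_const | apply hit0_cv|].
    intros n; unfold hit0. destruct memb; [destruct pt_eq_dec; lra | apply hit_at_bounds].
  - apply (un_cv_le (fun n => hit0 n y) (fun _ => 1)); [apply hit0_cv | apply un_cv_const|].
    intros n; unfold hit0. destruct memb; [destruct pt_eq_dec; lra | apply hit_at_bounds].
Qed.

Lemma hit_prob_lap y : ~ In y A -> lap hit_prob y = 0.
Proof.
  intros Hy. unfold lap. enough (avg hit_prob y = hit_prob y) by lra.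
  unfold hit_prob at 2. rewrite (proj2 (memb_false y A) Hy).
  apply (UL_sequence (fun n => hit_at (S n) A x y)).
  - apply (un_cv_avg hit0); intros; apply hit0_cv.
  - apply (un_cv_S (fun n => hit_at n A x y)), hit_at_cv.
Qed.

Lemma list_norm_bound (l : list pt) : exists r, forall z, In z l -> norm z < r.
Proof.
  induction l as [|a l [r Hr]]; [exists 0; intros z []|].
  exists (Rmax r (norm a + 1)). pose proof (Rmax_l r (norm a + 1)). pose proof (Rmax_r r (norm a + 1)).
  intros z [<-|Hz]; [lra | specialize (Hr z Hz); lra].
Qed.

(** The integral of [hit_prob] against [g] is computed twice. On [A] the function is the indicator
    of [x], which gives [g x]. Written as its limit [k] at infinity plus the potential of a neutral
    charge, it gives [k], since [g] has constant potential on [A]. *)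
Lemma hm_equilibrium g c : equilibrium (dedup A) g c -> In x A -> hm A x = g x.
Proof.
  intros E Hx. destruct (dedup_spec A) as [D1 D2].
  destruct (bounded_representation hit_prob 1 (dedup A) D1) as [Hsum [k [Hk Hrep]]].
  { intros y. pose proof (hit_prob_bounds y). rewrite Rabs_right; lra. }
  { intros y Hy. apply hit_prob_lap. now rewrite <- D2. }
  assert (Hg : lsum (fun y => g y * hit_prob y) (dedup A) = g x).
  { rewrite (lsum_ext _ (fun y => if pt_eq_dec y x then g y else 0)).
    - apply lsum_delta; [assumption | now apply D2].
    - intros y Hy. unfold hit_prob. rewrite (proj2 (memb_spec y A)) by (now apply D2).
      destruct pt_eq_dec; ring. }
  assert (Hg' : lsum (fun y => g y * hit_prob y) (dedup A) = k).
  { rewrite (lsum_ext _ (fun y => g y * k + g y * potential (dedup A) (lap hit_prob) y)).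
    - rewrite lsum_plus, lsum_mult_r, potential_pairing.
      destruct E as [_ [E2 [_ E4]]]. rewrite E2.
      rewrite (lsum_ext _ (fun z => lap hit_prob z * c)) by (intros; now rewrite E4).
      rewrite lsum_mult_r, Hsum; ring.
    - intros y _. rewrite (Hrep y) at 1. unfold potential; ring. }
  rewrite <- Hg, Hg'. unfold hm. apply LimInf_spec.
  destruct (list_norm_bound A) as [r Hr].
  apply (tends_inf_ext_far hit_prob _ _ r); [|assumption].
  intros y Hy. unfold hit_prob. rewrite (proj2 (memb_false y A)); [reflexivity|].
  intros Hin; specialize (Hr y Hin); lra.
Qed.

End HarmonicMeasure.

Lemma cap_caphat A : In origin A -> cap A = caphat A.
Proof.
  intros Ho. unfold cap. rewrite (proj2 (memb_spec origin A) Ho). unfold cap0.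
  destruct (dedup_spec A) as [D1 D2].
  destruct (caphat_equilibrium A (dedup A) D1) as [g [E _]].
  { intros z. rewrite D2. split; [intros [<-|]; assumption | now right]. }
  rewrite <- (proj2 (proj2 (proj2 E)) origin) by (now apply D2).
  apply lsum_ext; intros z Hz. rewrite (hm_equilibrium A z g (caphat A)) by (try apply D2; assumption).
  rewrite <- (pot_opp z). unfold popp; ring.
Qed.

(** ** Lattice isometries *)

Definition sqnorm (u : pt) : Z := (fst u * fst u + snd u * snd u)%Z.

Lemma norm_eq_sqnorm u v : norm u = norm v -> sqnorm u = sqnorm v.
Proof.
  intros H. apply eq_IZR. unfold sqnorm. rewrite !plus_IZR, !mult_IZR.
  pose proof (norm_sq u) as A. pose proof (norm_sq v) as B. rewrite H, B in A. lra.
Qed.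

Lemma unit_vectors p q : (p * p + q * q = 1)%Z ->
  ((p = 1 \/ p = -1) /\ q = 0 \/ p = 0 /\ (q = 1 \/ q = -1))%Z.
Proof.
  intros H. assert (-1 <= p <= 1)%Z by nia. assert (-1 <= q <= 1)%Z by nia.
  assert (Hc : (p = -1 \/ p = 0 \/ p = 1)%Z) by lia.
  destruct Hc as [-> | [-> | ->]]; nia.
Qed.

Lemma pot_dihedral x1 x2 y1 y2 :
  ((y1 = x1 \/ y1 = - x1) /\ (y2 = x2 \/ y2 = - x2) \/
   (y1 = x2 \/ y1 = - x2) /\ (y2 = x1 \/ y2 = - x1))%Z -> pot (y1, y2) = pot (x1, x2).
Proof.
  intros [[H1 H2] | [H1 H2]]; destruct H1 as [-> | ->], H2 as [-> | ->];
    rewrite ?pot_flip, ?pot_flip'; reflexivity || apply pot_swap.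
Qed.

(* Polarization gives the inner products of [M u - M v] with the images of the two basis vectors, which are an orthonormal integer basis. *)
Lemma isometry_pot M u v : isometry M -> pot (psub (M u) (M v)) = pot (psub u v).
Proof.
  intros HM.
  assert (H : forall a b, sqnorm (psub (M a) (M b)) = sqnorm (psub a b)) by (intros; apply norm_eq_sqnorm, HM).
  assert (E1 := H (1, 0)%Z origin). assert (E2 := H (0, 1)%Z origin). assert (E12 := H (1, 0)%Z (0, 1)%Z).
  assert (U0 := H u origin). assert (U1 := H u (1, 0)%Z). assert (U2 := H u (0, 1)%Z).
  assert (V0 := H v origin). assert (V1 := H v (1, 0)%Z). assert (V2 := H v (0, 1)%Z).
  clear H HM.
  destruct (M u) as [mu1 mu2], (M v) as [mv1 mv2], (M (1, 0)%Z) as [a1 a2], (M (0, 1)%Z) as [b1 b2],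
    (M origin) as [o1 o2], u as [u1 u2], v as [v1 v2].
  unfold sqnorm, psub, origin in *; cbn [fst snd] in *. rewrite !Z.sub_0_r in *.
  set (p := (a1 - o1)%Z) in *. set (q := (a2 - o2)%Z) in *. set (r := (b1 - o1)%Z) in *. set (s := (b2 - o2)%Z) in *.
  assert (Hp : (p * p + q * q = 1)%Z) by lia.
  assert (Hr : (r * r + s * s = 1)%Z) by lia.
  assert (Hpr : (p * r + q * s = 0)%Z).
  { replace (a1 - b1)%Z with (p - r)%Z in E12 by (unfold p, r; lia).
    replace (a2 - b2)%Z with (q - s)%Z in E12 by (unfold q, s; lia). lia. }
  set (y1 := (mu1 - mv1)%Z). set (y2 := (mu2 - mv2)%Z).
  assert (Hy1 : (p * y1 + q * y2 = u1 - v1)%Z).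
  { replace (mu1 - a1)%Z with ((mu1 - o1) - p)%Z in U1 by (unfold p; lia).
    replace (mu2 - a2)%Z with ((mu2 - o2) - q)%Z in U1 by (unfold q; lia).
    replace (mv1 - a1)%Z with ((mv1 - o1) - p)%Z in V1 by (unfold p; lia).
    replace (mv2 - a2)%Z with ((mv2 - o2) - q)%Z in V1 by (unfold q; lia).
    unfold y1, y2. replace (mu1 - mv1)%Z with ((mu1 - o1) - (mv1 - o1))%Z by lia.
    replace (mu2 - mv2)%Z with ((mu2 - o2) - (mv2 - o2))%Z by lia. lia. }
  assert (Hy2 : (r * y1 + s * y2 = u2 - v2)%Z).
  { replace (mu1 - b1)%Z with ((mu1 - o1) - r)%Z in U2 by (unfold r; lia).
    replace (mu2 - b2)%Z with ((mu2 - o2) - s)%Z in U2 by (unfold s; lia).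
    replace (mv1 - b1)%Z with ((mv1 - o1) - r)%Z in V2 by (unfold r; lia).
    replace (mv2 - b2)%Z with ((mv2 - o2) - s)%Z in V2 by (unfold s; lia).
    unfold y1, y2. replace (mu1 - mv1)%Z with ((mu1 - o1) - (mv1 - o1))%Z by lia.
    replace (mu2 - mv2)%Z with ((mu2 - o2) - (mv2 - o2))%Z by lia. lia. }
  clearbody p q r s y1 y2. apply pot_dihedral.
  destruct (unit_vectors p q Hp) as [[Hp' ->] | [-> Hp']], (unit_vectors r s Hr) as [[Hr' ->] | [-> Hr']];
    destruct Hp' as [-> | ->], Hr' as [-> | ->]; lia.
Qed.

Lemma pot_zero x : pot x = 0 -> x = origin.
Proof.
  intros H. destruct (pt_eq_dec x origin) as [|Hx]; [assumption|].
  pose proof (pot_ge_1 x Hx); lra.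
Qed.

Lemma isometry_inj M u v : isometry M -> M u = M v -> u = v.
Proof.
  intros HM E. apply psub_eq_origin, pot_zero.
  rewrite <- (isometry_pot M) by assumption. rewrite (proj2 (psub_eq_origin (M u) (M v)) E). apply pot_origin.
Qed.

Lemma cond_isometry alpha x A M : isometry M -> M origin = x -> M x = origin ->
  cond alpha A x = cond alpha (map M A) x.
Proof.
  intros HM H0 Hx. unfold cond, vac.
  rewrite (caphat_invariant M (x :: A) (x :: map M A)); [reflexivity | | |].
  - intros; now apply isometry_pot.
  - intros u v; now apply isometry_inj.
  - intros z. cbn [map In]. rewrite H0, Hx. tauto.
Qed.

Lemma isometry_reflection x : isometry (fun z => psub x z).
Proof.
  intros u v. rewrite <- norm_popp. f_equal. unfold popp, psub, origin; cbn; f_equal; lia.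
Qed.

(** ** Capacities of two and three points *)

Lemma caphat_same A B : (forall z, In z (origin :: A) <-> In z (origin :: B)) -> caphat A = caphat B.
Proof.
  intros H. apply (caphat_invariant (fun z => z)); auto.
  intros z. rewrite map_id. symmetry; apply H.
Qed.

Lemma caphat_mono A B : incl A B -> caphat A <= caphat B.
Proof.
  intros H. destruct (dedup_spec (origin :: A)) as [A1 A2]. destruct (dedup_spec (origin :: B)) as [B1 B2].
  destruct (caphat_equilibrium A (dedup (origin :: A)) A1) as [g [E [Hg _]]]; [intros; symmetry; apply A2|].
  destruct (caphat_equilibrium B (dedup (origin :: B)) B1) as [g' [E' _]]; [intros; symmetry; apply B2|].
  apply (equilibrium_mono _ _ _ _ _ _ E E'); [|assumption].
  intros z Hz. apply B2. apply A2 in Hz as [<-|Hz]; [now left | right; now apply H].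
Qed.

Lemma caphat_nil : caphat nil = 0.
Proof. reflexivity. Qed.

Lemma psub_origin_r y : psub y origin = y.
Proof. destruct y; unfold psub, origin; cbn; f_equal; lia. Qed.

Lemma pot_psub_origin_l y : pot (psub origin y) = pot y.
Proof. apply pot_opp. Qed.

Lemma pot_psub_diag y : pot (psub y y) = 0.
Proof. rewrite (proj2 (psub_eq_origin y y) eq_refl). apply pot_origin. Qed.

Lemma caphat_single x : caphat (x :: nil) = pot x / 2.
Proof.
  destruct (pt_eq_dec x origin) as [->|Hx].
  { rewrite (caphat_same _ nil) by (intros; cbn; tauto). rewrite caphat_nil, pot_origin; lra. }
  destruct (caphat_equilibrium (x :: nil) (origin :: x :: nil)) as [g [[_ [H1 [_ H2]]] _]].
  { repeat constructor; cbn; intuition congruence. }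
  { tauto. }
  pose proof (H2 origin ltac:(cbn; tauto)) as E0. pose proof (H2 x ltac:(cbn; tauto)) as Ex.
  unfold potential, lsum in *; cbn [fold_right] in *.
  rewrite pot_psub_diag, pot_psub_origin_l in E0. rewrite pot_psub_diag, psub_origin_r in Ex.
  pose proof (pot_ge_1 x Hx). nra.
Qed.

(** Kept in product form, so that the linear system is solved before anything is known about the
    denominator. *)
Lemma caphat_pair x y : x <> origin -> y <> origin -> x <> y ->
  caphat (x :: y :: nil) *
    (pot x * pot y + pot x * pot (psub x y) + pot y * pot (psub x y)
     - / 2 * (pot x ^ 2 + pot y ^ 2 + pot (psub x y) ^ 2))
  = pot x * pot y * pot (psub x y).
Proof.
  intros Hx Hy Hxy.
  destruct (caphat_equilibrium (x :: y :: nil) (origin :: x :: y :: nil)) as [g [[_ [H1 [_ H2]]] _]].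
  { repeat constructor; cbn; intuition congruence. }
  { tauto. }
  pose proof (H2 origin ltac:(cbn; tauto)) as E0. pose proof (H2 x ltac:(cbn; tauto)) as Ex.
  pose proof (H2 y ltac:(cbn; tauto)) as Ey.
  unfold potential, lsum in *; cbn [fold_right] in *.
  rewrite pot_psub_diag, !pot_psub_origin_l in E0. rewrite pot_psub_diag, psub_origin_r in Ex, Ey.
  rewrite (pot_psub_sym y x) in Ey.
  set (c := caphat (x :: y :: nil)) in *.
  set (X := pot x) in *. set (Y := pot y) in *. set (Z := pot (psub x y)) in *.
  (* Cramer's rule for the weights [g], whose sum is [1]. *)
  assert (E0' : g x * X + g y * Y = c) by lra. assert (Ex' : g origin * X + g y * Z = c) by lra.
  assert (Ey' : g origin * Y + g x * Z = c) by lra.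
  assert (G0 : c * (Z * (X + Y - Z)) = g origin * (2 * X * Y * Z)).
  { transitivity (X * Z * (g origin * Y + g x * Z) + Y * Z * (g origin * X + g y * Z) - Z ^ 2 * (g x * X + g y * Y));
      [rewrite E0', Ex', Ey'|]; ring. }
  assert (Gx : c * (Y * (X + Z - Y)) = g x * (2 * X * Y * Z)).
  { transitivity (X * Y * (g origin * Y + g x * Z) + Y * Z * (g x * X + g y * Y) - Y ^ 2 * (g origin * X + g y * Z));
      [rewrite E0', Ex', Ey'|]; ring. }
  assert (Gy : c * (X * (Y + Z - X)) = g y * (2 * X * Y * Z)).
  { transitivity (X * Y * (g origin * X + g y * Z) + X * Z * (g x * X + g y * Y) - X ^ 2 * (g origin * Y + g x * Z));
      [rewrite E0', Ex', Ey'|]; ring. }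
  assert (Hg : g y = 1 - g origin - g x) by lra. rewrite Hg in Gy. lra.
Qed.

(** The second expression divides numerator and denominator by the kernel of the difference. Its
    denominator remains of logarithmic order even when that kernel is of smaller order. *)
Lemma caphat_Psi x y : x <> origin -> y <> origin -> x <> y ->
  caphat (x :: y :: nil) = Psi x y /\
  Psi x y = pot x * pot y / (pot x + pot y - pot (psub x y) / 2 - (pot x - pot y) ^ 2 / pot (psub x y) / 2).
Proof.
  intros Hx Hy Hxy. pose proof (caphat_pair x y Hx Hy Hxy) as H.
  assert (Hd : psub x y <> origin) by (intros E; now apply Hxy, psub_eq_origin).
  pose proof (pot_ge_1 x Hx). pose proof (pot_ge_1 y Hy). pose proof (pot_ge_1 _ Hd).
  unfold Psi; cbv zeta. set (X := pot x) in *. set (Y := pot y) in *. set (Z := pot (psub x y)) in *.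
  set (D := X * Y + X * Z + Y * Z - / 2 * (X ^ 2 + Y ^ 2 + Z ^ 2)) in *.
  (* The product of the three kernels is positive, so the product form excludes a zero
     denominator. *)
  assert (HD : D <> 0).
  { intros E. rewrite E, Rmult_0_r in H. assert (0 < X * Y * Z) by (repeat apply Rmult_lt_0_compat; lra). lra. }
  split.
  - rewrite <- H. field; assumption.
  - replace (X + Y - Z / 2 - (X - Y) ^ 2 / Z / 2) with (D / Z) by (unfold D; field; lra).
    field; lra.
Qed.

(** ** Adding a distant point *)

(** Seen from [x], the equilibrium measure of [A] and the normalized restriction to [A] of the new
    equilibrium measure both look like a unit mass at the origin: their potentials at [x] are
    [pot x + d1] and [pot x + d2]. In these two numbers the capacity is an exact rational
    expression, so all approximation sits in [d1] and [d2]. *)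
Lemma caphat_add : exists C, 0 < C /\ forall A x r, 1 <= r -> In origin A ->
  (forall z, In z A -> norm z <= r) -> 2 * r <= norm x ->
  exists d1 d2, Rabs d1 <= C * (r / norm x) /\ Rabs d2 <= C * (r / norm x) /\
    2 * pot x + d1 + d2 - caphat A <> 0 /\
    caphat (x :: A) = (pot x + d1) * (pot x + d2) / (2 * pot x + d1 + d2 - caphat A).
Proof.
  destruct pot_shift as [C [HC Hshift]]. exists C; split; [assumption|].
  intros A x r Hr Ho HA Hx.
  set (L := dedup A). destruct (dedup_spec A) as [L1 L2]. fold L in L1, L2.
  assert (HxA : ~ In x L) by (intros H; apply L2, HA in H; lra).
  destruct (caphat_equilibrium A L L1) as [g [E _]].
  { intros z. rewrite L2. split; [intros [<-|]; assumption | now right]. }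
  destruct (caphat_equilibrium (x :: A) (x :: L)) as [g' [E' _]].
  { now constructor. }
  { intros z. cbn [In]. rewrite L2. split; [intros [<-|[]]; tauto | tauto]. }
  set (a := pot x). set (c := caphat A) in *. set (c' := caphat (x :: A)) in *.
  set (eps := C * (r / norm x)).
  set (U := potential L g x). set (q := lsum g' L). set (T := potential L g' x).
  destruct E as [_ [Es [Ep Ec]]]. destruct E' as [_ [Es' [Ep' Ec']]].
  assert (Es2 : g' x + q = 1) by exact Es'.
  assert (ET : T = c').
  { rewrite <- (Ec' x) by (now left).
    change (T = g' x * pot (psub x x) + T). rewrite pot_psub_diag; ring. }
  assert (EU : q * c + g' x * U = c').
  { rewrite <- (equilibrium_pair L g c (potential (x :: L) g') c').
    - rewrite potential_pairing.
      change (q * c + g' x * U = g' x * U + lsum (fun z => g' z * potential L g z) L).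
      rewrite (lsum_ext (fun z => g' z * potential L g z) (fun z => g' z * c)) by (intros; now rewrite Ec).
      rewrite lsum_mult_r. fold q. ring.
    - now repeat split.
    - intros y Hy; apply Ec'; now right. }
  assert (Hnear : forall h : pt -> R, (forall z, In z L -> 0 <= h z) ->
            Rabs (potential L h x - lsum h L * a) <= lsum h L * eps).
  { intros h Hh.
    replace (potential L h x - lsum h L * a) with (lsum (fun z => h z * (pot (psub x z) - a)) L).
    - rewrite <- lsum_mult_r. apply lsum_abs_le. intros z Hz.
      rewrite Rabs_mult, (Rabs_right (h z)) by (apply Rle_ge, Hh, Hz).
      apply Rmult_le_compat_l; [now apply Hh|]. apply Hshift; [assumption | | assumption]. now apply HA, L2.
    - unfold potential. rewrite (lsum_ext _ (fun z => h z * pot (psub x z) + h z * (- a))) by (intros; ring).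
      rewrite lsum_plus, lsum_mult_r; ring. }
  assert (HU : 1 <= U).
  { rewrite <- Es. apply lsum_le. intros z Hz.
    assert (1 <= pot (psub x z)).
    { apply pot_ge_1. intros E. apply (proj1 (psub_eq_origin x z)) in E. subst; contradiction. }
    pose proof (Ep z Hz). nra. }
  assert (Hq0 : 0 <= q).
  { unfold q. replace 0 with (lsum (fun _ : pt => 0) L) by (rewrite lsum_const; ring).
    apply lsum_le; intros; apply Ep'; now right. }
  assert (HT := Hnear g' (fun z Hz => Ep' z (or_intror Hz))). fold T q in HT.
  assert (HU' := Hnear g Ep). rewrite Es in HU'. fold U in HU'.
  (* Without mass on [A] the potential at [x] would be [0], and so would [c']; but then [c'] would
     also equal [U >= 1]. *)
  assert (Hq : q <> 0).
  { intros E0. rewrite E0, !Rmult_0_l, Rminus_0_r in HT.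
    assert (T = 0) by (apply Rabs_eq_0; pose proof (Rabs_pos T); lra).
    rewrite E0 in EU, Es2. nra. }
  exists (U - a), (T / q - a).
  replace (2 * a + (U - a) + (T / q - a) - c) with (U + T / q - c) by ring.
  replace (a + (U - a)) with U by ring. replace (a + (T / q - a)) with (T / q) by ring.
  (* Elimination of [c'] between [T = c'] and [q * c + (1 - q) * U = c']. *)
  assert (Hmain : q * (U + T / q - c) = U).
  { replace (q * (U + T / q - c)) with (q * U + T - q * c) by (field; assumption).
    rewrite ET, <- EU. replace (g' x) with (1 - q) by lra. ring. }
  assert (HD : U + T / q - c <> 0) by (intros E0; rewrite E0 in Hmain; lra).
  repeat split.
  - replace (U - a) with (U - 1 * a) by ring. fold eps. lra.
  - fold eps. replace (T / q - a) with ((T - q * a) * / q) by (field; assumption).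
    rewrite Rabs_mult, (Rabs_right (/ q)) by (apply Rle_ge, Rlt_le, Rinv_0_lt_compat; lra).
    apply Rmult_le_reg_r with q; [lra|]. rewrite Rmult_assoc, Rinv_l by assumption. lra.
  - assumption.
  - rewrite <- ET. set (D := U + T / q - c) in *. rewrite <- Hmain. field; split; assumption.
Qed.

(** * One vacant site, and conditioning on a distant one *)

Lemma vac_single alpha x : vac alpha (x :: nil) = exp (- (PI * alpha * pot x / 2)).
Proof. unfold vac. rewrite caphat_single. f_equal; field. Qed.

Lemma cond_exp alpha A x : cond alpha A x = exp (- (PI * alpha * (caphat (x :: A) - pot x / 2))).
Proof.
  unfold cond. rewrite vac_single. unfold vac, Rdiv. rewrite <- exp_Ropp, <- exp_plus. f_equal; field.
Qed.

Lemma gamma'_spec : exists C, 0 < C /\ forall x, x <> origin ->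
  Rabs (pot x - 2 / PI * ln (norm x) - gamma') <= C / norm x ^ 2.
Proof.
  destruct pot_asymptotic as [g [C [HC H]]]. exists C. split; [assumption|].
  replace gamma' with g; [assumption|]. symmetry. apply LimInf_spec.
  intros eps Heps. exists (1 + C / eps). intros y Hy.
  assert (0 < C / eps) by (apply Rdiv_lt_0_compat; lra).
  eapply Rle_lt_trans; [apply H, norm_gt_nonorigin; lra|].
  apply Rmult_lt_reg_r with (norm y ^ 2); [nra|].
  unfold Rdiv at 1; rewrite Rmult_assoc, Rinv_l, Rmult_1_r by nra.
  apply Rlt_le_trans with (eps * norm y); [|apply Rmult_le_compat_l; [lra | nra]].
  apply Rlt_le_trans with (eps * (1 + C / eps)); [|apply Rmult_le_compat_l; lra].
  replace (eps * (1 + C / eps)) with (eps + C) by (field; lra). lra.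
Qed.

Lemma vac_single_asymptotic alpha : 0 < alpha -> exists C R0, forall x, R0 <= norm x ->
  Rabs (vac alpha (x :: nil) /
        (exp (- (gamma' * PI * alpha / 2)) * Rpower (norm x) (- alpha)) - 1) <= C / norm x ^ 2.
Proof.
  intros Ha. destruct gamma'_spec as [C [HC H]]. pose proof PI_RGT_0 as Hpi.
  set (K := PI * alpha / 2 * C). assert (HK : 0 < K) by (unfold K; apply Rmult_lt_0_compat; nra).
  (* Beyond [1 + 2 * K] the exponent error [K / N ^ 2] is at most [1 / 2], the range of
     [exp_remainder_abs]; the constant doubles because the quadratic remainder is bounded by the
     linear term. *)
  exists (2 * K), (1 + 2 * K). intros x Hx.
  specialize (H x (norm_gt_nonorigin x ltac:(lra))).
  set (N := norm x) in *. set (d := pot x - 2 / PI * ln N - gamma') in *.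
  rewrite vac_single. unfold Rpower, Rdiv. rewrite <- exp_plus, <- exp_Ropp, <- exp_plus.
  replace (- (PI * alpha * pot x * / 2) + - (- (gamma' * PI * alpha * / 2) + - alpha * ln N))
    with (- (PI * alpha / 2 * d)) by (unfold d; field; lra).
  set (y := PI * alpha / 2 * d).
  assert (Hy : Rabs y <= K / N ^ 2).
  { unfold y. rewrite Rabs_mult, (Rabs_right (PI * alpha / 2)) by nra.
    unfold K. replace (PI * alpha / 2 * C / N ^ 2) with (PI * alpha / 2 * (C / N ^ 2)) by (field; lra).
    apply Rmult_le_compat_l; [nra | assumption]. }
  assert (HN : K / N ^ 2 <= / 2).
  { apply Rmult_le_reg_r with (N ^ 2); [nra|]. unfold Rdiv; rewrite Rmult_assoc, Rinv_l; nra. }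
  pose proof (exp_remainder_abs y ltac:(lra)) as B.
  replace (2 * K * / N ^ 2) with (K / N ^ 2 + K / N ^ 2) by (unfold Rdiv; ring).
  replace (exp (- y) - 1) with (- (1 - exp (- y) - y) + - y) by ring.
  eapply Rle_trans; [apply Rabs_triang|]. rewrite !Rabs_Ropp.
  rewrite <- pow2_abs in B. pose proof (Rabs_pos y).
  assert (2 * Rabs y ^ 2 <= Rabs y) by nra. lra.
Qed.

(** [caphat_add] gives errors of order [r / norm x]. They fit the stated form because
    [ln r >= 1 / 2] and [ln (norm x) >= 1]. *)
Lemma cond_ball_estimate : exists C1 C2, forall alpha r A x,
  0 < alpha -> 2 <= r -> In origin A -> (forall z, In z A -> norm z <= r) -> 2 * r <= norm x ->
  exists th1 th2, Rabs th1 <= C1 * (r * ln r * ln (norm x) / norm x) /\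
    Rabs th2 <= C2 * (r * ln r / norm x) /\
    cond alpha A x = exp (- (PI * alpha / 4 * cap A * (1 + th1) / (1 - cap A / (2 * pot x) + th2))).
Proof.
  destruct caphat_add as [C [HC Hadd]].
  exists (2 * C * (4 + 2 * C)), (2 * C). intros alpha r A x Halpha Hr Ho HA Hx.
  assert (Hx0 : x <> origin) by (apply norm_gt_nonorigin; lra).
  pose proof (pot_ge_1 x Hx0) as Ha. rewrite cond_exp, cap_caphat by assumption.
  set (N := norm x) in *.
  assert (Hl1 : / 2 <= ln r) by (apply Rle_trans with (ln 2); [left; apply ln_lt_2 | apply ln_le; lra]).
  assert (Hl2 : 1 <= ln N).
  { apply Rle_trans with (ln (2 * 2)); [|apply ln_le; lra]. rewrite ln_mult by lra. pose proof ln_lt_2; lra. }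
  assert (He : 0 < r / N <= / 2).
  { split; [apply Rdiv_lt_0_compat; lra|]. apply Rmult_le_reg_r with N; [lra|].
    unfold Rdiv; rewrite Rmult_assoc, Rinv_l; lra. }
  assert (Hb1 : r / N <= 2 * (r * ln r / N)).
  { replace (2 * (r * ln r / N)) with (r / N * (2 * ln r)) by (field; lra). nra. }
  assert (Hb2 : r / N <= 2 * (r * ln r * ln N / N)).
  { replace (2 * (r * ln r * ln N / N)) with (2 * (r * ln r / N) * ln N) by (field; lra). nra. }
  (* The relative error divides by the capacity, which is at least [1 / 2] once [A] has a second
     point. For [A] reduced to the origin the capacity is [0] and both errors are taken to be
     [0]. *)
  destruct (classic (exists z, In z A /\ z <> origin)) as [[z [Hz Hz0]]|Htriv].
  - assert (Hc : / 2 <= caphat A).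
    { apply Rle_trans with (caphat (z :: nil)).
      - rewrite caphat_single. pose proof (pot_ge_1 z Hz0); lra.
      - apply caphat_mono. intros w [<-|[]]; assumption. }
    destruct (Hadd A x r ltac:(lra) Ho HA Hx) as [d1 [d2 [H1 [H2 [HD E]]]]].
    rewrite E. fold N in H1, H2. set (a := pot x) in *. set (c := caphat A) in *.
    set (e := C * (r / N)) in *.
    assert (He2 : 0 < e <= C / 2) by (unfold e; nra).
    (* Subtracting [a / 2] from the capacity formula leaves the numerator
       [a c + a (d1 + d2) + 2 d1 d2] over [2 (2 a + d1 + d2 - c)]; factoring out [c / 4] reveals
       these two errors. *)
    exists ((d1 + d2 + 2 * d1 * d2 / a) / c), ((d1 + d2) / (2 * a)).
    assert (Hs : Rabs (d1 + d2) <= 2 * e) by (eapply Rle_trans; [apply Rabs_triang | lra]).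
    split; [|split].
    + assert (Hp : Rabs (2 * d1 * d2 / a) <= 2 * (e * e)).
      { unfold Rdiv. rewrite !Rabs_mult, (Rabs_right 2), (Rabs_right (/ a)) by
          (try (apply Rle_ge, Rlt_le, Rinv_0_lt_compat); lra).
        assert (0 < / a <= 1) by (split; [apply Rinv_0_lt_compat; lra | rewrite <- Rinv_1; apply Rinv_le_contravar; lra]).
        pose proof (Rabs_pos d1). pose proof (Rabs_pos d2).
        assert (Rabs d1 * Rabs d2 <= e * e) by (apply Rmult_le_compat; lra).
        assert (0 <= Rabs d1 * Rabs d2) by nra. nra. }
      unfold Rdiv at 1. rewrite Rabs_mult, (Rabs_right (/ c)) by (apply Rle_ge, Rlt_le, Rinv_0_lt_compat; lra).
      assert (Hi : 0 < / c <= 2).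
      { split; [apply Rinv_0_lt_compat; lra|]. rewrite <- (Rinv_inv 2). apply Rinv_le_contravar; lra. }
      assert (Hn : Rabs (d1 + d2 + 2 * d1 * d2 / a) <= 2 * e + 2 * (e * e))
        by (eapply Rle_trans; [apply Rabs_triang | lra]).
      apply Rle_trans with ((2 * e + 2 * (e * e)) * 2).
      { apply Rmult_le_compat; try lra. apply Rabs_pos. }
      apply Rle_trans with (e * (4 + 2 * C)); [nra|].
      unfold e. replace (C * (r / N) * (4 + 2 * C)) with (C * (4 + 2 * C) * (r / N)) by ring.
      replace (2 * C * (4 + 2 * C) * (r * ln r * ln N / N)) with (C * (4 + 2 * C) * (2 * (r * ln r * ln N / N))) by ring.
      apply Rmult_le_compat_l; [nra | assumption].
    + apply Rle_trans with e.
      * unfold Rdiv. rewrite Rabs_mult, (Rabs_right (/ (2 * a))) by (apply Rle_ge, Rlt_le, Rinv_0_lt_compat; lra).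
        apply Rmult_le_reg_r with (2 * a); [lra|]. rewrite Rmult_assoc, Rinv_l by lra. nra.
      * unfold e. replace (2 * C * (r * ln r / N)) with (C * (2 * (r * ln r / N))) by ring.
        apply Rmult_le_compat_l; lra.
    + do 2 f_equal.
      replace (1 - c / (2 * a) + (d1 + d2) / (2 * a)) with ((2 * a + d1 + d2 - c) / (2 * a)) by (field; lra).
      field. lra.
  - assert (HA0 : forall z, In z A -> z = origin).
    { intros z Hz. apply NNPP; intros Hz0. apply Htriv; now exists z. }
    assert (Ec : caphat A = 0).
    { rewrite (caphat_same A nil); [apply caphat_nil|].
      intros z; split; [intros [<-|Hz]; [now left | left; symmetry; now apply HA0] | intros [<-|[]]; now left]. }
    assert (Ec' : caphat (x :: A) = pot x / 2).
    { rewrite (caphat_same (x :: A) (x :: nil)); [apply caphat_single|].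
      intros z; cbn [In]; split; [|tauto]. intros [H|[H|H]]; [tauto | tauto |]. left; symmetry; now apply HA0. }
    exists 0, 0. rewrite Rabs_R0, Ec, Ec'. split; [|split].
    + apply Rmult_le_pos; [nra|]. apply Rdiv_le_0_compat; [|lra]. repeat apply Rmult_le_pos; lra.
    + apply Rmult_le_pos; [lra|]. apply Rdiv_le_0_compat; [|lra]. apply Rmult_le_pos; lra.
    + f_equal. field. lra.
Qed.

(** ** Logarithmic asymptotics along sequences *)

Lemma inv_cv_0 (l : nat -> R) : cv_infty l -> is_lim_seq (fun n => / l n) 0.
Proof.
  intros Hl. apply is_lim_seq_Reals. intros eps Heps.
  destruct (Hl (/ eps)) as [N HN]. exists N; intros n Hn. specialize (HN n Hn).
  assert (0 < / eps) by (apply Rinv_0_lt_compat; lra).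
  unfold Rdist. rewrite Rminus_0_r, Rabs_right by (apply Rle_ge, Rlt_le, Rinv_0_lt_compat; lra).
  rewrite <- (Rinv_inv eps). apply Rinv_lt_contravar; [|assumption]. apply Rmult_lt_0_compat; lra.
Qed.

Lemma bounded_div_cv_0 (u l : nat -> R) B N : cv_infty l ->
  (forall n, (N <= n)%nat -> Rabs (u n) <= B) -> is_lim_seq (fun n => u n / l n) 0.
Proof.
  intros Hl Hu. apply (is_lim_seq_abs_0 (fun n => u n / l n)).
  apply is_lim_seq_le_le_loc with (fun _ => 0) (fun n => B * Rabs (/ l n)).
  - exists N; intros n Hn. specialize (Hu n Hn). unfold Rdiv. rewrite Rabs_mult.
    pose proof (Rabs_pos (/ l n)). pose proof (Rabs_pos (u n)). split; nra.
  - apply is_lim_seq_const.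
  - replace (Finite 0) with (Rbar_mult (Finite B) (Rbar_abs (Finite 0))) by (cbn; f_equal; rewrite Rabs_R0; ring).
    apply is_lim_seq_scal_l, is_lim_seq_abs, inv_cv_0, Hl.
Qed.

Lemma cv_infty_ln u : cv_infty u -> cv_infty (fun n => ln (u n)).
Proof.
  intros Hu M. destruct (Hu (exp M)) as [N HN]. exists N; intros n Hn. specialize (HN n Hn).
  rewrite <- (ln_exp M). apply ln_increasing; [apply exp_pos | assumption].
Qed.

(** Inversion is total, so the identity holds at [d = 0] too and can be used before the denominator
    is known to be nonzero. *)
Lemma scaled_quotient a b d l : l <> 0 -> a / l * (b / l) / (d / l) = a * b / d / l.
Proof.
  intros Hl. unfold Rdiv. rewrite Rinv_mult, Rinv_inv. generalize (/ d). intros d'. field; assumption.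
Qed.

Lemma pot_div_cv (xs : nat -> pt) (l : nat -> R) (b : R) N : cv_infty l ->
  (forall n, (N <= n)%nat -> xs n <> origin) ->
  is_lim_seq (fun n => ln (norm (xs n)) / l n) b ->
  is_lim_seq (fun n => pot (xs n) / l n) (2 / PI * b).
Proof.
  intros Hl Hx Hb. destruct pot_log as [C [HC H]].
  replace (2 / PI * b) with (2 / PI * b + 0) by ring.
  apply is_lim_seq_ext with
    (fun n => 2 / PI * (ln (norm (xs n)) / l n) + (pot (xs n) - 2 / PI * ln (norm (xs n))) / l n).
  { intros n; unfold Rdiv; ring. }
  apply is_lim_seq_plus'.
  - apply (is_lim_seq_scal_l _ (2 / PI) b), Hb.
  - apply bounded_div_cv_0 with C N; [assumption|]. intros n Hn. apply H, Hx, Hn.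
Qed.

Lemma ln_one_minus_bounded u v : 0 < u -> u <= v -> v < 1 -> Rabs (ln (1 - u)) <= - ln (1 - v).
Proof.
  intros H0 H1 H2. rewrite Rabs_left1.
  - apply Ropp_le_contravar, ln_le; lra.
  - rewrite <- ln_1. apply ln_le; lra.
Qed.

Section PairAsymptotics.
Variables (alpha beta : R) (xs ys : nat -> pt).
Hypothesis Halpha : 0 < alpha.
Hypothesis Hbeta : 0 <= beta <= 1.
Hypothesis Hne : forall n, xs n <> origin /\ ys n <> origin /\ xs n <> ys n.
Hypothesis Hinf : cv_infty (fun n => norm (xs n)).
Hypothesis Hy : Un_cv (fun n => ln (norm (ys n)) / ln (norm (xs n))) 1.
Hypothesis Hxy : Un_cv (fun n => ln (norm (psub (xs n) (ys n))) / ln (norm (xs n))) beta.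

Let l (n : nat) : R := ln (norm (xs n)).
Let k : R := 2 / PI.

Lemma l_infty : cv_infty l.
Proof. apply cv_infty_ln, Hinf. Qed.

Lemma l_pos_loc : exists N, forall n, (N <= n)%nat -> 0 < l n.
Proof. destruct (l_infty 0) as [N HN]. exists N; exact HN. Qed.

Lemma diff_nonorigin n : psub (xs n) (ys n) <> origin.
Proof. intros E. apply (proj1 (psub_eq_origin _ _)) in E. now apply (Hne n). Qed.

Lemma pot_x_cv : is_lim_seq (fun n => pot (xs n) / l n) k.
Proof.
  replace k with (2 / PI * 1) by (unfold k; ring).
  apply (pot_div_cv xs l 1 0 l_infty); [intros n _; apply Hne|].
  apply is_lim_seq_ext_loc with (fun _ => 1); [|apply is_lim_seq_const].
  destruct l_pos_loc as [N HN]. exists N; intros n Hn. specialize (HN n Hn). unfold l in *. field; lra.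
Qed.

Lemma pot_y_cv : is_lim_seq (fun n => pot (ys n) / l n) k.
Proof.
  replace k with (2 / PI * 1) by (unfold k; ring).
  apply (pot_div_cv ys l 1 0 l_infty); [intros n _; apply Hne|]. apply is_lim_seq_Reals, Hy.
Qed.

Lemma pot_diff_cv : is_lim_seq (fun n => pot (psub (xs n) (ys n)) / l n) (k * beta).
Proof.
  apply (pot_div_cv (fun n => psub (xs n) (ys n)) l beta 0 l_infty); [intros n _; apply diff_nonorigin|].
  apply is_lim_seq_Reals, Hxy.
Qed.

Lemma pot_diff_le x y : Rabs (pot x - pot y) <= 2 * pot (psub x y).
Proof.
  pose proof (pot_increment (psub y x) y) as A. pose proof (pot_increment (psub x y) x) as B.
  replace (psub y (psub y x)) with x in A by (destruct x, y; unfold psub; cbn; f_equal; lia).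
  replace (psub x (psub x y)) with y in B by (destruct x, y; unfold psub; cbn; f_equal; lia).
  rewrite (pot_psub_sym y x) in A. apply Rabs_le; lra.
Qed.

(* Even when [beta = 0], dividing by [pot (x - y)] is harmless thanks to [pot_diff_le]. *)
Lemma square_term_cv :
  is_lim_seq (fun n => (pot (xs n) - pot (ys n)) ^ 2 / pot (psub (xs n) (ys n)) / l n) 0.
Proof.
  apply is_lim_seq_le_le_loc with (fun _ => 0) (fun n => 2 * Rabs (pot (xs n) / l n - pot (ys n) / l n)).
  - destruct l_pos_loc as [N HN]. exists N; intros n Hn. specialize (HN n Hn).
    pose proof (pot_ge_1 _ (diff_nonorigin n)) as Hz. pose proof (pot_diff_le (xs n) (ys n)) as Hd.
    set (X := pot (xs n)) in *. set (Y := pot (ys n)) in *. set (Z := pot (psub (xs n) (ys n))) in *.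
    replace (X / l n - Y / l n) with ((X - Y) * / l n) by (field; lra).
    rewrite Rabs_mult, (Rabs_right (/ l n)) by (apply Rle_ge, Rlt_le, Rinv_0_lt_compat, HN).
    rewrite <- (pow2_abs (X - Y)). pose proof (Rabs_pos (X - Y)).
    assert (0 < / l n) by (apply Rinv_0_lt_compat, HN).
    assert (0 <= Rabs (X - Y) ^ 2 / Z <= 2 * Rabs (X - Y)).
    { split; [apply Rdiv_le_0_compat; nra|]. apply Rmult_le_reg_r with Z; [lra|].
      unfold Rdiv; rewrite Rmult_assoc, Rinv_l by lra. nra. }
    unfold Rdiv at 2 4. split; nra.
  - apply is_lim_seq_const.
  - replace (Finite 0) with (Rbar_mult (Finite 2) (Rbar_abs (Finite (k - k))))
      by (cbn; f_equal; rewrite Rminus_diag, Rabs_R0; ring).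
    apply is_lim_seq_scal_l, is_lim_seq_abs, is_lim_seq_minus'; [apply pot_x_cv | apply pot_y_cv].
Qed.

Lemma k_pos : 0 < k.
Proof. pose proof PI_RGT_0. apply Rdiv_lt_0_compat; lra. Qed.

(** In units of [l], the kernels at [x], [y] and [x - y] tend to [k], [k] and [k * beta]; the second
    form of [Psi] then tends to [k^2 / (2 k - k beta / 2)]. *)
Lemma Psi_cv : is_lim_seq (fun n => caphat (xs n :: ys n :: nil) / l n) (2 * k / (4 - beta)).
Proof.
  pose proof k_pos as Hk.
  replace (2 * k / (4 - beta)) with (k * k / (k + k - k * beta / 2 - 0 / 2)) by (field; repeat split; nra).
  apply is_lim_seq_ext_loc with (fun n => (pot (xs n) / l n) * (pot (ys n) / l n) /
    (pot (xs n) / l n + pot (ys n) / l n - pot (psub (xs n) (ys n)) / l n / 2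
     - (pot (xs n) - pot (ys n)) ^ 2 / pot (psub (xs n) (ys n)) / l n / 2)).
  - destruct l_pos_loc as [N HN]. exists N; intros n Hn. specialize (HN n Hn).
    destruct (Hne n) as [Hx [Hy' Hd]]. destruct (caphat_Psi _ _ Hx Hy' Hd) as [-> ->].
    set (Q := (pot (xs n) - pot (ys n)) ^ 2 / pot (psub (xs n) (ys n))).
    set (X := pot (xs n)). set (Y := pot (ys n)). set (Z := pot (psub (xs n) (ys n))).
    replace (X / l n + Y / l n - Z / l n / 2 - Q / l n / 2) with ((X + Y - Z / 2 - Q / 2) / l n) by (field; lra).
    apply scaled_quotient; lra.
  - apply is_lim_seq_div'; [apply is_lim_seq_mult'; [apply pot_x_cv | apply pot_y_cv] | | nra].
    repeat apply is_lim_seq_minus'; [apply is_lim_seq_plus'; [apply pot_x_cv | apply pot_y_cv] | |].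
    + apply (is_lim_seq_div' _ (fun _ => 2)); [apply pot_diff_cv | apply is_lim_seq_const | lra].
    + apply (is_lim_seq_div' _ (fun _ => 2)); [apply square_term_cv | apply is_lim_seq_const | lra].
Qed.

Lemma ln_vac a A : ln (vac a A) = - (PI * a * caphat A).
Proof. apply ln_exp. Qed.

Lemma ln_vac_pair_cv :
  is_lim_seq (fun n => ln (vac alpha (xs n :: ys n :: nil)) / l n) (- (4 * alpha / (4 - beta))).
Proof.
  pose proof PI_RGT_0.
  apply is_lim_seq_ext with (fun n => - (PI * alpha) * (caphat (xs n :: ys n :: nil) / l n)).
  { intros n. rewrite ln_vac. unfold Rdiv; ring. }
  replace (- (4 * alpha / (4 - beta))) with (- (PI * alpha) * (2 * k / (4 - beta))) by (unfold k; field; lra).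
  apply (is_lim_seq_scal_l _ (- (PI * alpha)) (2 * k / (4 - beta))), Psi_cv.
Qed.

Let gap (n : nat) : R :=
  PI * alpha * ((pot (xs n) + pot (ys n)) / 2 - caphat (xs n :: ys n :: nil)).

(** [exp (- gap n)] is the ratio of the product of the two vacancy probabilities to the joint one.
    On the scale [l] the gap has the limit [PI * alpha * k * (2 - beta) / (4 - beta)], positive
    since [beta <= 1]. *)
Lemma gap_large : exists N, forall n, (N <= n)%nat -> 1 <= gap n.
Proof.
  pose proof k_pos as Hk. pose proof PI_RGT_0 as Hpi.
  set (g := PI * alpha * ((k + k) / 2 - 2 * k / (4 - beta))).
  assert (Hg : is_lim_seq (fun n => gap n / l n) g).
  { apply is_lim_seq_ext with (fun n => PI * alpha * ((pot (xs n) / l n + pot (ys n) / l n) / 2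
                                              - caphat (xs n :: ys n :: nil) / l n)).
    { intros n; unfold gap, Rdiv; ring. }
    apply (is_lim_seq_scal_l _ (PI * alpha) ((k + k) / 2 - 2 * k / (4 - beta))).
    apply is_lim_seq_minus'; [|apply Psi_cv].
    apply (is_lim_seq_div' _ (fun _ => 2)); [|apply is_lim_seq_const | lra].
    apply is_lim_seq_plus'; [apply pot_x_cv | apply pot_y_cv]. }
  assert (Hg0 : 0 < g).
  { unfold g. apply Rmult_lt_0_compat; [nra|].
    replace ((k + k) / 2 - 2 * k / (4 - beta)) with (k * ((2 - beta) / (4 - beta))) by (field; lra).
    apply Rmult_lt_0_compat; [assumption | apply Rdiv_lt_0_compat; lra]. }
  apply is_lim_seq_Reals in Hg. destruct (Hg (g / 2)) as [N HN]; [lra|].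
  destruct (l_infty (2 / g)) as [N' HN']. exists (Nat.max N N'). intros n Hn.
  specialize (HN n ltac:(lia)). specialize (HN' n ltac:(lia)). unfold Rdist in HN. apply Rabs_def2 in HN.
  assert (0 < 2 / g) by (apply Rdiv_lt_0_compat; lra).
  replace (gap n) with (gap n / l n * l n) by (field; lra).
  apply Rle_trans with (g / 2 * (2 / g)); [apply Req_le; field; lra|].
  apply Rmult_le_compat; lra.
Qed.

Lemma vac_single_small x : x <> origin -> 0 < vac alpha (x :: nil) <= exp (- (PI * alpha / 2)).
Proof.
  intros Hx. rewrite vac_single. split; [apply exp_pos|]. apply exp_le_exp.
  pose proof (pot_ge_1 x Hx). pose proof PI_RGT_0. assert (0 < PI * alpha) by nra. nra.
Qed.

Lemma exp_half_lt_1 : exp (- (PI * alpha / 2)) < 1.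
Proof. rewrite <- exp_0. apply exp_increasing. pose proof PI_RGT_0. nra. Qed.

Lemma vac_product n : vac alpha (xs n :: nil) * vac alpha (ys n :: nil)
  = vac alpha (xs n :: ys n :: nil) * exp (- gap n).
Proof.
  rewrite !vac_single. unfold vac, gap. rewrite <- !exp_plus. f_equal; field.
Qed.

(** The covariance is the joint probability times [1 - exp (- gap n)], and the square root halves
    the logarithms of the single probabilities. What has no logarithmic growth is collected in the
    last bracket. *)
Lemma cor_ln n : 1 <= gap n -> 0 < cor alpha (xs n) (ys n) /\
  ln (cor alpha (xs n) (ys n)) =
    (PI * alpha * (pot (xs n) / 2 + pot (ys n) / 2)) / 2 - PI * alpha * caphat (xs n :: ys n :: nil)
    + (ln (1 - exp (- gap n)) - (ln (1 - vac alpha (xs n :: nil)) + ln (1 - vac alpha (ys n :: nil))) / 2).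
Proof.
  intros Hgap. destruct (Hne n) as [Hx [Hy' _]].
  pose proof (vac_single_small _ Hx) as Px. pose proof (vac_single_small _ Hy') as Py.
  pose proof exp_half_lt_1 as H1.
  unfold cor; cbv zeta. rewrite vac_product.
  set (pxy := vac alpha (xs n :: ys n :: nil)).
  assert (Lx : ln (vac alpha (xs n :: nil)) = - (PI * alpha * pot (xs n) / 2)) by (rewrite vac_single; apply ln_exp).
  assert (Ly : ln (vac alpha (ys n :: nil)) = - (PI * alpha * pot (ys n) / 2)) by (rewrite vac_single; apply ln_exp).
  assert (Lxy : ln pxy = - (PI * alpha * caphat (xs n :: ys n :: nil))) by apply ln_vac.
  assert (Pxy : 0 < pxy) by apply exp_pos.
  set (px := vac alpha (xs n :: nil)) in *. set (py := vac alpha (ys n :: nil)) in *.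
  assert (He : 0 < 1 - exp (- gap n)).
  { enough (exp (- gap n) < 1) by lra. rewrite <- exp_0. apply exp_increasing; lra. }
  assert (Hd : 0 < px * (1 - px) * (py * (1 - py))) by (repeat apply Rmult_lt_0_compat; lra).
  replace (pxy - pxy * exp (- gap n)) with (pxy * (1 - exp (- gap n))) by ring.
  assert (Hs := sqrt_lt_R0 _ Hd). split.
  - apply Rdiv_lt_0_compat; [apply Rmult_lt_0_compat|]; assumption.
  - rewrite ln_div, ln_mult by (try apply Rmult_lt_0_compat; assumption).
    assert (Lsqrt : ln (sqrt (px * (1 - px) * (py * (1 - py)))) = ln (px * (1 - px) * (py * (1 - py))) / 2).
    { rewrite <- (sqrt_sqrt (px * (1 - px) * (py * (1 - py)))) at 2 by lra.
      rewrite ln_mult by assumption. field. }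
    rewrite Lsqrt, !ln_mult by (repeat apply Rmult_lt_0_compat; lra).
    rewrite Lx, Ly, Lxy. field.
Qed.

Lemma ln_cor_cv : is_lim_seq (fun n => ln (cor alpha (xs n) (ys n)) / l n) (- (alpha * beta / (4 - beta))).
Proof.
  pose proof PI_RGT_0 as Hpi. pose proof exp_half_lt_1 as H1. destruct gap_large as [N HN].
  set (rest := fun n => ln (1 - exp (- gap n))
                        - (ln (1 - vac alpha (xs n :: nil)) + ln (1 - vac alpha (ys n :: nil))) / 2).
  apply is_lim_seq_ext_loc with (fun n =>
    PI * alpha * ((pot (xs n) / l n + pot (ys n) / l n) / 4 - caphat (xs n :: ys n :: nil) / l n) + rest n / l n).
  { exists N; intros n Hn. rewrite (proj2 (cor_ln n (HN n Hn))). fold (rest n). unfold Rdiv. generalize (/ l n). intros i. field. }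
  replace (- (alpha * beta / (4 - beta))) with (PI * alpha * ((k + k) / 4 - 2 * k / (4 - beta)) + 0)
    by (unfold k; field; lra).
  apply is_lim_seq_plus'.
  - apply (is_lim_seq_scal_l _ (PI * alpha) ((k + k) / 4 - 2 * k / (4 - beta))).
    apply is_lim_seq_minus'; [|apply Psi_cv].
    apply (is_lim_seq_div' _ (fun _ => 4)); [|apply is_lim_seq_const | lra].
    apply is_lim_seq_plus'; [apply pot_x_cv | apply pot_y_cv].
  (* [gap n >= 1], and each single probability is at most [exp (- PI alpha / 2) < 1], so the
     arguments of the three logarithms stay away from [0]. *)
  - apply bounded_div_cv_0 with (- ln (1 - exp (-1)) + - ln (1 - exp (- (PI * alpha / 2)))) N; [apply l_infty|].
    intros n Hn. specialize (HN n Hn). destruct (Hne n) as [Hx [Hy' _]].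
    assert (B1 : Rabs (ln (1 - exp (- gap n))) <= - ln (1 - exp (-1))).
    { apply ln_one_minus_bounded; [apply exp_pos | apply exp_le_exp; lra |].
      rewrite <- exp_0; apply exp_increasing; lra. }
    pose proof (vac_single_small _ Hx) as Px. pose proof (vac_single_small _ Hy') as Py.
    pose proof (ln_one_minus_bounded _ _ (proj1 Px) (proj2 Px) H1) as B2.
    pose proof (ln_one_minus_bounded _ _ (proj1 Py) (proj2 Py) H1) as B3.
    unfold rest. apply Rabs_le_between in B1, B2, B3. apply Rabs_le; lra.
Qed.

End PairAsymptotics.

(** ** Balls *)

Lemma zrange_spec c m z : In z (zrange c m) <-> (c - Z.of_nat m <= z <= c + Z.of_nat m)%Z.
Proof.
  unfold zrange. rewrite in_map_iff. split.
  - intros [j [<- Hj]]. apply in_seq in Hj. lia.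
  - intros Hz. exists (Z.to_nat (z - c + Z.of_nat m)). rewrite in_seq. lia.
Qed.

Lemma coordinate_le_norm u : Rabs (IZR (fst u)) <= norm u /\ Rabs (IZR (snd u)) <= norm u.
Proof.
  pose proof (norm_sq u). pose proof (norm_nonneg u).
  split; apply Rsqr_incr_0_var; try assumption; unfold Rsqr; rewrite <- Rabs_mult, Rabs_right; nra.
Qed.

Lemma ball_spec x r y : In y (ball x r) <-> norm (psub y x) <= r.
Proof.
  unfold ball. rewrite filter_In. destruct x as [x1 x2], y as [y1 y2]; cbn [fst snd]. unfold pt in *; rewrite in_prod_iff, !zrange_spec.
  destruct Rle_dec as [Hr|Hr]; [|split; [intros [_ E]; discriminate | contradiction]].
  split; [trivial|]. intros _. split; [|reflexivity].
  destruct (coordinate_le_norm (psub (y1, y2) (x1, x2))) as [H1 H2].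
  set (N := norm (psub (y1, y2) (x1, x2))) in *. rewrite <- abs_IZR in H1, H2; cbn [psub fst snd] in H1, H2.
  destruct (archimed r) as [Hup _].
  assert (A1 : (Z.abs (y1 - x1) < up r)%Z) by (apply lt_IZR; lra).
  assert (A2 : (Z.abs (y2 - x2) < up r)%Z) by (apply lt_IZR; lra).
  lia.
Qed.

Lemma norm_dirs e : In e dirs -> norm e = 1.
Proof.
  intros He. unfold norm.
  destruct He as [<-|[<-|[<-|[<-|[]]]]]; cbn [fst snd]; (transitivity (sqrt 1); [f_equal; ring | apply sqrt_1]).
Qed.

(* The equilibrium measure of a ball lives on its inner boundary, where [pot] is nearly constant. *)
Lemma caphat_ball : exists C, forall r, 0 < r ->
  Rabs (caphat (ball origin r) - 2 / PI * ln (Rmax r 2)) <= C.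
Proof.
  destruct pot_log as [C [HC Hpot]].
  assert (Hk : 0 < 2 / PI < 1).
  { pose proof PI2_3_2. split; [apply Rdiv_lt_0_compat; lra|]. apply Rmult_lt_reg_r with PI; [lra|].
    unfold Rdiv; rewrite Rmult_assoc, Rinv_l; lra. }
  assert (Hln2 : 0 < ln 2 < 1).
  { split; [rewrite <- ln_1; apply ln_increasing; lra|]. pose proof (ln_le_minus_1 2).
    destruct (Rle_lt_dec 1 (ln 2)) as [H1|]; [|assumption]. exfalso.
    apply exp_le_exp in H1. rewrite exp_ln in H1 by lra. pose proof (exp_ineq1 1 ltac:(lra)). lra. }
  (* The extra [1] pays for a loss of at most [ln 2]: a boundary point has norm at least
     [r - 1 >= r / 2] when [r >= 2], and for smaller [r] the logarithm is just [ln 2]. *)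
  exists (C + 1). intros r Hr. pose proof (Rmax_l r 2). pose proof (Rmax_r r 2).
  set (B := ball origin r). set (L := dedup B). destruct (dedup_spec B) as [L1 L2]. fold L in L1, L2.
  assert (HB : forall z, In z L <-> norm z <= r).
  { intros z. rewrite L2. unfold B. now rewrite ball_spec, psub_origin_r. }
  assert (Ho : In origin L) by (apply HB; rewrite norm_origin; lra).
  destruct (caphat_equilibrium B L L1) as [g [[_ [Es [Ep Ec]]] [_ Hbdry]]].
  { intros z. rewrite L2. split; [intros [<-|]; [now apply L2 | assumption] | now right]. }
  assert (Hc : caphat B = lsum (fun z => g z * pot z) L).
  { rewrite <- (Ec origin Ho). apply lsum_ext; intros z _. now rewrite pot_psub_origin_l. }
  assert (Hln : ln 2 <= ln (Rmax r 2)) by (apply ln_le; lra).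
  apply Rabs_le; split.
  - assert (Hlow : 2 / PI * ln (Rmax r 2) - (C + 1) <= caphat B); [|lra].
    rewrite Hc. destruct (Rle_or_lt 2 r) as [H2|H2].
    + rewrite Rmax_left by lra.
      apply Rle_trans with (lsum (fun z => g z * (2 / PI * ln r - (C + 1))) L); [rewrite lsum_mult_r, Es; lra|].
      apply lsum_le. intros z Hz.
      destruct (classic (forall e, In e dirs -> In (padd z e) L)) as [Hi|Hi]; [rewrite (Hbdry z Hz Hi); lra|].
      apply Rmult_le_compat_l; [now apply Ep|].
      apply not_all_ex_not in Hi as [e He]. apply imply_to_and in He as [He Hout].
      rewrite HB in Hout. apply Rnot_le_lt in Hout. pose proof (norm_triang z e) as T. rewrite (norm_dirs e He) in T.
      assert (Hz2 : r / 2 <= norm z) by lra.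
      specialize (Hpot z (norm_gt_nonorigin z ltac:(lra))). apply Rabs_le_between in Hpot.
      assert (ln r - ln 2 <= ln (norm z)) by (rewrite <- ln_div by lra; apply ln_le; lra).
      nra.
    + rewrite Rmax_right by lra. apply Rle_trans with 0; [nra|].
      replace 0 with (lsum (fun _ : pt => 0) L) by (rewrite lsum_const; ring).
      apply lsum_le; intros z Hz. apply Rmult_le_pos; [now apply Ep | apply pot_nonneg].
  - assert (Hup : caphat B <= 2 / PI * ln (Rmax r 2) + (C + 1)); [|lra].
    rewrite Hc. apply Rle_trans with (lsum (fun z => g z * (2 / PI * ln (Rmax r 2) + (C + 1))) L);
      [|rewrite lsum_mult_r, Es; lra].
    apply lsum_le. intros z Hz. apply Rmult_le_compat_l; [now apply Ep|].
    destruct (pt_eq_dec z origin) as [->|Hz0]; [rewrite pot_origin; nra|].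
    specialize (Hpot z Hz0). apply Rabs_le_between in Hpot. apply HB in Hz.
    assert (ln (norm z) <= ln (Rmax r 2)) by (apply ln_le; [pose proof (norm_pos z Hz0); lra | lra]).
    nra.
Qed.

(** Translation by [- x] carries the implicit origin to [popp x] and the ball to the centred one,
    which already contains the origin. The ball problem thus becomes that of a distant point added
    to a centred set. *)
Lemma caphat_ball_translate x r : 0 < r -> caphat (ball x r) = caphat (popp x :: ball origin r).
Proof.
  intros Hr. apply (caphat_invariant (fun z => psub z x)).
  - intros u v. f_equal. unfold psub; cbn; f_equal; lia.
  - intros [u1 u2] [v1 v2]. unfold psub; cbn; intros E; injection E; intros; f_equal; lia.
  - intros z. cbn [map In]. rewrite in_map_iff, ball_spec, psub_origin_r.
    change (psub origin x) with (popp x).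
    assert (E : (exists y, psub y x = z /\ In y (ball x r)) <-> norm z <= r).
    { split.
      - intros [y [<- Hy]]. now apply ball_spec.
      - intros Hz. exists (padd z x).
        assert (E : psub (padd z x) x = z) by (destruct z, x; unfold psub, padd; cbn; f_equal; lia).
        split; [exact E|]. apply ball_spec. now rewrite E. }
    rewrite E. split; [|tauto]. intros [<-|H]; [|tauto]. right. rewrite norm_origin; lra.
Qed.

Lemma ln_pos_gt_1 u : 0 < ln u -> 1 < u.
Proof.
  intros H. apply Rnot_le_lt; intros Hu.
  destruct (Rlt_le_dec 0 u) as [H0|H0].
  - pose proof (ln_le u 1 H0 Hu) as A. rewrite ln_1 in A. lra.
  (* [ln] takes the default value [0] on nonpositive reals. *)
  - unfold ln in H. destruct (Rlt_dec 0 u); lra.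
Qed.

Lemma ln_vac_ball_cv alpha beta (ss : nat -> R) (xs : nat -> pt) (rs : nat -> R) :
  0 < alpha -> 0 <= beta < 1 -> (forall n, 0 < rs n) -> cv_infty ss ->
  Un_cv (fun n => ln (norm (xs n)) / ln (ss n)) 1 ->
  Un_cv (fun n => ln (rs n) / ln (ss n)) beta ->
  Un_cv (fun n => ln (vac alpha (ball (xs n) (rs n))) / ln (ss n)) (- (2 * alpha / (2 - beta))).
Proof.
  intros Halpha Hbeta Hrs Hss Hx Hr.
  set (l := fun n => ln (ss n)). assert (Hl : cv_infty l) by apply cv_infty_ln, Hss.
  set (k := 2 / PI). pose proof PI_RGT_0 as Hpi. assert (Hk : 0 < k) by (apply Rdiv_lt_0_compat; lra).
  (* When [beta = 0] the radii may be small, even below [1]. Raising them to [2] gives an admissible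
     bound for [caphat_add] and leaves the limit of the logarithmic ratio unchanged. *)
  set (r' := fun n => Rmax (rs n) 2).
  assert (Hr'2 : forall n, 2 <= r' n) by (intros n; apply Rmax_r).
  assert (Hr'r : forall n, rs n <= r' n) by (intros n; apply Rmax_l).
  assert (Hr' : is_lim_seq (fun n => ln (r' n) / l n) beta).
  { apply is_lim_seq_Reals. intros eps Heps. destruct (Hr eps Heps) as [N HN].
    destruct (Hl (Rmax 0 (ln 2 / eps))) as [N' HN']. exists (Nat.max N N'). intros n Hn.
    specialize (HN n ltac:(lia)). specialize (HN' n ltac:(lia)). fold (l n) in HN.
    pose proof (Rmax_l 0 (ln 2 / eps)). pose proof (Rmax_r 0 (ln 2 / eps)).
    unfold r'. unfold Rmax. destruct (Rle_dec (rs n) 2) as [H2|H2]; [|exact HN].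
    assert (Hl0 : 0 < l n) by lra. unfold Rdist in *. apply Rabs_def2 in HN.
    assert (ln (rs n) / l n <= ln 2 / l n).
    { apply Rmult_le_compat_r; [apply Rlt_le, Rinv_0_lt_compat, Hl0|]. apply ln_le; [apply Hrs | assumption]. }
    assert (ln 2 / l n < eps).
    { apply Rmult_lt_reg_r with (l n); [assumption|]. unfold Rdiv; rewrite Rmult_assoc, Rinv_l by lra.
      assert (HN2 : ln 2 / eps < l n) by lra.
      apply Rmult_lt_compat_l with (r := eps) in HN2; [|lra].
      replace (eps * (ln 2 / eps)) with (ln 2) in HN2 by (field; lra). lra. }
    apply Rabs_def1; lra. }
  assert (Hfar : exists N, forall n, (N <= n)%nat -> 0 < l n /\ 2 * r' n <= norm (xs n)).
  (* With this [eps], [beta + 2 * eps < 1 - eps]: one [eps] covers the fluctuation of the radius,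
     one the factor [2], and one the fluctuation of the norm. *)
  { apply is_lim_seq_Reals in Hr'. set (eps := (1 - beta) / 4).
    assert (Heps : 0 < eps) by (unfold eps; lra).
    destruct (Hx eps Heps) as [N1 H1]. destruct (Hr' eps Heps) as [N2 H2].
    destruct (Hl (ln 2 / eps)) as [N3 H3]. exists (Nat.max N1 (Nat.max N2 N3)). intros n Hn.
    specialize (H1 n ltac:(lia)). specialize (H2 n ltac:(lia)). specialize (H3 n ltac:(lia)).
    assert (Hln2 : 0 < ln 2) by (rewrite <- ln_1; apply ln_increasing; lra).
    assert (0 < ln 2 / eps) by (apply Rdiv_lt_0_compat; lra).
    assert (Hl0 : 0 < l n) by lra. split; [assumption|].
    fold (l n) in H1. unfold Rdist in *. apply Rabs_def2 in H1, H2.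
    assert (E1 : (1 - eps) * l n < ln (norm (xs n))).
    { replace (ln (norm (xs n))) with (ln (norm (xs n)) / l n * l n) by (field; lra).
      apply Rmult_lt_compat_r; lra. }
    assert (E2 : ln (r' n) < (beta + eps) * l n).
    { replace (ln (r' n)) with (ln (r' n) / l n * l n) by (field; lra).
      apply Rmult_lt_compat_r; lra. }
    assert (E3 : ln 2 < eps * l n).
    { apply Rmult_lt_compat_l with (r := eps) in H3; [|lra].
      replace (eps * (ln 2 / eps)) with (ln 2) in H3 by (field; lra). assumption. }
    pose proof (Hr'2 n).
    assert (E4 : ln (2 * r' n) < ln (norm (xs n))).
    { rewrite ln_mult by lra. unfold eps in *. nra. }
    assert (1 < norm (xs n)).
    { apply ln_pos_gt_1. assert (0 < ln (2 * r' n)); [|lra]. rewrite <- ln_1. apply ln_increasing; lra. }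
    left. apply ln_lt_inv; lra. }
  destruct Hfar as [N0 Hfar].
  assert (Hx0 : forall n, (N0 <= n)%nat -> xs n <> origin).
  { intros n Hn. apply norm_gt_nonorigin. pose proof (proj2 (Hfar n Hn)). pose proof (Hr'2 n). lra. }
  assert (Ha : is_lim_seq (fun n => pot (xs n) / l n) k).
  { replace k with (2 / PI * 1) by (unfold k; ring).
    apply (pot_div_cv xs l 1 N0 Hl Hx0). apply is_lim_seq_Reals, Hx. }
  destruct caphat_ball as [CB HB].
  assert (Hc : is_lim_seq (fun n => caphat (ball origin (rs n)) / l n) (k * beta)).
  { replace (k * beta) with (k * beta + 0) by ring.
    apply is_lim_seq_ext with (fun n => k * (ln (r' n) / l n) + (caphat (ball origin (rs n)) - k * ln (r' n)) / l n).
    { intros n; unfold Rdiv; ring. }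
    apply is_lim_seq_plus'; [apply (is_lim_seq_scal_l _ k beta), Hr'|].
    apply bounded_div_cv_0 with CB 0%nat; [assumption|]. intros n _. apply HB, Hrs. }
  destruct caphat_add as [C [HC Hadd]].
  (* The deviations are only known to exist for each [n]; packed into a pair, with a dummy value
     before [N0], they can be chosen as sequences. *)
  assert (Hd : forall n, exists d : R * R, (N0 <= n)%nat ->
     Rabs (fst d) <= C /\ Rabs (snd d) <= C /\
     caphat (ball (xs n) (rs n)) =
       (pot (xs n) + fst d) * (pot (xs n) + snd d) /
       (2 * pot (xs n) + fst d + snd d - caphat (ball origin (rs n)))).
  { intros n. destruct (le_lt_dec N0 n) as [Hn|Hn]; [|exists (0, 0); lia].
    destruct (Hfar n Hn) as [_ Hf]. pose proof (Hr'2 n).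
    destruct (Hadd (ball origin (rs n)) (popp (xs n)) (r' n)) as [d1 [d2 [H1 [H2 [_ E]]]]].
    - lra.
    - apply ball_spec. rewrite psub_origin_r, norm_origin. apply Rlt_le, Hrs.
    - intros z Hz. apply ball_spec in Hz. rewrite psub_origin_r in Hz. pose proof (Hr'r n). lra.
    - now rewrite norm_popp.
    - exists (d1, d2); intros _; cbn [fst snd]. rewrite norm_popp in H1, H2. rewrite pot_opp in E.
      assert (Hq : C * (r' n / norm (xs n)) <= C).
      { rewrite <- (Rmult_1_r C) at 2. apply Rmult_le_compat_l; [lra|].
        apply Rmult_le_reg_r with (norm (xs n)); [lra|]. unfold Rdiv; rewrite Rmult_assoc, Rinv_l; lra. }
      split; [lra|]. split; [lra|]. rewrite caphat_ball_translate by apply Hrs. exact E. }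
  set (d := fun n => proj1_sig (constructive_indefinite_description _ (Hd n))).
  assert (Hd' : forall n, (N0 <= n)%nat -> Rabs (fst (d n)) <= C /\ Rabs (snd (d n)) <= C /\
     caphat (ball (xs n) (rs n)) =
       (pot (xs n) + fst (d n)) * (pot (xs n) + snd (d n)) /
       (2 * pot (xs n) + fst (d n) + snd (d n) - caphat (ball origin (rs n)))).
  { intros n. exact (proj2_sig (constructive_indefinite_description _ (Hd n))). }
  clearbody d.
  assert (D1 : is_lim_seq (fun n => fst (d n) / l n) 0).
  { apply bounded_div_cv_0 with C N0; [assumption|]. intros n Hn. apply Hd', Hn. }
  assert (D2 : is_lim_seq (fun n => snd (d n) / l n) 0).
  { apply bounded_div_cv_0 with C N0; [assumption|]. intros n Hn. apply Hd', Hn. }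
  apply is_lim_seq_Reals.
  replace (- (2 * alpha / (2 - beta)))
    with (- (PI * alpha) * ((k + 0) * (k + 0) / (2 * k + 0 + 0 - k * beta))) by (unfold k; field; repeat split; nra).
  apply is_lim_seq_ext_loc with (fun n => - (PI * alpha) *
    ((pot (xs n) / l n + fst (d n) / l n) * (pot (xs n) / l n + snd (d n) / l n) /
     (2 * (pot (xs n) / l n) + fst (d n) / l n + snd (d n) / l n - caphat (ball origin (rs n)) / l n))).
  { exists N0; intros n Hn. destruct (Hfar n Hn) as [Hl0 _]. rewrite ln_vac.
    rewrite (proj2 (proj2 (Hd' n Hn))). fold (l n).
    set (a := pot (xs n)). set (c := caphat (ball origin (rs n))).
    replace (2 * (a / l n) + fst (d n) / l n + snd (d n) / l n - c / l n)
      with ((2 * a + fst (d n) + snd (d n) - c) / l n) by (field; lra).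
    replace (a / l n + fst (d n) / l n) with ((a + fst (d n)) / l n) by (field; lra).
    replace (a / l n + snd (d n) / l n) with ((a + snd (d n)) / l n) by (field; lra).
    rewrite scaled_quotient by lra. unfold Rdiv; ring. }
  apply (is_lim_seq_scal_l _ (- (PI * alpha)) ((k + 0) * (k + 0) / (2 * k + 0 + 0 - k * beta))).
  apply is_lim_seq_div'.
  - apply is_lim_seq_mult'; apply is_lim_seq_plus'; assumption.
  - apply is_lim_seq_minus'; [|assumption]. repeat (apply is_lim_seq_plus'; [|assumption]).
    apply (is_lim_seq_scal_l _ 2 k), Ha.
  - nra.
Qed.

Theorem theorem2p3 :
  (* (i) *)
  (forall (alpha : R) (x : pt) (A : list pt), 0 < alpha ->
     cond alpha A x = cond alpha (map (fun z => psub x z) A) x) /\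
  (forall (alpha : R) (x : pt) (A : list pt) (M : pt -> pt),
     0 < alpha -> x <> origin -> isometry M -> M origin = x -> M x = origin ->
     cond alpha A x = cond alpha (map M A) x) /\
  (* (ii) *)
  (forall (alpha : R) (x : pt), 0 < alpha ->
     vac alpha (x :: nil) = exp (- (PI * alpha * pot x / 2))) /\
  (forall alpha : R, 0 < alpha -> exists C R0 : R, forall x : pt, R0 <= norm x ->
     Rabs (vac alpha (x :: nil) /
           (exp (- (gamma' * PI * alpha / 2)) * Rpower (norm x) (- alpha)) - 1)
       <= C / norm x ^ 2) /\
  (* (iii) *)
  (exists C1 C2 : R, forall (alpha r : R) (A : list pt) (x : pt),
     0 < alpha -> 2 <= r -> In origin A -> (forall z, In z A -> norm z <= r) ->
     2 * r <= norm x ->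
     exists th1 th2 : R,
       Rabs th1 <= C1 * (r * ln r * ln (norm x) / norm x) /\
       Rabs th2 <= C2 * (r * ln r / norm x) /\
       cond alpha A x =
         exp (- (PI * alpha / 4 * cap A * (1 + th1) /
                 (1 - cap A / (2 * pot x) + th2)))) /\
  (* (iv) *)
  (forall (alpha : R) (x y : pt), 0 < alpha -> x <> origin -> y <> origin -> x <> y ->
     vac alpha (x :: y :: nil) = exp (- (PI * alpha * Psi x y))) /\
  (forall (alpha beta : R) (xs ys : nat -> pt),
     0 < alpha -> 0 <= beta <= 1 ->
     (forall n, xs n <> origin /\ ys n <> origin /\ xs n <> ys n) ->
     cv_infty (fun n => norm (xs n)) ->
     Un_cv (fun n => ln (norm (ys n)) / ln (norm (xs n))) 1 ->
     Un_cv (fun n => ln (norm (psub (xs n) (ys n))) / ln (norm (xs n))) beta ->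
     Un_cv (fun n => ln (vac alpha (xs n :: ys n :: nil)) / ln (norm (xs n)))
           (- (4 * alpha / (4 - beta))) /\
     (exists N : nat, forall n, (N <= n)%nat -> 0 < cor alpha (xs n) (ys n)) /\
     Un_cv (fun n => ln (cor alpha (xs n) (ys n)) / ln (norm (xs n)))
           (- (alpha * beta / (4 - beta)))) /\
  (* (v) *)
  (forall (alpha beta : R) (ss : nat -> R) (xs : nat -> pt) (rs : nat -> R),
     0 < alpha -> 0 <= beta < 1 -> (forall n, 0 < rs n) ->
     cv_infty ss ->
     Un_cv (fun n => ln (norm (xs n)) / ln (ss n)) 1 ->
     Un_cv (fun n => ln (rs n) / ln (ss n)) beta ->
     Un_cv (fun n => ln (vac alpha (ball (xs n) (rs n))) / ln (ss n))
           (- (2 * alpha / (2 - beta)))).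
Proof.
  split; [|split; [|split; [|split; [|split; [|split; [|split]]]]]].
  - intros alpha x A _. apply cond_isometry; [apply isometry_reflection | apply psub_origin_r | now apply psub_eq_origin].
  - intros alpha x A M _ _ HM H0 Hx. now apply cond_isometry.
  - intros alpha x _. apply vac_single.
  - intros alpha Ha. exact (vac_single_asymptotic alpha Ha).
  - exact cond_ball_estimate.
  - intros alpha x y _ Hx Hy Hxy. unfold vac. now rewrite (proj1 (caphat_Psi x y Hx Hy Hxy)).
  - intros alpha beta xs ys Ha Hb Hne Hinf Hy Hxy. split; [|split].
    + apply is_lim_seq_Reals. now apply ln_vac_pair_cv.
    + destruct (gap_large alpha beta xs ys Ha Hb Hne Hinf Hy Hxy) as [N HN].
      exists N; intros n Hn. apply cor_ln; auto.
    + apply is_lim_seq_Reals. now apply ln_cor_cv.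
  - exact ln_vac_ball_cv.
Qed.
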